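(* For each $\Lambda \in X$, the sequences $\{G_{n,\Lambda}^{+}\}_{n\ge1}$ and $\{G_{n,\Lambda}^{-}\}_{n\ge1}$ converge locally uniformly on $\mathbb{C}^2$, as $n\to\infty$, to non-negative, locally Hölder continuous plurisubharmonic functions $G_\Lambda^{+}$ and $G_\Lambda^{-}$ respectively. For every $\lambda\in M$ and $\Lambda\in X$, \[ G_\Lambda^{\pm}\circ H_\lambda^{\pm1} = d\, G_{\lambda\Lambda}^{\pm}. \] The functions $G_\Lambda^{\pm}$ are positive and pluriharmonic on $I_\Lambda^{\pm}=\mathbb{C}^2\setminus K_\Lambda^{\pm}$, and vanish precisely on $K_\Lambda^{\pm}$. Furthermore, there exists $C>0$ such that \[ 0\le G_\Lambda^{\pm}(z)\le \log^+\Vert z\Vert + C \] for all $\Lambda\in X$ and $z\in\mathbb{C}^2$. Finally, the correspondences $\Lambda\mapsto G_\Lambda^{\pm}$ are continuous (with respect to the product topology on $X$ and the topology of locally uniform convergence on $\mathbb{C}^2$). Each assertion containing $\pm$ is understood for both the upper and the lower choice of signs.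
   Context: Let $M\subset\mathbb{C}^k$ be compact. For each $\lambda\in M$ let \[ H_\lambda = H_\lambda^{(s)}\circ H_\lambda^{(s-1)}\circ\cdots\circ H_\lambda^{(1)}:\mathbb{C}^2\to\mathbb{C}^2,\qquad H_\lambda^{(j)}(x,y) = (y,\, p_{j,\lambda}(y) - a_j(\lambda)x), \] where the number of factors $s\ge1$ and the degrees $d_j\ge2$ do not depend on $\lambda$, $p_{j,\lambda}(y)$ is a monic polynomial of degree $d_j$ whose coefficients are continuous functions of $\lambda\in M$, and $a_j$ is a continuous function on $M$ with $a_j(\lambda)\ne0$ for all $\lambda$. Each $H_\lambda$ is a polynomial automorphism of $\mathbb{C}^2$ of degree $d=d_1d_2\cdots d_s$. Let $X=M\times M\times\cdots$ (countably many copies) with the product topology. For $\Lambda=(\lambda_1,\lambda_2,\ldots)\in X$ and $\lambda\in M$ put $\lambda\Lambda=(\lambda,\lambda_1,\lambda_2,\ldots)\in X$, and for $n\ge1$ put \[ H_{n,\Lambda}^{\pm} = H_{\lambda_n}^{\pm1}\circ H_{\lambda_{n-1}}^{\pm1}\circ\cdots\circ H_{\lambda_1}^{\pm1},\qquad G_{n,\Lambda}^{\pm}(z)=\frac1{d^n}\log^+\Vert H_{n,\Lambda}^{\pm}(z)\Vert, \] where $\log^+t=\max\{\log t,0\}$. Define \[ I_\Lambda^{\pm}=\{z\in\mathbb{C}^2:\Vert H_{n,\Lambda}^{\pm}(z)\Vert\to\infty \text{ as } n\to\infty\},\qquad K_\Lambda^{\pm}=\{z\in\mathbb{C}^2: (H_{n,\Lambda}^{\pm}(z))_{n\ge0}\text{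 is bounded in }\mathbb{C}^2\}. \] *)

(* Defs.v *)
From HB Require Import structures.
From mathcomp Require Export all_boot all_order all_algebra.
From mathcomp Require Export all_classical all_reals all_analysis.
From mathcomp Require Export complex.

Set Implicit Arguments.
Unset Strict Implicit.
Unset Printing Implicit Defensive.

Import Order.TTheory GRing.Theory Num.Theory.
Export numFieldNormedType.Exports.

Local Open Scope classical_set_scope.
Local Open Scope ring_scope.

(* The library gives R[i] its usual topology and norm only through the alias
   R[i]^o; transfer them to R[i] itself. *)
HB.instance Definition _ (R : realType) := PseudoPointedMetric.copy R[i] R[i]^o.
HB.instance Definition _ (R : realType) := GRing.ComAlgebra.copy R[i] R[i]^o.
HB.instance Definition _ (R : realType) := Vector.copy R[i] R[i]^o.
HB.instance Definition _ (R : realType) := NormedModule.copy R[i] R[i]^o.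

Notation "''C2[' R ]" := (R[i] * R[i])%type (format "''C2[' R ]") : type_scope.

Section FunctionsOnC2.
Variable R : realType.
Implicit Types (z w v b : 'C2[R]) (u : 'C2[R] -> R) (A : set 'C2[R]).

(* Euclidean norm; the library norm on a product is the sup norm. *)
Definition enorm z : R :=
  Num.sqrt (ComplexField.Normc.normc z.1 ^+ 2 +
            ComplexField.Normc.normc z.2 ^+ 2).

(* ln 0 = 0 in the library, so this is 0 at t = 0, as it should be. *)
Definition logplus (t : R) : R := Num.max (ln t) 0.

Definition locally_hoelder u : Prop :=
  forall z0, exists alpha L : R, 0 < alpha <= 1 /\
    exists2 U : set 'C2[R], nbhs z0 U &
      forall z w, U z -> U w -> `|u z - u w| <= L * (enorm (z - w) `^ alpha).

(* u takes values in [-oo, +oo[, is upper semicontinuous, and satisfies the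
   sub-mean value inequality on every closed disc
   {z + zeta b : |zeta| <= 1} of every complex line. The integral may be -oo. *)
Definition plurisubharmonic (u : 'C2[R] -> \bar R) : Prop :=
  [/\ forall z, (u z < +oo)%E,
      lower_semicontinuous (fun z => - u z)%E &
      forall z b,
        (u z <= ((2 * pi)^-1)%R%:E *
           \int[lebesgue_measure]_(t in `[0%R, (2 * pi)%R])
              u (z + (cos t +i* sin t)%C *: b)%R)%E].

(* Derivative at z in the direction of v, C^2 being seen as a real vector
   space. *)
Definition dirderive v u z : R :=
  derive1 (fun t : R => u (z + (t%:C)%C *: v)) 0.

(* For v in {(1,0), (i,0), (0,1), (0,i)} these are the real partial
   derivatives, so on an open set of_class_C1 and of_class_C2 say that u is
   continuously differentiable once, resp. twice, as a function of four real
   variables. *)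
Definition of_class_C1 A u : Prop :=
  forall v z, A z ->
    derivable (fun t : R => u (z + (t%:C)%C *: v)) 0 1 /\
    {for z, continuous (dirderive v u)}.

Definition of_class_C2 A u : Prop :=
  of_class_C1 A u /\ forall v, of_class_C1 A (dirderive v u).

(* The last condition says that zeta |-> u (z + zeta b) is harmonic: its left
   side is the Laplacian of this function of zeta = s + i t at zeta = 0. *)
Definition pluriharmonic_on A u : Prop :=
  [/\ open A, of_class_C2 A u &
      forall z b, A z ->
        dirderive b (dirderive b u) z +
        dirderive ('i%C *: b) (dirderive ('i%C *: b) u) z = 0].

End FunctionsOnC2.

Section HenonFamily.
Variables (R : realType) (k s : nat).
Local Notation param := 'rV[R[i]]_k.
Variables (p : 'I_s -> param -> {poly R[i]}) (a : 'I_s -> param -> R[i]).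
Implicit Types (l : param) (z : 'C2[R]) (e : bool).

Definition henon_factor (j : 'I_s) l z : 'C2[R] :=
  (z.2, (p j l).[z.2] - a j l * z.1).

Definition henon_factor_inv (j : 'I_s) l z : 'C2[R] :=
  (((p j l).[z.1] - z.2) / a j l, z.1).

(* The factor of index 0 is applied first. *)
Definition henon l z : 'C2[R] :=
  foldl (fun w j => henon_factor j l w) z (enum 'I_s).

Definition henon_inv l z : 'C2[R] :=
  foldr (fun j w => henon_factor_inv j l w) z (enum 'I_s).

Lemma henon_factorK j l : a j l != 0 ->
  cancel (henon_factor j l) (henon_factor_inv j l).
Proof.
move=> a0 [x y]; rewrite /henon_factor /henon_factor_inv /=.
by rewrite opprB addrC subrK mulrC mulKf.
Qed.

Lemma henon_factor_invK j l : a j l != 0 ->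
  cancel (henon_factor_inv j l) (henon_factor j l).
Proof.
move=> a0 [x y]; rewrite /henon_factor /henon_factor_inv /=.
by rewrite mulrC divfK // opprB addrC subrK.
Qed.

Lemma henonK l : (forall j, a j l != 0) -> cancel (henon l) (henon_inv l).
Proof.
move=> a0 z; rewrite /henon /henon_inv.
elim: (enum 'I_s) z => //= j r IH z.
by rewrite IH henon_factorK.
Qed.

Lemma henon_invK l : (forall j, a j l != 0) -> cancel (henon_inv l) (henon l).
Proof.
move=> a0 z; rewrite /henon /henon_inv.
elim: (enum 'I_s) => //= j r IH.
by rewrite henon_factor_invK.
Qed.

(* Signs are booleans: true for +, false for -. *)
Definition henon_pm e l : 'C2[R] -> 'C2[R] :=
  if e then henon l else henon_inv l.

(* A sequence (lambda_1, lambda_2, ...) is a function on nat whose value at n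
   is lambda_(n+1). *)
Fixpoint henon_iter e (L : nat -> param) (n : nat) z : 'C2[R] :=
  if n is m.+1 then henon_pm e (L m) (henon_iter e L m z) else z.

Definition green_seq (d : nat) e (L : nat -> param) (n : nat) z : R :=
  ((d ^ n)%N%:R)^-1 * logplus (enorm (henon_iter e L n z)).

Definition escaping_set e (L : nat -> param) : set 'C2[R] :=
  [set z | (fun n => enorm (henon_iter e L n z)) @ \oo --> +oo].

Definition bounded_orbit_set e (L : nat -> param) : set 'C2[R] :=
  [set z | exists B : R, forall n, enorm (henon_iter e L n z) <= B].

End HenonFamily.

Definition seq_space (T : Type) (M : set T) : set (nat -> T) :=
  [set L | forall n, M (L n)].

Definition seq_cons (T : Type) (x : T) (L : nat -> T) : nat -> T :=
  fun n => if n is m.+1 then L m else x.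

(* Main.v *)
(* Up to an exchange of coordinates for the minus sign, the maps H_{n,Lambda}
   are orbits of steps (x, y) |-> (y, q(y) - b x): the inverse of a Henon map
   is such a step with (p / a, 1 / a) in place of (p, a). For r large, the cone
   |y| >= max(r, |x|) is invariant, |y| is there raised to the power deg q up
   to a constant factor, and an orbit starting in the bidisc of radius r stays
   in it until it enters the cone. So log max(r, |x|, |y|) is multiplied by
   deg q at each step, up to a bounded error, and its normalizations converge
   geometrically, uniformly on the bidisc and in Lambda. Two orbits stay close
   relative to their size for about log(1/delta) steps if they start at
   distance delta and their steps differ by delta; this gives both Hoelder
   continuity and continuity in Lambda.
   In the cone, the Green function is the limit of log|y_m| / deg(y_m). The
   logarithmic derivatives of y_m obey linear recursions whose coefficients
   converge like 1 / |y_m|, so the first and second derivatives converge locally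
   uniformly, and the Laplacian of log|y_m| along complex lines vanishes since
   y_m is a polynomial. The sub-mean value inequality follows from Jensen's
   inequality for polynomials, proved by averaging over roots of unity. *)

Require Import Defs.
From mathcomp Require Import ring lra.

Import Order.TTheory GRing.Theory Num.Theory.

Set Implicit Arguments.
Unset Strict Implicit.
Unset Printing Implicit Defensive.

Local Open Scope classical_set_scope.
Local Open Scope ring_scope.
Local Notation Re := complex.Re.
Local Notation Im := complex.Im.

(** * Modulus and sup norm *)

Section Modulus.
Variable R : realType.
Implicit Types (z w : R[i]) (v : 'C2[R]).

(** A step enters the orbit estimates only through three numbers [N], [B], [c], which compactness of
    [M] supplies for both signs at once; this is where uniformity in Lambda comes from. Time is
    counted in single factors rather than in whole maps, so that all steps have one shape. Two
    floors for the norm coexist. A large floor [r] gives two-sided control of each step, with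
    constants that depend on [r]. The floor 1 gives an upper bound free of [r], hence the global
    estimate by log^+ plus a constant. The functions log|y_m| / deg(y_m) are smooth only away from
    the zeros of y_m, so derivatives are followed only once the orbit is in the cone. First
    derivatives divided by y_m grow like the degree, which the normalization absorbs. Second ones
    may grow like its square, and only the combination that is the second derivative of log y_m has
    the right growth. The discrete form of Jensen's inequality breaks down when a root lies on the
    circle. It is therefore used on a circle of radius slightly below 1, chosen after the iterate,
    and uniform continuity of the Green function carries the result to radius 1. *)

Definition cmod z : R := ComplexField.Normc.normc z.

Lemma normr_cmod z : `|z| = (cmod z)%:C%C. Proof. by []. Qed.

Lemma cmodE z : cmod z = Num.sqrt (Re z ^+ 2 + Im z ^+ 2).
Proof. by case: z. Qed.

Lemma cmod_sqr z : cmod z ^+ 2 = Re z ^+ 2 + Im z ^+ 2.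
Proof. by rewrite cmodE sqr_sqrtr // addr_ge0 // sqr_ge0. Qed.

Lemma cmod_ge0 z : 0 <= cmod z.
Proof. by rewrite cmodE sqrtr_ge0. Qed.

Lemma cmod0 : cmod 0 = 0. Proof. exact: ComplexField.Normc.normc0. Qed.

Lemma cmod1 : cmod 1 = 1. Proof. exact: ComplexField.Normc.normc1. Qed.

Lemma cmodM z w : cmod (z * w) = cmod z * cmod w.
Proof. exact: ComplexField.Normc.normcM. Qed.

Lemma cmodV z : cmod z^-1 = (cmod z)^-1.
Proof. exact: ComplexField.Normc.normcV. Qed.

Lemma cmodX z n : cmod (z ^+ n) = cmod z ^+ n.
Proof. by elim: n => [|n IH]; rewrite ?expr0 ?cmod1 // !exprS cmodM IH. Qed.

Lemma cmod_eq0 z : (cmod z == 0) = (z == 0).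
Proof.
apply/eqP/eqP => [/ComplexField.Normc.eq0_normc//|->]; exact: cmod0.
Qed.

Lemma cmod_gt0 z : (0 < cmod z) = (z != 0).
Proof. by rewrite lt_def cmod_ge0 andbT cmod_eq0. Qed.

Lemma cmodN z : cmod (- z) = cmod z. Proof. exact: normcN. Qed.

Lemma cmodD z w : cmod (z + w) <= cmod z + cmod w.
Proof. exact: le_normcD. Qed.

Lemma cmodB z w : cmod (z - w) <= cmod z + cmod w.
Proof. by rewrite -(cmodN w) cmodD. Qed.

Lemma cmodBC z w : cmod (z - w) = cmod (w - z).
Proof. by rewrite -cmodN opprB. Qed.

Lemma cmodB_ge z w : cmod z - cmod w <= cmod (z - w).
Proof. by rewrite lerBlDr -{1}(subrK w z) cmodD. Qed.

Lemma cmodR (x : R) : cmod x%:C%C = `|x|.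
Proof. by rewrite cmodE /= expr0n addr0 sqrtr_sqr. Qed.

Lemma cmod_nat n : cmod n%:R = n%:R.
Proof.
rewrite -[n%:R in LHS](rmorph_nat (real_complex R)) [LHS]cmodR.
by rewrite ger0_norm // ler0n.
Qed.

Lemma cmod_sum (I : Type) (s : seq I) (P : pred I) (F : I -> R[i]) :
  cmod (\sum_(i <- s | P i) F i) <= \sum_(i <- s | P i) cmod (F i).
Proof.
apply: (big_ind2 (fun z x => cmod z <= x)) => [|z x w y zx wy|//].
  by rewrite cmod0.
exact: le_trans (cmodD _ _) (lerD zx wy).
Qed.

Lemma Re_le_cmod z : `|Re z| <= cmod z.
Proof.
rewrite -[leLHS]sqrtr_sqr cmodE ler_wsqrtr // lerDl; exact: sqr_ge0.
Qed.

Lemma cmod_le_ReIm z : cmod z <= `|Re z| + `|Im z|.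
Proof.
rewrite -(@ler_pXn2r _ 2) ?nnegrE ?cmod_ge0 ?addr_ge0 // cmod_sqr.
rewrite sqrrD !real_normK ?num_real // lerD2r lerDl mulrn_wge0 // mulr_ge0.
Qed.

Definition pmax v : R := Num.max (cmod v.1) (cmod v.2).

Lemma pmax_ge1 v : cmod v.1 <= pmax v. Proof. by rewrite le_max lexx. Qed.

Lemma pmax_ge2 v : cmod v.2 <= pmax v.
Proof. by rewrite le_max lexx orbT. Qed.

Lemma pmax_ge0 v : 0 <= pmax v.
Proof. exact: le_trans (cmod_ge0 _) (pmax_ge1 v). Qed.

Lemma pmax_le v (t : R) : (pmax v <= t) = (cmod v.1 <= t) && (cmod v.2 <= t).
Proof. by rewrite ge_max. Qed.

Lemma pmaxBC v v' : pmax (v - v') = pmax (v' - v).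
Proof. by rewrite /pmax /= cmodBC [X in Num.max _ X]cmodBC. Qed.

Lemma pmaxD v v' : pmax (v + v') <= pmax v + pmax v'.
Proof.
by rewrite pmax_le /= !(le_trans (cmodD _ _)) ?lerD ?pmax_ge1 ?pmax_ge2.
Qed.

Lemma pmaxZ z v : pmax (z *: v) = cmod z * pmax v.
Proof. by rewrite /pmax /= !cmodM maxr_pMr ?cmod_ge0. Qed.

Lemma pmax_le_enorm v : pmax v <= enorm v.
Proof.
rewrite pmax_le; apply/andP; split; rewrite -[leLHS]ger0_norm ?cmod_ge0 //;
  rewrite -sqrtr_sqr ler_wsqrtr // ?lerDl ?lerDr; exact: sqr_ge0.
Qed.

Lemma enorm_le_pmax v : enorm v <= 2 * pmax v.
Proof.
rewrite -(@ler_pXn2r _ 2) ?nnegrE ?sqrtr_ge0 ?mulr_ge0 ?pmax_ge0 //.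
rewrite sqr_sqrtr ?addr_ge0 ?sqr_ge0 // exprMn.
have h1 : cmod v.1 ^+ 2 <= pmax v ^+ 2.
  by rewrite ler_pXn2r ?nnegrE ?pmax_ge0 ?cmod_ge0 ?pmax_ge1.
have h2 : cmod v.2 ^+ 2 <= pmax v ^+ 2.
  by rewrite ler_pXn2r ?nnegrE ?pmax_ge0 ?cmod_ge0 ?pmax_ge2.
rewrite /cmod in h1 h2; have := sqr_ge0 (pmax v); lra.
Qed.

Lemma cmod_horner_le (p : {poly R[i]}) n (B t : R) (y : R[i]) :
  (size p <= n.+1)%N -> (forall i, cmod p`_i <= B) -> 1 <= t -> cmod y <= t ->
  cmod p.[y] <= n.+1%:R * B * t ^+ n.
Proof.
move=> sp pB t1 yt; have B0 : 0 <= B by exact: le_trans (cmod_ge0 _) (pB 0%N).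
rewrite (horner_coef_wide _ sp) (le_trans (cmod_sum _ _ _)) //.
rewrite -mulrA mulr_natl -[n.+1 in leRHS]card_ord -sumr_const.
apply: ler_sum => i _; rewrite cmodM cmodX ler_pM ?exprn_ge0 ?cmod_ge0 //.
apply: (@le_trans _ _ (t ^+ i)).
  by rewrite lerXn2r ?nnegrE ?cmod_ge0 ?(le_trans ler01 t1).
by rewrite ler_weXn2l // -ltnS.
Qed.

Lemma cmod_subX_le (y y' : R[i]) (t : R) n : 1 <= t -> cmod y <= t ->
  cmod y' <= t -> cmod (y ^+ n.+1 - y' ^+ n.+1) <= n.+1%:R * t ^+ n * cmod (y -
    y').
Proof.
move=> t1 yt y't; rewrite subrXX cmodM mulrC ler_wpM2r ?cmod_ge0 //.
rewrite (le_trans (cmod_sum _ _ _)) // mulr_natl -[n.+1 in leRHS]card_ord.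
rewrite -sumr_const; apply: ler_sum => i _; rewrite cmodM !cmodX.
have t0 : 0 <= t by exact: le_trans ler01 t1.
rewrite -[X in t ^+ X](@subnK i n) -1?ltnS // exprD.
by rewrite ler_pM ?exprn_ge0 ?cmod_ge0 // lerXn2r ?nnegrE ?cmod_ge0.
Qed.

Lemma cmod_hornerB_le (p : {poly R[i]}) n (B t : R) (y y' : R[i]) :
  (size p <= n.+2)%N -> (forall i, cmod p`_i <= B) -> 1 <= t ->
  cmod y <= t -> cmod y' <= t ->
  cmod (p.[y] - p.[y']) <= (n.+2%:R * n.+2%:R) * B * t ^+ n * cmod (y - y').
Proof.
move=> sp pB t1 yt y't.
have t0 : 0 <= t by exact: le_trans ler01 t1.
have B0 : 0 <= B by exact: le_trans (cmod_ge0 _) (pB 0%N).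
rewrite !(horner_coef_wide _ sp) -sumrB (le_trans (cmod_sum _ _ _)) //.
rewrite -!mulrA mulr_natl -[n.+2 in leRHS]card_ord -sumr_const card_ord.
apply: ler_sum => -[[|i] ilt] _ /=.
  by rewrite !expr0 subrr cmod0 !mulr_ge0 ?exprn_ge0 ?cmod_ge0.
rewrite -mulrBr cmodM mulrCA ler_pM ?cmod_ge0 //.
apply: le_trans (cmod_subX_le _ t1 yt y't) _.
rewrite mulrA ler_wpM2r ?cmod_ge0 // ler_pM ?exprn_ge0 ?ler_nat //.
  exact: ltnW.
by rewrite ler_weXn2l.
Qed.

End Modulus.

(** The intervals of radius [C / 2 ^+ m] around [u m] are nested, so the supremum of their left ends
    lies in all of them; the limit and the rate come out together. *)
Lemma geometric_limit (R : realType) (u : nat -> R) (C : R) :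
  (forall m, `|u m.+1 - u m| <= C / 2 ^+ m.+1) ->
  exists l, forall m, `|u m - l| <= C / 2 ^+ m.
Proof.
move=> hu.
have hS m : C / 2 ^+ m = C / 2 ^+ m.+1 + C / 2 ^+ m.+1.
  by rewrite exprS invfM; field; rewrite expf_neq0.
have C0 m : 0 <= C / 2 ^+ m by rewrite hS addr_ge0 // (le_trans _ (hu m)).
pose v m := u m - C / 2 ^+ m; pose w m := u m + C / 2 ^+ m.
have vS m : v m <= v m.+1.
  by have := hu m; rewrite /v (hS m) ler_norml; lra.
have wS m : w m.+1 <= w m.
  by have := hu m; rewrite /w (hS m) ler_norml; lra.
have vD m k : v m <= v (m + k)%N.
  by elim: k => [|k IH]; rewrite ?addn0 // addnS (le_trans IH).
have wD m k : w (m + k)%N <= w m.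
  by elim: k => [|k IH]; rewrite ?addn0 // addnS (le_trans (wS _)).
have vw m k : v m <= w k.
  apply: le_trans (vD m k) (le_trans _ (wD k m)).
  by rewrite addnC /v /w; have := C0 (k + m)%N; lra.
have hs : has_sup (range v).
  by split; [exists (v 0%N), 0%N | exists (w 0%N) => _ [m _ <-]].
exists (sup (range v)) => m.
have h1 : v m <= sup (range v) by apply: sup_ubound; [case: hs | exists m].
have h2 : sup (range v) <= w m.
  by apply: ge_sup => [|_ [k _ <-]]; [case: hs | exact: vw].
by move: h1 h2; rewrite ler_norml /v /w; lra.
Qed.

(** * Generalized Henon steps and the invariant cone *)

Section Step.
Variable R : realType.
Variables (N : nat) (B c : R).
Implicit Types (q : {poly R[i]}) (b x y z : R[i]) (w v : 'C2[R]).

Definition qstep q b w : 'C2[R] := (w.2, q.[w.2] - b * w.1).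

(** The lower bound [c] replaces monicity, which fails for the inverse maps. The constants of the
    orbit estimates depend only on [N], [B], [c] and a radius, hence serve all Lambda and both
    signs. *)
Definition admissible n q b :=
  [/\ (2 <= n <= N)%N, size q = n.+1, forall i, cmod q`_i <= B,
      c <= cmod (lead_coef q) & cmod b <= B].

(** At most [n + 1] coefficients of modulus at most [B], and the term [b * x]: a step is bounded by
    [cup * t ^+ n] when both coordinates are at most [t] and [t >= 1]. *)
Definition cup : R := N.+2%:R * B.

(* The cubic size makes 1 / |y_m| <= expand^(-m) beat the crude bounds
   (N + 2)^(2 m) on second logarithmic derivatives, and makes [rad0] at least
   the constant [cratio] below. *)
Definition expand : R := 2 * N.+2%:R ^+ 3 * B.

(** Solves [c / 2 * rad0 = cup + expand]. Beyond this radius half of the leading term pays for all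
    lower-order terms, through [cup], and the half that remains still expands by [expand]. *)
Definition rad0 : R := 2 / c * (cup + expand).

Definition in_bidisc (r : R) w := pmax w <= r.

Definition in_cone (r : R) w := r <= cmod w.2 /\ cmod w.1 <= cmod w.2.

Hypotheses (B1 : 1 <= B) (c0 : 0 < c) (c1 : c <= 1).

Let B0 : 0 < B. Proof. exact: lt_le_trans ltr01 B1. Qed.

Lemma cup_ge2 : 2 <= cup.
Proof.
rewrite /cup -[2]mulr1 ler_pM //.
by rewrite ler_nat.
Qed.

Lemma expand_ge8 : 8 <= expand.
Proof.
have h : 2 <= N.+2%:R :> R by rewrite ler_nat.
apply: (@le_trans _ _ (2 * 2 ^+ 3)); first by rewrite -natrX -natrM ler_nat.
rewrite -[leLHS]mulr1 ler_pM ?mulr_ge0 ?exprn_ge0 // ler_wpM2l //.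
by rewrite lerXn2r ?nnegrE ?ler0n.
Qed.

Lemma rad0_ge : cup + expand = c / 2 * rad0.
Proof. by rewrite /rad0; field; rewrite gt_eqF. Qed.

Lemma rad0_ge1 : 1 <= rad0.
Proof.
by have := rad0_ge; have := cup_ge2; have := expand_ge8; move: c0 c1; nra.
Qed.

Lemma admissible_size n q b : admissible n q b -> (size q <= n.+1)%N.
Proof. by case=> _ ->. Qed.

Lemma lead_admissible n q b : admissible n q b -> q`_n = lead_coef q.
Proof. by case=> _ sq _ _ _; rewrite lead_coefE sq. Qed.

Lemma ler_self_exp (t : R) n : 1 <= t -> (1 <= n)%N -> t <= t ^+ n.
Proof. by move=> t1 n1; rewrite -{1}(expr1 t) ler_weXn2l. Qed.

Lemma qstep_le n q b x y (t : R) : admissible n q b -> 1 <= t ->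
  cmod x <= t -> cmod y <= t -> cmod (q.[y] - b * x) <= cup * t ^+ n.
Proof.
move=> ad t1 xt yt; have [/andP[n2 nN] sq qB _ bB] := ad.
have t0 : 0 <= t by exact: le_trans ler01 t1.
apply: le_trans (cmodB _ _) _; rewrite cmodM.
have h1 := cmod_horner_le (admissible_size ad) qB t1 yt.
have h2 : cmod b * cmod x <= B * t ^+ n.
  rewrite ler_pM ?cmod_ge0 //; apply: le_trans xt _.
  by rewrite ler_self_exp // (ltn_trans _ n2).
apply: le_trans (lerD h1 h2) _.
rewrite -mulrA -[X in _ + X]mul1r -mulrDl /cup -mulrA ler_wpM2r //.
  by rewrite mulr_ge0 ?exprn_ge0 // ltW.
by rewrite -[1]/(1%:R) -natrD addn1 ler_nat.
Qed.

Lemma cmod_lower_horner n (p : {poly R[i]}) (C t : R) y :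
  (size p <= n.+1)%N -> (forall i, cmod p`_i <= C) -> 1 <= t -> cmod y <= t ->
  cmod (p.[y] - p`_n * y ^+ n) <= n%:R * C * t ^+ n.-1.
Proof.
move=> sp pC t1 yt.
rewrite (horner_coef_wide _ sp) big_ord_recr /= addrK.
case: n sp => [|n] sp; first by rewrite big_ord0 cmod0 !mul0r.
have -> : \sum_(i < n.+1) p`_i * y ^+ i = (take_poly n.+1 p).[y].
  rewrite (horner_coef_wide _ (size_take_poly _ _)); apply: eq_bigr => i _.
  by rewrite coef_take_poly ltn_ord.
apply: cmod_horner_le (size_take_poly _ _) _ t1 yt => i.
rewrite coef_take_poly; case: ifP => // _.
by rewrite cmod0 (le_trans (cmod_ge0 _) (pC 0%N)).
Qed.

Lemma qstep_ge n q b r w : admissible n q b -> rad0 <= r -> in_cone r w ->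
  c / 2 * cmod w.2 ^+ n <= cmod (q.[w.2] - b * w.1).
Proof.
move=> ad r0 [rw ww]; have [/andP[n2 nN] sq qB qc bB] := ad.
have t1 : 1 <= cmod w.2 by rewrite (le_trans rad0_ge1) // (le_trans r0).
set t := cmod w.2 in t1 *.
have h1 := cmod_lower_horner (admissible_size ad) qB t1 (lexx _).
have n1 : (1 <= n.-1)%N by rewrite -ltnS prednK // (ltn_trans _ n2).
have h2 : cmod (b * w.1) <= B * t ^+ n.-1.
  rewrite cmodM ler_pM ?cmod_ge0 //; apply: le_trans ww _.
  by rewrite ler_self_exp.
have h3 : c * t ^+ n <= cmod (q`_n * w.2 ^+ n).
  by rewrite cmodM cmodX (lead_admissible ad) ler_wpM2r // exprn_ge0 ?cmod_ge0.
have h4 : (n%:R + 1) * B * t ^+ n.-1 <= c / 2 * t ^+ n.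
  rewrite -[n in leRHS]prednK ?(ltn_trans _ n2) // exprS mulrA.
  rewrite ler_wpM2r ?exprn_ge0 ?cmod_ge0 //.
  apply: (@le_trans _ _ (c / 2 * rad0)); last first.
    by rewrite ler_wpM2l ?divr_ge0 ?(ltW c0) // (le_trans r0).
  rewrite -rad0_ge /cup.
  have : (n%:R + 1) * B <= N.+2%:R * B.
    rewrite ler_wpM2r ?(ltW B0) // -[1]/(1%:R) -natrD addn1 ler_nat.
    by rewrite (leq_trans _ (leqnSn _)).
  have := expand_ge8; lra.
have := cmodB_ge (q`_n * w.2 ^+ n)
   (- ((q.[w.2] - q`_n * w.2 ^+ n) - b * w.1)).
have -> : q`_n * w.2 ^+ n - - (q.[w.2] - q`_n * w.2 ^+ n - b * w.1) =
   q.[w.2] - b * w.1 by ring.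
have := cmodB (q.[w.2] - q`_n * w.2 ^+ n) (b * w.1).
rewrite cmodN; lra.
Qed.

Lemma qstep_expand n q b r w : admissible n q b -> rad0 <= r -> in_cone r w ->
  expand * cmod w.2 <= cmod (q.[w.2] - b * w.1).
Proof.
move=> ad r0 rw; apply: le_trans (qstep_ge ad r0 rw).
case: rw => rw ww; have [/andP[n2 nN] _ _ _ _] := ad.
have t1 : 1 <= cmod w.2 by rewrite (le_trans rad0_ge1) // (le_trans r0).
apply: (@le_trans _ _ (c / 2 * rad0 * cmod w.2)).
  rewrite ler_wpM2r ?cmod_ge0 // -rad0_ge; have := cup_ge2; lra.
rewrite -mulrA ler_wpM2l ?divr_ge0 ?(ltW c0) //.
apply: (@le_trans _ _ (cmod w.2 ^+ 2)).
  by rewrite expr2 ler_wpM2r ?cmod_ge0 // (le_trans r0).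
by rewrite ler_weXn2l.
Qed.

Lemma in_cone_qstep n q b r w : admissible n q b -> rad0 <= r ->
  in_cone r w -> in_cone r (qstep q b w).
Proof.
move=> ad r0 rw; have h := qstep_expand ad r0 rw; case: rw => rw ww.
have := cmod_ge0 w.2; have := expand_ge8.
have := rad0_ge1; rewrite /in_cone /=; split; nra.
Qed.

(** The new first coordinate is the old second one, hence at most [r]; if the new second coordinate
    exceeds [r], it dominates the first and the point is in the cone. *)
Lemma in_bidisc_qstep n q b r w : admissible n q b -> rad0 <= r ->
  in_bidisc r w \/ in_cone r w ->
  in_bidisc r (qstep q b w) \/ in_cone r (qstep q b w).
Proof.
move=> ad r0 [|/(in_cone_qstep ad r0)]; last by right.
rewrite /in_bidisc pmax_le => /andP[w1 w2].
have [h|h] := lerP (cmod (q.[w.2] - b * w.1)) r.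
  by left; rewrite pmax_le /= w2 h.
by right; split; rewrite /= ?(ltW h) // (le_trans w2 (ltW h)).
Qed.

Definition trunc_norm (r : R) w := Num.max r (pmax w).

Lemma trunc_norm_ger r w : r <= trunc_norm r w.
Proof. by rewrite le_max lexx. Qed.

Lemma trunc_norm_gep r w : pmax w <= trunc_norm r w.
Proof. by rewrite le_max lexx orbT. Qed.

Lemma trunc_norm_le r n q b w : admissible n q b -> 1 <= r ->
  trunc_norm r (qstep q b w) <= cup * trunc_norm r w ^+ n.
Proof.
move=> ad r1; have [/andP[n2 nN] _ _ _ _] := ad.
set t := trunc_norm r w.
have t1 : 1 <= t by rewrite (le_trans r1) // trunc_norm_ger.
have pt : pmax w <= t by exact: trunc_norm_gep.
have tn : t <= cup * t ^+ n.
  apply: (@le_trans _ _ (t ^+ n));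
    first by rewrite ler_self_exp // (ltn_trans _ n2).
  by rewrite ler_peMl ?exprn_ge0 ?(le_trans ler01 t1) // (le_trans _ cup_ge2)
    ?ler1n.
rewrite ge_max (le_trans (trunc_norm_ger r w) tn) pmax_le /=.
rewrite (le_trans (pmax_ge2 _)) ?(le_trans pt) //= (qstep_le ad t1) //.
  by rewrite (le_trans (pmax_ge1 _)).
by rewrite (le_trans (pmax_ge2 _)).
Qed.

(** The factor [c / 2] is the loss in the cone. The power [r ^+ N] serves the bidisc, where
    [trunc_norm r w ^+ n] is [r ^+ n] while the next value is only known to be at least [r]. *)
Definition clow (r : R) : R := c / 2 / r ^+ N.

Lemma trunc_norm_ge r n q b w : admissible n q b -> rad0 <= r ->
  in_bidisc r w \/ in_cone r w ->
  clow r * trunc_norm r w ^+ n <= trunc_norm r (qstep q b w).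
Proof.
move=> ad r0 hw; have [/andP[n2 nN] _ _ _ _] := ad.
have r1 : 1 <= r by exact: le_trans rad0_ge1 r0.
have rN : 1 <= r ^+ N by rewrite exprn_ege1.
case: hw => [hw|hw].
  rewrite /trunc_norm (max_idPl hw); apply: le_trans (trunc_norm_ger _ _).
  apply: (@le_trans _ _ (c / 2)); last by move: c1; lra.
  rewrite /clow -mulrA ler_piMr ?divr_ge0 ?(ltW c0) //.
  by rewrite mulrC ler_pdivrMr ?(lt_le_trans ltr01) // mul1r ler_weXn2l.
have h := qstep_ge ad r0 hw; case: hw => rw ww.
have -> : trunc_norm r w = cmod w.2.
  by rewrite /trunc_norm /pmax (max_idPr ww) (max_idPr rw).
apply: le_trans (trunc_norm_gep _ _); apply: le_trans (pmax_ge2 _).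
apply: le_trans h; rewrite ler_wpM2r ?exprn_ge0 ?cmod_ge0 // /clow.
by rewrite ler_pdivrMr ?(lt_le_trans ltr01) // ler_peMr ?divr_ge0 ?(ltW c0).
Qed.

Lemma clow_gt0 r : 1 <= r -> 0 < clow r.
Proof.
by move=> r1; rewrite /clow divr_gt0 ?divr_gt0 // exprn_gt0 // (lt_le_trans
  ltr01).
Qed.

Lemma clow_le1 r : 1 <= r -> clow r <= 1.
Proof.
move=> r1; have rN : 1 <= r ^+ N by rewrite exprn_ege1.
by rewrite /clow ler_pdivrMr ?(lt_le_trans ltr01) //; move: c1; lra.
Qed.

Definition clog (r : R) : R := ln cup - ln (clow r).

Lemma ln_trunc_norm_step r n q b w : admissible n q b -> rad0 <= r ->
  in_bidisc r w \/ in_cone r w ->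
  `|ln (trunc_norm r (qstep q b w)) - n%:R * ln (trunc_norm r w)| <= clog r.
Proof.
move=> ad r0 hw.
have r1 : 1 <= r by exact: le_trans rad0_ge1 r0.
have g0 v : 0 < trunc_norm r v.
  by rewrite (lt_le_trans _ (trunc_norm_ger r v)) // (lt_le_trans ltr01).
have cu0 : 0 < cup by rewrite (lt_le_trans _ cup_ge2) ?ltr0n.
have h1 := trunc_norm_le w ad r1; have h2 := trunc_norm_ge ad r0 hw.
have cl0 := clow_gt0 r1.
have := clow_le1 r1; have := cup_ge2 => cu2 cl1.
have lcu : 0 <= ln cup by rewrite ln_ge0 // (le_trans _ cu2) // ler1n.
have lcl : ln (clow r) <= 0 by rewrite -ln1 ler_ln ?posrE.
move: h1; rewrite -ler_ln ?posrE ?mulr_gt0 ?exprn_gt0 //.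
rewrite lnM ?posrE ?exprn_gt0 // lnXn // -mulr_natl => {}h1.
move: h2; rewrite -ler_ln ?posrE ?(mulr_gt0 cl0) ?exprn_gt0 //.
rewrite lnM ?posrE ?exprn_gt0 // lnXn // -mulr_natl => {}h2.
rewrite ler_norml /clog; lra.
Qed.

End Step.

(** * Green function of an orbit *)

Lemma rate_cvg (R : realType) (u : nat -> R) (l C : R) :
  (forall m, `|u m - l| <= C / 2 ^+ m) -> u @ \oo --> l.
Proof.
move=> h; apply/cvgrPdistC_le => /= e e0.
have C0 : 0 <= C by have := h 0%N; rewrite expr0 divr1; apply: le_trans.
have hc : C *: (GRing.exp (2^-1 : R)) @ \oo --> C *: (0 : R).
  by apply: cvgZr; apply: cvg_expr; rewrite ger0_norm // invf_lt1 ?ltr1n.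
have := cvgr_le _ hc; rewrite scaler0 => /(_ _ e e0).
apply: filterS => m; rewrite /= -[(_ *: _) m]/(C * 2^-1 ^+ m) exprVn.
exact: le_trans.
Qed.

Section Orbit.
Variables (R : realType) (N : nat) (B c : R) (n : nat -> nat).
Implicit Types (q : nat -> {poly R[i]}) (b : nat -> R[i]) (w v : 'C2[R]).
Implicit Types (r : R).

Fixpoint orb q b m w : 'C2[R] :=
  if m is m'.+1 then qstep (q m') (b m') (orb q b m' w) else w.

Definition degprod m := (\prod_(i < m) n i)%N.

Lemma degprodS m : degprod m.+1 = (degprod m * n m)%N.
Proof. by rewrite /degprod big_ord_recr. Qed.

(** The floor 1 makes the limit independent of the bidisc, whereas the two-sided step bounds hold
    for floors at least [rad0]. Passing between the floors 1 and [r] shifts the logarithm by at most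
    [ln r]. *)
Definition green_approx q b m w : R :=
  ln (trunc_norm 1 (orb q b m w)) / (degprod m)%:R.

Definition orbit_green q b (g : 'C2[R] -> R) :=
  forall w, green_approx q b ^~ w @ \oo --> g w.

Definition admissible_seq q b :=
  forall m, admissible N B c (n m) (q m) (b m).

Hypotheses (B1 : 1 <= B) (c0 : 0 < c) (c1 : c <= 1).
Local Notation rad0 := (rad0 N B c).
Local Notation clog := (clog N B c).
Local Notation clow := (clow N c).
Local Notation cup := (cup N B).
Local Notation expand := (expand N B).

Lemma trunc_norm_gt0 r w : 0 < r -> 0 < trunc_norm r w.
Proof. by move=> r0; rewrite (lt_le_trans r0) // trunc_norm_ger. Qed.

Lemma trunc_norm1_le r w : 1 <= r -> trunc_norm 1 w <= trunc_norm r w.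
Proof.
move=> r1; rewrite {1}/trunc_norm ge_max trunc_norm_gep andbT.
exact: le_trans r1 (trunc_norm_ger r w).
Qed.

Lemma trunc_norm_ler r w : 1 <= r -> trunc_norm r w <= r * trunc_norm 1 w.
Proof.
move=> r1; rewrite /trunc_norm maxr_pMr ?(le_trans ler01) // mulr1.
rewrite ge_max le_max lexx /= le_max; apply/orP; right.
by rewrite ler_peMl ?pmax_ge0.
Qed.

Lemma ln_trunc_norm_dist r w : 1 <= r ->
  `|ln (trunc_norm 1 w) - ln (trunc_norm r w)| <= ln r.
Proof.
move=> r1; have r0 : 0 < r by rewrite (lt_le_trans ltr01).
have := trunc_norm1_le w r1; have := trunc_norm_ler w r1.
rewrite -ler_ln ?posrE ?mulr_gt0 ?trunc_norm_gt0 //.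
rewrite lnM ?posrE ?trunc_norm_gt0 // => h1.
rewrite -ler_ln ?posrE ?trunc_norm_gt0 // => h2.
by rewrite ler_norml; lra.
Qed.

Lemma clog_ge0 r : 1 <= r -> 0 <= clog r.
Proof.
move=> r1; rewrite /clog subr_ge0.
have := clow_gt0 N c0 r1; have := clow_le1 N c1 r1; have := cup_ge2 N B1.
by move=> *; rewrite ler_ln ?posrE; lra.
Qed.

Section OneOrbit.
Variables (q : nat -> {poly R[i]}) (b : nat -> R[i]).
Hypothesis ad : admissible_seq q b.

Lemma degprod_gt0 m : (0 < degprod m)%N.
Proof.
rewrite prodn_gt0 // => i; have [/andP[+ _] _ _ _ _] := ad i.
exact: ltn_trans.
Qed.

Lemma degprod_ge m : 2 ^+ m <= (degprod m)%:R :> R.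
Proof.
elim: m => [|m IH]; first by rewrite /degprod big_ord0.
rewrite degprodS natrM exprSr ler_pM // ler_nat.
by have [/andP[]] := ad m.
Qed.

Lemma degprodV_le m : (degprod m)%:R^-1 <= (2 ^+ m)^-1 :> R.
Proof.
by rewrite lef_pV2 ?posrE ?exprn_gt0 ?ltr0n ?degprod_gt0 // degprod_ge.
Qed.

Lemma orb_region r w m : rad0 <= r -> in_bidisc r w ->
  in_bidisc r (orb q b m w) \/ in_cone r (orb q b m w).
Proof.
move=> r0 rw; elim: m => [|m IH]; first by left.
exact: (in_bidisc_qstep B1 c0 c1 (ad m)).
Qed.

Lemma green_approx_limit r w : rad0 <= r -> in_bidisc r w ->
  exists l, forall m,
    `|green_approx q b m w - l| <= (clog r + ln r) / 2 ^+ m.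
Proof.
move=> r0 rw; have r1 : 1 <= r by exact: le_trans (rad0_ge1 N B1 c0 c1) r0.
pose u m := ln (trunc_norm r (orb q b m w)) / (degprod m)%:R.
have [m|l hl] := @geometric_limit _ u (clog r).
  have := ln_trunc_norm_step B1 c0 c1 (ad m) r0 (orb_region m r0 rw).
  have D0 : (0 : R) < (degprod m)%:R by rewrite ltr0n degprod_gt0.
  have DS0 : (0 : R) < (degprod m.+1)%:R by rewrite ltr0n degprod_gt0.
  have nm0 : (n m)%:R != 0 :> R.
    by apply: contraTN DS0; rewrite degprodS natrM => /eqP->;
      rewrite mulr0 ltxx.
  move=> h; have -> : u m.+1 - u m = (ln (trunc_norm r (orb q b m.+1 w)) -
      (n m)%:R * ln (trunc_norm r (orb q b m w))) / (degprod m.+1)%:R.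
    by rewrite /u degprodS natrM; field; rewrite nm0 gt_eqF.
  rewrite normrM [X in _ * X]ger0_norm ?invr_ge0 //.
  by rewrite ler_pM ?invr_ge0 // degprodV_le.
exists l => m; rewrite mulrDl [leRHS]addrC -(subrKA (u m)).
rewrite (le_trans (ler_normD _ _)) // lerD //.
rewrite /green_approx /u -mulrBl normrM [X in _ * X]ger0_norm ?invr_ge0 //.
by rewrite ler_pM ?invr_ge0 // ?ln_trunc_norm_dist // degprodV_le.
Qed.

Lemma orbit_green_rate g r w m : orbit_green q b g -> rad0 <= r ->
  in_bidisc r w -> `|green_approx q b m w - g w| <= (clog r + ln r) / 2 ^+ m.
Proof.
move=> gq r0 rw; have [l hl] := green_approx_limit r0 rw.
by rewrite -(cvg_unique _ (rate_cvg hl) (gq w)).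
Qed.

Lemma orb_cone r w m j : rad0 <= r -> in_cone r (orb q b m w) ->
  in_cone r (orb q b (j + m) w) /\
  expand ^+ j * cmod (orb q b m w).2 <= cmod (orb q b (j + m) w).2.
Proof.
move=> r0 hw; elim: j => [|j [IH1 IH2]]; first by rewrite expr0 mul1r.
rewrite addSn; split; first exact: (in_cone_qstep B1 c0 c1 (ad _)).
apply: le_trans (qstep_expand B1 c0 c1 (ad _) r0 IH1).
rewrite exprS -mulrA ler_wpM2l //; have := expand_ge8 N B1; lra.
Qed.

Lemma cone_trunc_norm w : in_cone 1 w -> trunc_norm 1 w = cmod w.2.
Proof. by move=> [w1 w2];
  rewrite /trunc_norm /pmax (max_idPr w2) (max_idPr w1). Qed.

Lemma in_cone_le r r' w : r <= r' -> in_cone r' w -> in_cone r w.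
Proof. by move=> rr [r1 r2]; split => //; exact: le_trans rr r1. Qed.

(** In the cone, [ln (c / 2 * |y_j|) / degprod j] does not decrease: [|y_{j+1}| >= c / 2 * |y_j|^n],
    and [(c / 2)^2 >= (c / 2)^n] because [n >= 2] and [c / 2 <= 1]. It is positive at time [m]
    because [c / 2 * rad0 = cup + expand > 1], and it bounds [green_approx] from below. *)
Lemma orbit_green_gt0 g w m : orbit_green q b g -> in_cone rad0 (orb q b m w) ->
  0 < g w.
Proof.
move=> gq hw; have r1 := rad0_ge1 N B1 c0 c1.
pose F j := ln (c / 2 * cmod (orb q b j w).2) / (degprod j)%:R.
have hc j : in_cone rad0 (orb q b (j + m) w) by case: (orb_cone j (lexx _) hw).
have pos j : 1 < c / 2 * cmod (orb q b (j + m) w).2.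
  apply: (@lt_le_trans _ _ (c / 2 * rad0)).
    by rewrite -rad0_ge //; have := expand_ge8 N B1; have := cup_ge2 N B1; lra.
  by rewrite ler_wpM2l ?divr_ge0 ?(ltW c0) //; case: (hc j).
have Fm j : F m <= F (j + m)%N.
  elim: j => [//|j IH]; apply: le_trans IH _.
  have h := qstep_ge B1 c0 c1 (ad (j + m)) (lexx _) (hc j).
  have [/andP[n2 _] _ _ _ _] := ad (j + m).
  have D0 : (0 : R) < (degprod (j + m))%:R by rewrite ltr0n degprod_gt0.
  have n0 : (0 : R) < (n (j + m))%:R by rewrite ltr0n (ltn_trans _ n2).
  rewrite /F addSn degprodS natrM invfM mulrA [leRHS]mulrAC ler_pM2r ?invr_gt0
    //.
  rewrite ler_pdivlMr // mulrC mulr_natl -lnXn ?(lt_trans ltr01 (pos _)) //.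
  rewrite ler_ln ?posrE ?exprn_gt0 ?(lt_trans ltr01 (pos _)) //; last first.
    exact: lt_trans ltr01 (pos j.+1).
  rewrite exprMn; apply: le_trans (ler_wpM2l _ h); last first.
    by rewrite divr_ge0 ?(ltW c0).
  rewrite mulrA ler_wpM2r ?exprn_ge0 ?cmod_ge0 // -expr2.
  by rewrite ler_wiXn2l ?divr_ge0 ?(ltW c0) //; move: c1; lra.
have F0 : 0 < F m.
  by rewrite divr_gt0 ?ltr0n ?degprod_gt0 // ln_gt0 // (pos 0%N).
apply: lt_le_trans F0 _.
apply: (cvgr_to_ge (gq w)); exists m => // k /= mk; rewrite -(subnK mk).
set j := (k - m)%N; apply: le_trans (Fm j) _; rewrite /F /green_approx.
rewrite ler_pM2r ?invr_gt0 ?ltr0n ?degprod_gt0 //.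
have hj := hc j; rewrite cone_trunc_norm; last exact: in_cone_le hj.
have h0 : 0 < cmod (orb q b (j + m) w).2.
  by apply: lt_le_trans (proj1 hj); exact: lt_le_trans r1.
rewrite ler_ln ?posrE ?(lt_trans ltr01 (pos _)) //.
by rewrite ler_piMl ?(ltW h0) //; move: c1; lra.
Qed.

Lemma orbit_green_eq0 g r w : orbit_green q b g -> rad0 <= r ->
  (forall m, in_bidisc r (orb q b m w)) -> g w = 0.
Proof.
move=> gq r0 hw; have r1 : 1 <= r by exact: le_trans (rad0_ge1 N B1 c0 c1) r0.
apply/esym/(cvg_unique _ _ (gq w)) => //.
apply: (@rate_cvg _ _ _ (ln r)) => m; rewrite subr0.
have h1 : 1 <= trunc_norm 1 (orb q b m w) by exact: trunc_norm_ger.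
rewrite /green_approx ger0_norm ?divr_ge0 ?ln_ge0 //.
rewrite ler_pM ?ln_ge0 ?invr_ge0 ?degprodV_le //.
rewrite ler_ln ?posrE ?(lt_le_trans ltr01) //.
by rewrite /trunc_norm ge_max r1 /=; exact: hw.
Qed.

(** Only the upper half of the step estimate enters. It holds with floor 1 at every point, so the
    constant does not depend on a bidisc. *)
Lemma orbit_green_le g w : orbit_green q b g ->
  g w <= ln (trunc_norm 1 w) + ln cup.
Proof.
move=> gq; apply: (cvgr_to_le (gq w)); apply: nearW => m.
have lcu : 0 <= ln cup.
  by rewrite ln_ge0 // (le_trans _ (cup_ge2 N B1)) // ler1n.
(* Step [i] adds at most [ln cup / degprod i.+1 <= ln cup / 2 ^+ i.+1]; the bracket is the sum of
   [2^-(i+1)] over [i < m]. *)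
apply: (@le_trans _ _ (ln (trunc_norm 1 w) + ln cup * (1 - (2 ^+ m)^-1))).
  elim: m => [|m IH].
    by rewrite /green_approx /degprod big_ord0 divr1 expr0 invr1 subrr mulr0
      addr0.
  have [/andP[n2 _] _ _ _ _] := ad m.
  have D0 : (0 : R) < (degprod m)%:R by rewrite ltr0n degprod_gt0.
  have n0 : (0 : R) < (n m)%:R by rewrite ltr0n (ltn_trans _ n2).
  have := trunc_norm_le B1 (orb q b m w) (ad m) (lexx 1).
  have cu0 : 0 < cup by rewrite (lt_le_trans _ (cup_ge2 N B1)) ?ltr0n.
  rewrite -ler_ln ?posrE ?(mulr_gt0 cu0) ?exprn_gt0 ?trunc_norm_gt0 //.
  rewrite lnM ?posrE ?exprn_gt0 ?trunc_norm_gt0 // lnXn ?trunc_norm_gt0 //.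
  move=> h.
  apply: (@le_trans _ _ (ln cup / (degprod m.+1)%:R + green_approx q b m w)).
    rewrite /green_approx degprodS natrM.
    have -> : ln cup / ((degprod m)%:R * (n m)%:R) +
       ln (trunc_norm 1 (orb q b m w)) / (degprod m)%:R =
      (ln cup + (n m)%:R * ln (trunc_norm 1 (orb q b m w))) /
      ((degprod m)%:R * (n m)%:R).
      by field; rewrite !gt_eqF.
    by rewrite ler_pM2r ?invr_gt0 ?mulr_gt0 // mulr_natl.
  have : ln cup / (degprod m.+1)%:R <= ln cup * (2 ^+ m.+1)^-1.
    by rewrite ler_wpM2l // degprodV_le.
  move: IH; have -> : (2 ^+ m)^-1 = 2 * (2 ^+ m.+1)^-1 :> R.
    by rewrite exprS; field; rewrite expf_neq0.
  lra.
have : 0 <= (2 ^+ m)^-1 :> R by rewrite invr_ge0 exprn_ge0.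
by move: lcu; nra.
Qed.

End OneOrbit.
End Orbit.

(** * Comparison of two orbits *)

Section Comparison.
Variables (R : realType) (N : nat) (B c : R).
Hypotheses (B1 : 1 <= B) (c0 : 0 < c) (c1 : c <= 1).
Local Notation rad0 := (rad0 N B c).
Local Notation clog := (clog N B c).
Local Notation clow := (clow N c).
Local Notation admissible := (admissible N B c).
Local Notation admissible_seq := (admissible_seq N B c).

(* Growth per step of the distance of two orbits divided by their size. *)
Definition spread (r : R) : R := 2 ^+ N * (2 * N.+2%:R ^+ 2 * B) / clow r.

Lemma spread_ge2 r : 1 <= r -> 2 <= spread r.
Proof.
move=> r1; have cl0 := clow_gt0 N c0 r1; have cl1 := clow_le1 N c1 r1.
have h : 1 <= 2 ^+ N * (N.+2%:R ^+ 2 * B) :> R.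
  by rewrite !mulr_ege1 ?exprn_ege1 ?ler1n.
rewrite /spread ler_pdivlMr // (_ : _ * (2 * _ * B) =
  2 * (2 ^+ N * (N.+2%:R ^+ 2 * B))); last by ring.
by rewrite ler_wpM2l // (le_trans cl1).
Qed.

(** Here [e] is the error relative to [T = trunc_norm r w]. Since [e <= 1], both points have
    coordinates at most [2 * T], so the absolute error after the step is at most [e * (2 * T) ^+ n]
    times a constant. By [trunc_norm_ge], [T ^+ n] is at most the new truncated norm divided by
    [clow r], which makes the error relative again. *)
Lemma qstep_close r n (q q' : {poly R[i]}) (b b' : R[i]) (w w' : 'C2[R])
    (e th : R) :
  admissible n q b -> admissible n q' b' -> rad0 <= r ->
  in_bidisc r w \/ in_cone r w ->
  0 <= th -> th <= e -> e <= 1 ->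
  (forall k, cmod (q`_k - q'`_k) <= th) -> cmod (b - b') <= th ->
  pmax (w - w') <= e * trunc_norm r w ->
  pmax (qstep q b w - qstep q' b' w') <=
    spread r * e * trunc_norm r (qstep q b w).
Proof.
move=> ad ad' r0 hw th0 the e1 hq hb hww.
have r1 : 1 <= r by exact: le_trans (rad0_ge1 N B1 c0 c1) r0.
have cl0 := clow_gt0 N c0 r1.
have e0 : 0 <= e by exact: le_trans th0 the.
have [/andP[n2 nN] sq qB _ bB] := ad; have [_ sq' _ _ _] := ad'.
set T := trunc_norm r w in hww *.
have T1 : 1 <= T by rewrite (le_trans r1) // trunc_norm_ger.
have T0 : 0 < T by rewrite (lt_le_trans ltr01).
have eT : e * T <= T by rewrite ler_piMl // ltW.
have wT : pmax w <= T by exact: trunc_norm_gep.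
have w'T : pmax w' <= 2 * T.
  rewrite -[w'](subrK w) (le_trans (pmaxD _ _)) // pmaxBC.
  by move: hww eT wT; clear; lra.
have [[x1 y1] [x2 y2] [d1 d2]] : [/\ cmod w.1 <= 2 * T /\ cmod w.2 <= 2 * T,
    cmod w'.1 <= 2 * T /\ cmod w'.2 <= 2 * T &
    cmod (w.1 - w'.1) <= e * T /\ cmod (w.2 - w'.2) <= e * T].
  have := pmax_ge1 w; have := pmax_ge2 w; have := pmax_ge1 w'.
  have := pmax_ge2 w'; have := pmax_ge1 (w - w'); have := pmax_ge2 (w - w').
  move: (ltW T0) wT w'T hww => /=; clear; split; split; lra.
have t1 : 1 <= 2 * T by move: T1; lra.
set S := (2 * T) ^+ n.
have S1 : 2 * T <= S by rewrite ler_self_exp // (ltn_trans _ n2).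
have TS : T <= S by move: S1 T0; lra.
have S0 : 0 <= S by move: TS T0; lra.
have key : cmod ((q.[w.2] - b * w.1) - (q'.[w'.2] - b' * w'.1)) <=
    e * S * (2 * N.+2%:R ^+ 2 * B).
  have h1 : cmod (q.[w.2] - q.[w'.2]) <= n.+1%:R * n.+1%:R * B * (e * S).
    have := @cmod_hornerB_le _ q n.-1 B _ _ _ _ qB t1 y1 y2.
    have -> : n.-1.+2 = n.+1 by rewrite prednK // (ltn_trans _ n2).
    rewrite sq => /(_ (leqnn _)) /le_trans; apply.
    rewrite -!mulrA !ler_wpM2l ?ler0n // ?(le_trans ler01) //.
    rewrite /S -[in leRHS](prednK (ltn_trans (ltn0Sn 0) n2)) exprSr.
    rewrite [leRHS]mulrCA ler_wpM2l ?exprn_ge0 // ?(le_trans ler01) //.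
    by rewrite (le_trans d2) // ler_wpM2l //; lra.
  have h2 : cmod (q.[w'.2] - q'.[w'.2]) <= n.+1%:R * (e * S).
    rewrite -hornerN -hornerD.
    have sqq : (size (q - q')%R <= n.+1)%N.
      by rewrite (leq_trans (size_polyD _ _)) // size_polyN sq sq' maxnn.
    have := @cmod_horner_le _ (q - q') n th (2 * T) w'.2 sqq _ t1 y2.
    have hc i : cmod (q - q')`_i <= th by rewrite coefB.
    move=> /(_ hc) /le_trans; apply; rewrite -mulrA ler_wpM2l ?ler0n //.
    by rewrite ler_wpM2r.
  have h3 : cmod (b * (w.1 - w'.1)) <= B * (e * S).
    rewrite cmodM ler_pM ?cmod_ge0 // (le_trans d1) // ler_wpM2l //.
  have h4 : cmod ((b - b') * w'.1) <= e * S.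
    rewrite cmodM ler_pM ?cmod_ge0 //; first exact: le_trans hb the.
    exact: le_trans x2 S1.
  (* Point and coefficients are changed one at a time, in each of the two terms of the step. *)
  have -> : (q.[w.2] - b * w.1) - (q'.[w'.2] - b' * w'.1) =
    ((q.[w.2] - q.[w'.2]) + (q.[w'.2] - q'.[w'.2])) -
    (b * (w.1 - w'.1) + (b - b') * w'.1) by ring.
  apply: le_trans (cmodB _ _) _.
  apply: (@le_trans _ _ ((n.+1%:R * n.+1%:R * B * (e * S) + n.+1%:R * (e * S)) +
     (B * (e * S) + e * S))).
    by rewrite lerD // (le_trans (cmodD _ _)) // lerD.
  have -> : (n.+1%:R * n.+1%:R * B * (e * S) + n.+1%:R * (e * S)) +
     (B * (e * S) + e * S) =
     e * S * (n.+1%:R * n.+1%:R * B + n.+1%:R + B + 1) by ring.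
  rewrite ler_wpM2l ?mulr_ge0 //.
  have k1 : n.+1%:R + 1 <= N.+2%:R :> R.
    by rewrite -[1]/(1%:R) -natrD addn1 ler_nat.
  have k0 : 1 <= n.+1%:R :> R by rewrite ler1n.
  have k2 : n.+1%:R * n.+1%:R <= N.+2%:R * N.+2%:R - N.+2%:R :> R.
    apply: (@le_trans _ _ ((N.+2%:R - 1) * (N.+2%:R - 1))).
      by rewrite ler_pM ?lerBrDr.
    by move: k0 k1; lra.
  have k3 : n.+1%:R * n.+1%:R * B <= (N.+2%:R * N.+2%:R - N.+2%:R) * B.
    by rewrite ler_wpM2r // (le_trans ler01).
  have k4 : N.+2%:R <= N.+2%:R * B by rewrite ler_peMr ?ler0n.
  have k5 : 2 * (N.+2%:R * B) <= N.+2%:R * N.+2%:R * B.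
    by rewrite mulrA ler_wpM2r ?(le_trans ler01) // ler_wpM2r ?ler0n // ler_nat.
  have k6 : 0 <= N.+2%:R * B by rewrite mulr_ge0 ?ler0n // (le_trans ler01).
  have k7 : B <= N.+2%:R * B by rewrite ler_peMl ?ler1n // (le_trans ler01).
  rewrite expr2; move: k1 k3 k4 k5 k6 k7; lra.
have lowS : e * S <= e * (2 ^+ N * (trunc_norm r (qstep q b w) / clow r)).
  rewrite ler_wpM2l // /S exprMn ler_pM ?exprn_ge0 ?(ltW T0) //.
    by rewrite ler_weXn2l // ler1n.
  by rewrite ler_pdivlMr // mulrC (trunc_norm_ge B1 c0 c1 ad).
have CB : 1 <= 2 * N.+2%:R ^+ 2 * B.
  by rewrite !mulr_ege1 ?exprn_ege1 ?ler1n.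
have fin : e * S * (2 * N.+2%:R ^+ 2 * B) <=
    spread r * e * trunc_norm r (qstep q b w).
  rewrite /spread (_ : _ / _ * e * _ =
    e * (2 ^+ N * (trunc_norm r (qstep q b w) / clow r)) *
    (2 * N.+2%:R ^+ 2 * B)); last by ring.
  by rewrite ler_wpM2r // (le_trans ler01).
rewrite pmax_le /= (le_trans _ fin) ?(le_trans key) ?fin //.
apply: le_trans d2 (le_trans _ (ler_peMr _ CB)); rewrite ?mulr_ge0 //.
by rewrite ler_wpM2l.
Qed.

Variables (n : nat -> nat).
Local Notation orbit_green := (orbit_green n).

Section TwoOrbits.
Variables (q q' : nat -> {poly R[i]}) (b b' : nat -> R[i]).
Hypotheses (ad : admissible_seq n q b) (ad' : admissible_seq n q' b').

(** The last hypothesis keeps the relative error at most 1 up to time [m], which is what allows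
    [qstep_close] to be iterated. *)
Lemma orb_close r (w w' : 'C2[R]) (th : R) m : rad0 <= r -> in_bidisc r w ->
  0 <= th -> pmax (w - w') <= th ->
  (forall i k, (i < m)%N -> cmod ((q i)`_k - (q' i)`_k) <= th) ->
  (forall i, (i < m)%N -> cmod (b i - b' i) <= th) ->
  spread r ^+ m * th <= 1 ->
  pmax (orb q b m w - orb q' b' m w') <=
    spread r ^+ m * th * trunc_norm r (orb q b m w).
Proof.
move=> r0 hw th0 hww hq hb.
have r1 : 1 <= r by exact: le_trans (rad0_ge1 N B1 c0 c1) r0.
have sp1 : 1 <= spread r by rewrite (le_trans _ (spread_ge2 r1)) // ler1n.
elim: m hq hb => [|m IH] hq hb hm.
  rewrite expr0 mul1r /= (le_trans hww) // ler_peMr // (le_trans r1) //.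
  exact: trunc_norm_ger.
have hm' : spread r ^+ m * th <= 1.
  by apply: le_trans hm; rewrite ler_wpM2r // ler_weXn2l.
rewrite exprS -[X in _ <= X * _]mulrA.
apply: (qstep_close (ad m) (ad' m) r0 _ th0) => //.
- exact: (orb_region B1 c0 c1 ad).
- by rewrite ler_peMl // exprn_ege1.
- by move=> k; apply: hq.
- exact: hb.
- by apply: IH => // [i k im|i im]; [apply: hq|apply: hb]; rewrite ltnS ltnW.
Qed.

End TwoOrbits.

(** Two convergence rates, one for each Green function, plus the distance of the two approximations
    at time [m]: a factor 2 between the truncated norms and a factor [r] for the change of floor. *)
Definition ccmp (r : R) : R := 2 * (clog r + ln r) + (ln 2 + ln r).

Lemma ccmp_ge0 r : 1 <= r -> 0 <= ccmp r.
Proof.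
move=> r1; have lr := ln_ge0 r1; have := clog_ge0 N B1 c0 c1 r1.
have : 0 <= ln 2 :> R by rewrite ln_ge0 // ler1n.
by rewrite /ccmp; lra.
Qed.

(** At time [m] the norms truncated at [r] agree up to a factor 2, so the two approximations differ
    by at most [ln 2 + ln r] over [degprod m], which is at least [2 ^+ m]; each of them is within
    its rate of its limit. *)
Lemma orbit_green_close (q q' : nat -> {poly R[i]}) (b b' : nat -> R[i])
    g g' r (w w' : 'C2[R]) (th : R) m :
  admissible_seq n q b -> admissible_seq n q' b' ->
  orbit_green q b g -> orbit_green q' b' g' ->
  rad0 <= r -> in_bidisc r w -> in_bidisc r w' ->
  0 <= th -> pmax (w - w') <= th ->
  (forall i k, (i < m)%N -> cmod ((q i)`_k - (q' i)`_k) <= th) ->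
  (forall i, (i < m)%N -> cmod (b i - b' i) <= th) ->
  spread r ^+ m * th <= 1 ->
  `|g w - g' w'| <= ccmp r / 2 ^+ m.
Proof.
move=> ad ad' gq gq' r0 hw hw' th0 hww hq hb hm.
have r1 : 1 <= r by exact: le_trans (rad0_ge1 N B1 c0 c1) r0.
have p0 : 0 < r by exact: lt_le_trans r1.
have k1 := orb_close ad ad' r0 hw th0 hww hq hb hm.
have k2 : pmax (orb q' b' m w' - orb q b m w) <=
    spread r ^+ m * th * trunc_norm r (orb q' b' m w').
  apply: orb_close => //; first by rewrite pmaxBC.
    by move=> i k im; rewrite cmodBC hq.
  by move=> i im; rewrite cmodBC hb.
have two (v v' : 'C2[R]) : pmax (v' - v) <= spread r ^+ m * th * trunc_norm r v
  ->
    ln (trunc_norm 1 v') <= ln 2 + ln r + ln (trunc_norm 1 v).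
  move=> h; rewrite -lnM ?posrE // -lnM ?posrE ?mulr_gt0 ?trunc_norm_gt0 //.
  rewrite ler_ln ?posrE ?mulr_gt0 ?trunc_norm_gt0 //.
  apply: le_trans (trunc_norm1_le _ r1) _; rewrite -mulrA.
  apply: (@le_trans _ _ (2 * trunc_norm r v)); last first.
    by rewrite ler_wpM2l // trunc_norm_ler.
  have t1 := trunc_norm_ger r v; have t2 := trunc_norm_gep r v.
  rewrite {1}/trunc_norm ge_max; apply/andP; split.
    by rewrite (le_trans t1) // ler_peMl ?ler1n // (le_trans _ t1) // ltW.
  rewrite -[v'](subrK v) (le_trans (pmaxD _ _)) //.
  have : spread r ^+ m * th * trunc_norm r v <= trunc_norm r v.
    by rewrite ler_piMl // (le_trans _ t1) // ltW.
  by move: h t2; lra.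
rewrite pmaxBC in k1; rewrite pmaxBC in k2.
have l1 := two _ _ k2; have l2 := two _ _ k1.
have D0 : (0 : R) < (degprod n m)%:R.
  by rewrite ltr0n (degprod_gt0 ad).
have mid : `|green_approx n q b m w - green_approx n q' b' m w'| <=
    (ln 2 + ln r) / 2 ^+ m.
  rewrite /green_approx -mulrBl normrM [X in _ * X]ger0_norm ?invr_ge0 ?(ltW
    D0) //.
  rewrite ler_pM ?invr_ge0 ?(ltW D0) ?(degprodV_le ad) //.
  by rewrite ler_norml; move: l1 l2; lra.
have e1 := orbit_green_rate B1 c0 c1 ad m gq r0 hw.
have e2 := orbit_green_rate B1 c0 c1 ad' m gq' r0 hw'.
have -> : g w - g' w' = - (green_approx n q b m w - g w) +
  (green_approx n q b m w - green_approx n q' b' m w') +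
  (green_approx n q' b' m w' - g' w') by ring.
have -> : ccmp r / 2 ^+ m = (clog r + ln r) / 2 ^+ m + (ln 2 + ln r) / 2 ^+ m +
  (clog r + ln r) / 2 ^+ m by rewrite /ccmp; ring.
rewrite (le_trans (ler_normD _ _)) // lerD // (le_trans (ler_normD _ _)) //.
by rewrite lerD // normrN.
Qed.

Lemma orbit_green_hoelder (q : nat -> {poly R[i]}) (b : nat -> R[i]) g r :
  admissible_seq n q b -> orbit_green q b g -> rad0 <= r ->
  exists alpha L : R, 0 < alpha <= 1 /\ 0 <= L /\ forall w w',
    in_bidisc r w -> in_bidisc r w' -> pmax (w - w') <= 1 ->
    `|g w - g w'| <= L * (pmax (w - w') `^ alpha).
Proof.
move=> ad gq r0.
have r1 : 1 <= r by exact: le_trans (rad0_ge1 N B1 c0 c1) r0.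
set Lam := spread r; have L2 : 2 <= Lam by exact: spread_ge2.
have L0 : 0 < Lam by rewrite (lt_le_trans _ L2).
have lL0 : 0 < ln Lam by rewrite ln_gt0 // (lt_le_trans _ L2) // ltr1n.
have l20 : 0 < ln 2 :> R by rewrite ln_gt0 // ltr1n.
(* The exponent [alpha] solves [Lam^alpha = 2]: distances growing by [Lam] per step are traded for
   errors halved per step. It is at most 1 because [Lam >= 2]. The factor 2 pays for passing from
   [m] to [m + 1]. *)
exists (ln 2 / ln Lam), (2 * ccmp r); split; [|split].
- rewrite divr_gt0 //= ler_pdivrMr // mul1r ler_ln ?posrE //.
- by rewrite mulr_ge0 // ccmp_ge0.
move=> w w' hw hw'; set th := pmax (w - w') => th1.
have [th0|th0] := ltP 0 th; last first.
  have /eqP : pmax (w - w') == 0 by rewrite eq_le th0 pmax_ge0.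
  move=> e; have : w - w' = 0.
    have := pmax_ge1 (w - w'); have := pmax_ge2 (w - w'); rewrite e.
    case: (w - w') => u v /=.
    rewrite [X in X -> _](_ : _ = is_true (v == 0)); last first.
      by rewrite -cmod_eq0 eq_le cmod_ge0 andbT.
    move=> /eqP ->.
    rewrite [X in X -> _](_ : _ = is_true (u == 0)); last first.
      by rewrite -cmod_eq0 eq_le cmod_ge0 andbT.
    by move=> /eqP ->.
  move=> /eqP; rewrite subr_eq0 => /eqP ->; rewrite subrr normr0.
  by rewrite mulr_ge0 ?mulr_ge0 ?ccmp_ge0 // powR_ge0.
have exm : exists m, 1 < Lam ^+ m.+1 * th.
  have [m hm] : exists m : nat, th^-1 < 2 ^+ m.
    exists (Num.bound th^-1); apply: lt_le_trans (archi_boundP _) _.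
      by rewrite invr_ge0 ltW.
    by rewrite -natrX ler_nat ltnW // ltn_expl.
  exists m; rewrite -ltr_pdivrMr // mul1r (lt_le_trans hm) //.
  apply: (@le_trans _ _ (Lam ^+ m)); first by rewrite lerXn2r ?nnegrE ?(ltW L0).
  by rewrite ler_weXn2l // (le_trans _ L2) // ler1n.
(* This [m] is the last time with [Lam ^+ m * th <= 1], where the comparison still applies; the
   failure at [m + 1] converts [2^-(m+1)] into a power of [th]. *)
have hmin := ex_minnP exm; case: hmin => m hm mmin.
have hm' : Lam ^+ m * th <= 1.
  case: m mmin {hm} => [|m] mmin; first by rewrite expr0 mul1r.
  by rewrite leNgt; apply/negP => /mmin; rewrite ltnn.
apply: le_trans (@orbit_green_close q q b b g g r w w' th m ad ad gq gq r0 hw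
  hw'
  (ltW th0) (lexx _) _ _ hm') _.
- by move=> i k _; rewrite subrr cmod0 ltW.
- by move=> i _; rewrite subrr cmod0 ltW.
rewrite [leRHS]mulrAC [leRHS]mulrC ler_wpM2l ?ccmp_ge0 //.
have -> : (2 ^+ m)^-1 = 2 * (2 ^+ m.+1)^-1 :> R.
  by rewrite exprS; field; rewrite expf_neq0.
rewrite ler_wpM2l //.
have E : 2 ^+ m.+1 = (Lam ^+ m.+1) `^ (ln 2 / ln Lam) :> R.
  rewrite /powR gt_eqF ?exprn_gt0 // lnXn // mulrnAr divfK ?gt_eqF //.
  by rewrite -[ln 2 *+ _]mulr_natl expRM_natl lnK // posrE.
have h : 1 <= (Lam ^+ m.+1 * th) `^ (ln 2 / ln Lam).
  have a0 : 0 <= ln 2 / ln Lam by rewrite divr_ge0 // ltW.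
  have := @ge0_ler_powR _ _ a0 1 (Lam ^+ m.+1 * th).
  rewrite powR1 !nnegrE ler01 => /(_ isT _ (ltW hm)); apply.
  by rewrite mulr_ge0 ?exprn_ge0 // ltW.
rewrite powRM ?exprn_ge0 ?(ltW L0) ?(ltW th0) // -E in h.
by rewrite -[leLHS]mul1r ler_pdivrMr ?exprn_gt0 // mulrC.
Qed.

End Comparison.

(** * Topology of C and C^2 *)

Section Topology.
Variable R : realType.

(** Norms on [R[i]] take values in [R[i]], where positivity forces a number to be real; this is the
    bridge to the real-valued [cmod]. *)
Lemma gt0_complex_real (e : R[i]) : 0 < e -> exists2 d : R, 0 < d & e = d%:C%C.
Proof.
case: e => x y; rewrite ltcE /= => /andP[/eqP-> x0]; by exists x.
Qed.

Lemma cvg_cmodP (T : Type) (F : set_system T) (FF : Filter F) (f : T -> R[i])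
  (l : R[i]) :
  f @ F --> l <-> forall e : R, 0 < e -> \forall x \near F, cmod (f x - l) < e.
Proof.
split=> [/cvgrPdist_lt h e e0|h].
  have /h : 0 < e%:C%C :> R[i] by rewrite ltcR.
  by apply: filterS => x; rewrite normr_cmod ltcR cmodBC.
apply/cvgrPdist_lt => e /gt0_complex_real[d d0 ->].
by apply: filterS (h _ d0) => x; rewrite normr_cmod ltcR cmodBC.
Qed.

Lemma near_cmod (z : R[i]) (e : R) : 0 < e -> \forall w \near z,
  cmod (w - z) < e.
Proof.
move=> e0; apply/nbhs_ballP; exists e%:C%C; first by rewrite /= ltcR.
by move=> w; rewrite /ball/= normr_cmod ltcR cmodBC.
Qed.

Lemma nbhs_pmaxP (z : 'C2[R]) (U : set 'C2[R]) :
  nbhs z U <-> exists2 d : R, 0 < d & forall w, pmax (w - z) < d -> U w.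
Proof.
split=> [/nbhs_ballP[e /= /gt0_complex_real[d d0 ->]] h|[d d0 h]].
  exists d => // w; rewrite gt_max => /andP[h1 h2]; apply: h.
  by split; rewrite /ball/= normr_cmod ltcR cmodBC.
apply/nbhs_ballP; exists d%:C%C; first by rewrite /= ltcR.
move=> w [h1 h2]; apply: h; move: h1 h2.
rewrite /ball/= !normr_cmod !ltcR => h1 h2.
by rewrite gt_max /= cmodBC h1 cmodBC.
Qed.

Lemma cvg_C2P (T : Type) (F : set_system T) (FF : Filter F) (f : T -> 'C2[R])
  (l : 'C2[R]) :
  f @ F --> l <-> forall e : R, 0 < e -> \forall x \near F, pmax (f x - l) < e.
Proof.
split=> [h e e0|h].
  by apply: (h [set w | pmax (w - l) < e]); apply/nbhs_pmaxP; exists e.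
by move=> U /nbhs_pmaxP[d d0 hd]; apply: filterS (h _ d0) => x /hd.
Qed.

Lemma continuous_cmod : continuous (@cmod R).
Proof.
move=> z; apply/(@cvgrPdist_lt _ _ _ (nbhs z) (nbhs_filter z)) => e e0.
have := near_cmod z e0.
apply: filterS => w; apply: le_lt_trans.
rewrite ler_norml; have := cmodB_ge z w; have := cmodB_ge w z.
by rewrite (cmodBC z) => h1 h2; apply/andP; split; lra.
Qed.

Lemma continuous_Re : continuous (@complex.Re R).
Proof.
move=> z; apply/(@cvgrPdist_lt _ _ _ (nbhs z) (nbhs_filter z)) => e e0.
have := near_cmod z e0.
apply: filterS => w; apply: le_lt_trans; rewrite cmodBC.
by apply: le_trans (Re_le_cmod _); rewrite raddfB.
Qed.

Lemma continuous_enorm : continuous (@enorm R).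
Proof.
move=> z; have h1 : cmod w.1 @[w --> z] --> cmod z.1.
  by apply: (cvg_comp _ _ (@cvg_fst _ _ _ _ _)); exact: continuous_cmod.
have h2 : cmod w.2 @[w --> z] --> cmod z.2.
  by apply: (cvg_comp _ _ (@cvg_snd _ _ _ _ _)); exact: continuous_cmod.
apply: (cvg_comp _ _ (cvgD (cvgM h1 h1) (cvgM h2 h2))).
exact: sqrt_continuous.
Qed.

Section Cvg.
Variables (T : Type) (F : set_system T).
Hypothesis FF : Filter F.
Implicit Types (f g : T -> R[i]) (k l : R[i]).

Lemma cplx_cvg_cst l : (fun=> l) @ F --> l.
Proof. exact: cvg_cst. Qed.

Lemma cplx_cvgD f g k l : f @ F --> k -> g @ F --> l ->
  (fun x => f x + g x) @ F --> k + l.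
Proof. exact: cvgD. Qed.

Lemma cplx_cvgB f g k l : f @ F --> k -> g @ F --> l ->
  (fun x => f x - g x) @ F --> k - l.
Proof. exact: cvgB. Qed.

Lemma cplx_cvgM f g k l : f @ F --> k -> g @ F --> l ->
  (fun x => f x * g x) @ F --> k * l.
Proof. exact: cvgM. Qed.

Lemma cplx_cvgV f k : k != 0 -> f @ F --> k -> (fun x => (f x)^-1) @ F --> k^-1.
Proof. by move=> k0; exact: cvgV. Qed.

Lemma cplx_cvg_horner (p : {poly R[i]}) f k : f @ F --> k ->
  (fun x => p.[f x]) @ F --> p.[k].
Proof.
move=> fk; elim/poly_ind: p => [|p a IH].
  rewrite (_ : (fun x => _) = fun=> 0); first by rewrite horner0;
    exact: cvg_cst.
  by apply/funext => x; rewrite horner0.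
rewrite (_ : (fun x => _) = fun x => p.[f x] * f x + a); last first.
  by apply/funext => x; rewrite hornerMXaddC.
rewrite hornerMXaddC; apply: cplx_cvgD; last exact: cplx_cvg_cst.
exact: cplx_cvgM.
Qed.

Lemma cplx_cvg_cmod f k : f @ F --> k -> (fun x => cmod (f x)) @ F --> cmod k.
Proof. by move=> fk; apply: cvg_comp fk _; exact: continuous_cmod. Qed.

Lemma cplx_cvg_Re f k : f @ F --> k -> (fun x => Re (f x)) @ F --> Re k.
Proof. by move=> fk; apply: cvg_comp fk _; exact: continuous_Re. Qed.

End Cvg.

Lemma compact_in_bidisc (K : set 'C2[R]) : compact K ->
  exists r, forall z, K z -> pmax z <= r.
Proof.
move=> Kc.
have /compact_bounded[r [_ hr]] : compact (@enorm R @` K).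
  by apply: continuous_compact => //; apply: continuous_subspaceT;
    exact: continuous_enorm.
exists (r + 1) => z Kz; apply: le_trans (pmax_le_enorm z) _.
apply: le_trans (ler_norm _) _.
by apply: hr; [rewrite ltrDl | exists z].
Qed.

End Topology.

(** * Derivatives along real lines *)

Section ComplexDerivative.
Variable R : realType.
Implicit Types (f g : R -> R[i]) (t : R) (k l : R[i]).

Lemma Re_mul k l : Re (k * l) = Re k * Re l - Im k * Im l.
Proof. by case: k; case: l. Qed.

Lemma Im_mul k l : Im (k * l) = Re k * Im l + Im k * Re l.
Proof. by case: k; case: l. Qed.

Lemma Re_inv k : Re k^-1 = Re k / (Re k ^+ 2 + Im k ^+ 2).
Proof. by case: k. Qed.

Lemma Im_inv k : Im k^-1 = - Im k / (Re k ^+ 2 + Im k ^+ 2).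
Proof. by case: k => x y; rewrite mulNr. Qed.

Lemma Re_add k l : Re (k + l) = Re k + Re l. Proof. by case: k; case: l. Qed.

Lemma Im_add k l : Im (k + l) = Im k + Im l. Proof. by case: k; case: l. Qed.

Lemma Re_opp k : Re (- k) = - Re k. Proof. by case: k. Qed.

Lemma Im_opp k : Im (- k) = - Im k. Proof. by case: k. Qed.

Lemma Re2_Im2_gt0 k : k != 0 -> 0 < Re k ^+ 2 + Im k ^+ 2.
Proof. by move=> k0; rewrite -cmod_sqr exprn_gt0 // cmod_gt0. Qed.

(** Differentiation in a real variable, componentwise: [pluriharmonic_on] only asks for derivatives
    along real lines, and holomorphy enters later through [dorbZ] and [ddorbZ]. *)
Definition is_cderive f t l :=
  is_derive t 1 (fun x => Re (f x)) (Re l) /\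
  is_derive t 1 (fun x => Im (f x)) (Im l).

Lemma is_cderive_eq f t k l : is_cderive f t k -> k = l -> is_cderive f t l.
Proof. by move=> + <-. Qed.

Lemma is_cderive_ext f g t l : f =1 g -> is_cderive f t l -> is_cderive g t l.
Proof. by move=> /funext ->. Qed.

Lemma is_cderive_cst k t : is_cderive (fun=> k) t 0.
Proof. by split; exact: is_derive_cst. Qed.

Lemma is_cderive_line k l t : is_cderive (fun x => k + x%:C%C * l) t l.
Proof.
have h (u v : R) : is_derive t 1 (fun x : R => u + x * v) v.
  rewrite (_ : (fun x => _) = cst u + (v \*: id)); last first.
    by apply/funext => x; rewrite mulrC.
  by apply: is_derive_eq; rewrite add0r /GRing.scale /= mulr1.
split.
  rewrite (_ : (fun x => _) = fun x => Re k + x * Re l) //.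
  by apply/funext => x; rewrite Re_add Re_mul /= mul0r subr0.
rewrite (_ : (fun x => _) = fun x => Im k + x * Im l) //.
by apply/funext => x; rewrite Im_add Im_mul /= mul0r addr0.
Qed.

Lemma is_cderiveD f g t k l : is_cderive f t k -> is_cderive g t l ->
  is_cderive (fun x => f x + g x) t (k + l).
Proof.
move=> [f1 f2] [g1 g2]; split.
  rewrite (_ : (fun x => _) = (fun x => Re (f x)) + (fun x => Re (g x))).
    by rewrite Re_add; exact: is_deriveD.
  by apply/funext => x; rewrite Re_add.
rewrite (_ : (fun x => _) = (fun x => Im (f x)) + (fun x => Im (g x))).
  by rewrite Im_add; exact: is_deriveD.
by apply/funext => x; rewrite Im_add.
Qed.

Lemma is_cderiveM f g t k l : is_cderive f t k -> is_cderive g t l ->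
  is_cderive (fun x => f x * g x) t (f t * l + g t * k).
Proof.
move=> [f1 f2] [g1 g2]; split.
  rewrite (_ : (fun x => _) = (fun x => Re (f x)) * (fun x => Re (g x)) -
    (fun x => Im (f x)) * (fun x => Im (g x))); last first.
    by apply/funext => x; rewrite Re_mul.
  apply: is_derive_eq (is_deriveB (is_deriveM f1 g1) (is_deriveM f2 g2)) _.
  by rewrite Re_add !Re_mul /GRing.scale /=; ring.
rewrite (_ : (fun x => _) = (fun x => Re (f x)) * (fun x => Im (g x)) +
  (fun x => Im (f x)) * (fun x => Re (g x))); last first.
  by apply/funext => x; rewrite Im_mul.
apply: is_derive_eq (is_deriveD (is_deriveM f1 g2) (is_deriveM f2 g1)) _.
by rewrite Im_add !Im_mul /GRing.scale /=; ring.
Qed.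

Lemma is_cderiveN f t k : is_cderive f t k -> is_cderive (fun x =>
  - f x) t (- k).
Proof.
move=> h; apply: is_cderive_eq (is_cderive_ext _ (is_cderiveM (is_cderive_cst
  (-1) t) h)) _.
  by move=> x; rewrite mulN1r.
by rewrite mulr0 addr0 mulN1r.
Qed.

Lemma is_cderiveB f g t k l : is_cderive f t k -> is_cderive g t l ->
  is_cderive (fun x => f x - g x) t (k - l).
Proof. by move=> fk /is_cderiveN; exact: is_cderiveD. Qed.

Lemma is_cderive_horner (p : {poly R[i]}) f t k : is_cderive f t k ->
  is_cderive (fun x => p.[f x]) t (p^`().[f t] * k).
Proof.
move=> fk; elim/poly_ind: p => [|p a IH].
  apply: is_cderive_eq (is_cderive_ext _ (is_cderive_cst 0 t)) _.
    by move=> x; rewrite horner0.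
  by rewrite deriv0 horner0 mul0r.
have h := is_cderiveD (is_cderiveM IH fk) (is_cderive_cst a t).
apply: is_cderive_eq (is_cderive_ext _ h) _.
  by move=> x; rewrite hornerMXaddC.
by rewrite derivMXaddC hornerD hornerMX; ring.
Qed.

Lemma is_derive_inv (f : R -> R) (t df : R) : f t != 0 -> is_derive t 1 f df ->
  is_derive t 1 (fun x => (f x)^-1) (- (f t) ^- 2 * df).
Proof. by move=> f0 h; exact: is_deriveV. Qed.

Lemma is_cderiveV f t k : f t != 0 -> is_cderive f t k ->
  is_cderive (fun x => (f x)^-1) t (- k / (f t) ^+ 2).
Proof.
move=> f0 [h1 h2]; have n0 := Re2_Im2_gt0 f0.
pose n := (fun x => Re (f x)) ^+ 2 + (fun x => Im (f x)) ^+ 2 : R -> R.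
have nE x : n x = Re (f x) ^+ 2 + Im (f x) ^+ 2 by [].
have hn := is_deriveD (is_deriveX 2 h1) (is_deriveX 2 h2).
have nt0 : n t != 0 by rewrite nE gt_eqF.
have hV := is_derive_inv nt0 hn.
have E : - k / f t ^+ 2 = - k * ((f t)^-1 * (f t)^-1) by rewrite expr2 invfM.
split.
  rewrite (_ : (fun x => _) = (fun x => Re (f x)) * (fun x => (n x)^-1));
    last first.
    by apply/funext => x; rewrite Re_inv.
  apply: is_derive_eq (is_deriveM h1 hV) _.
  rewrite E !(Re_mul, Im_mul, Re_inv, Im_inv, Re_opp,
    Im_opp) /GRing.scale /= !nE.
  by field; rewrite gt_eqF.
rewrite (_ : (fun x => _) = (fun x => - Im (f x)) * (fun x => (n x)^-1));
  last first.
  by apply/funext => x; rewrite Im_inv.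
have h2N : is_derive t 1 (fun x => - Im (f x)) (- Im k) by exact: is_deriveN.
apply: is_derive_eq (is_deriveM h2N hV) _.
rewrite E !(Re_mul, Im_mul, Re_inv, Im_inv, Re_opp, Im_opp) /GRing.scale /= !nE.
by field; rewrite gt_eqF.
Qed.

(** [ln (cmod f)] is half the logarithm of [Re^2 + Im^2], which is differentiable where [f] does not
    vanish. *)
Lemma is_derive_ln_cmod f t k : f t != 0 -> is_cderive f t k ->
  is_derive t 1 (fun x => ln (cmod (f x))) (Re (k / f t)).
Proof.
move=> f0 [h1 h2]; have n0 := Re2_Im2_gt0 f0.
pose n := (fun x => Re (f x)) ^+ 2 + (fun x => Im (f x)) ^+ 2 : R -> R.
have nE x : n x = Re (f x) ^+ 2 + Im (f x) ^+ 2 by [].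
have hn : is_derive t 1 n _ := is_deriveD (is_deriveX 2 h1) (is_deriveX 2 h2).
rewrite (_ : (fun x => _) = 2^-1 \*: (@ln R \o n)); last first.
  apply/funext => x; rewrite /= nE -cmod_sqr.
  (* The identity of functions holds at the zeros of [f] too, both sides being 0 by the convention
     [ln 0 = 0]. *)
  have [->|fx0] := eqVneq (f x) 0.
    by rewrite cmod0 expr0n /= ln0 // scaler0.
  by rewrite lnXn ?cmod_gt0 // /GRing.scale /= mulr2n; field.
apply: is_derive_eq (is_deriveZ _ (is_derive1_comp (is_derive1_ln _) hn)) _.
  by rewrite nE.
rewrite Re_mul Re_inv Im_inv /GRing.scale /= !nE.
by field; rewrite gt_eqF.
Qed.

End ComplexDerivative.

(** * Differentiation of geometrically convergent sequences *)

Section UniformLimit.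
Variable R : realType.

Lemma derive_lipschitz (f df : R -> R) (d C t : R) :
  (forall x : R, `|x| < d -> is_derive x 1 f (df x)) ->
  (forall x, `|x| < d -> `|df x| <= C) -> `|t| < d -> `|f t - f 0| <= C * `|t|.
Proof.
move=> hf hC td.
have hc a b : `|a| < d -> `|b| < d -> {within `[a, b], continuous f}.
  move=> ad bd; apply: continuous_in_subspaceT => x.
  rewrite inE /= in_itv /= => /andP[ax xb].
  have xd : `|x| < d.
    by move: ad bd; rewrite !ltr_norml => /andP[? ?] /andP[? ?]; apply/andP;
      split; lra.
  have [h _] := hf _ xd.
  exact/differentiable_continuous/derivable1_diffP.
have d0 : `|0 : R| < d by rewrite normr0 (le_lt_trans (normr_ge0 t)).
have inside x : Num.min 0 t <= x <= Num.max 0 t -> `|x| < d.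
  rewrite ge_min le_max => /andP[h1 h2].
  move: td; rewrite !ltr_norml => /andP[? ?]; move: d0; rewrite normr0 => ?.
  apply/andP; split; [case/orP: h1 => ?|case/orP: h2 => ?]; lra.
have [t0|t0|->] := ltgtP t 0; last by rewrite subrr normr0 mulr0.
- have [x|x] := @MVT _ f df t 0 t0 _ (hc _ _ td d0).
    rewrite in_itv /= => /andP[h1 h2]; apply: hf; apply: inside.
    by rewrite ge_min le_max (ltW h1) (ltW h2) orbT.
  rewrite in_itv /= => /andP[h1 h2].
  rewrite distrC => ->;
    rewrite sub0r normrM normrN ler_wpM2r // hC // inside //.
  by rewrite ge_min le_max (ltW h1) (ltW h2) orbT.
have [x|x] := @MVT _ f df 0 t t0 _ (hc _ _ d0 td).
  rewrite in_itv /= => /andP[h1 h2]; apply: hf; apply: inside.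
  by rewrite ge_min le_max (ltW h1) (ltW h2) orbT.
rewrite in_itv /= => /andP[h1 h2].
move=> ->; rewrite subr0 normrM ler_wpM2r // hC // inside //.
by rewrite ge_min le_max (ltW h1) (ltW h2) orbT.
Qed.

Lemma is_derive_quotient (f : R -> R) (l : R) :
  (forall e, 0 < e -> exists2 d, 0 < d & forall t, `|t| < d ->
    `|f t - f 0 - t * l| <= e * `|t|) -> is_derive (0 : R) 1 f l.
Proof.
move=> h.
have hc : (fun t => t^-1 *: ((f \o shift 0) (t *: 1) - f 0)) @ 0^' --> l.
  apply/cvgrPdistC_le => e e0; have [d d0 hd] := h _ e0.
  rewrite near_withinE; exists d => //= t; rewrite /= sub0r normrN => td t0.
  rewrite addr0 /GRing.scale /= mulr1.
  have -> : t^-1 * (f t - f 0) - l = (f t - f 0 - t * l) / t by field.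
  by rewrite normrM normrV ?unitfE // ler_pdivrMr ?normr_gt0 // hd.
apply: DeriveDef; first exact: cvgP hc.
exact: (cvg_lim _ hc).
Qed.

Lemma is_derive_quotient_inv (f : R -> R) (l : R) : is_derive (0 : R) 1 f l ->
  forall e, 0 < e -> exists2 d, 0 < d & forall t, `|t| < d ->
    `|f t - f 0 - t * l| <= e * `|t|.
Proof.
move=> [hd hl] e e0.
have hc : (fun t => t^-1 *: ((f \o shift 0) (t *: 1) - f 0)) @ 0^' --> l.
  by rewrite -hl; exact: hd.
move/cvgrPdistC_le: hc => /(_ _ e0); rewrite near_withinE => -[d /= d0 h].
exists d => // t td; have [->|t0] := eqVneq t 0.
  by rewrite subrr mul0r subr0 normr0 mulr0.
have := h t; rewrite /= sub0r normrN => /(_ td t0).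
rewrite addr0 /GRing.scale /= mulr1.
have -> : t^-1 * (f t - f 0) - l = (f t - f 0 - t * l) / t by field.
by rewrite normrM normrV ?unitfE // ler_pdivrMr ?normr_gt0.
Qed.

(** The mean value theorem for [f k - f m] bounds its increments by [2 * C / 2 ^+ m] times [|t|];
    letting [k] tend to infinity gives the same bound for [F - f m], so the difference quotients
    converge uniformly in [t]. *)
Lemma is_derive_uniform_limit (f df : nat -> R -> R) (F dF : R -> R) (d C : R) :
  0 < d -> (forall m (t : R), `|t| < d -> is_derive t 1 (f m) (df m t)) ->
  (forall m t, `|t| < d -> `|df m t - dF t| <= C / 2 ^+ m) ->
  (forall t, `|t| < d -> f ^~ t @ \oo --> F t) ->
  is_derive (0 : R) 1 F (dF 0).
Proof.
move=> d0 hf hdf hF.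
have nd0 : `|0 : R| < d by rewrite normr0.
have C0 : 0 <= C.
  by have := hdf 0%N 0 nd0; rewrite expr0 divr1; apply: le_trans.
have step m t : `|t| < d ->
    `|(F t - F 0) - (f m t - f m 0)| <= 2 * C / 2 ^+ m * `|t|.
  move=> td; have hlim : (fun k =>
    `|(f k t - f k 0) - (f m t - f m 0)|) @ \oo -->
      `|(F t - F 0) - (f m t - f m 0)|.
    apply: cvg_norm; apply: cvgB; last exact: cvg_cst.
    by apply: cvgB; apply: hF.
  apply: (cvgr_to_le hlim); exists m => // k /= mk.
  have := @derive_lipschitz (f k - f m) (fun x => df k x - df m x) d
    (2 * C / 2 ^+ m) t.
  have -> : (f k - f m) t - (f k - f m) 0 = f k t - f k 0 - (f m t - f m 0).
    by rewrite -[(f k - f m) t]/(f k t - f m t) -[(f k - f m) 0]/(f k 0 - f m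
      0); ring.
  apply=> // x xd; first by apply: is_deriveB; apply: hf.
  have -> : df k x - df m x = (df k x - dF x) - (df m x - dF x) by ring.
  apply: le_trans (ler_normB _ _) _.
  have h1 : C / 2 ^+ k <= C / 2 ^+ m.
    by rewrite ler_wpM2l // lef_pV2 ?posrE ?exprn_gt0 // ler_weXn2l // ler1n.
  by have := hdf m x xd; have := hdf k x xd; lra.
apply: is_derive_quotient => e e0.
(* Two parts of the 3 come from the increments of [F - f m], one from replacing [df m 0] by [dF 0];
   the other half of [e] is left for the derivative of [f m]. *)
have [m hm] : exists m : nat, 3 * C / 2 ^+ m <= e / 2.
  exists (Num.bound (6 * C / e)).
  have h : 6 * C / e < 2 ^+ Num.bound (6 * C / e).
    apply: lt_le_trans (archi_boundP _) _.
      by rewrite divr_ge0 ?mulr_ge0 // ltW.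
    by rewrite -natrX ler_nat ltnW // ltn_expl.
  rewrite ler_pdivrMr ?exprn_gt0 //; move: h; rewrite ltr_pdivrMr //; lra.
have [d' d'0 hd'] := is_derive_quotient_inv (hf m 0 nd0) (divr_gt0 e0 (ltr0n _
  2)).
exists (Num.min d d'); first by rewrite lt_min d0.
move=> t; rewrite lt_min => /andP[td td'].
have -> : F t - F 0 - t * dF 0 = ((F t - F 0) - (f m t - f m 0)) +
  (f m t - f m 0 - t * df m 0) + t * (df m 0 - dF 0) by ring.
have h1 := step m t td; have h2 := hd' t td'.
have h3 : `|t * (df m 0 - dF 0)| <= C / 2 ^+ m * `|t|.
  by rewrite normrM mulrC ler_wpM2r // hdf.
have h4 : 3 * C / 2 ^+ m * `|t| <= e / 2 * `|t| by rewrite ler_wpM2r.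
apply: le_trans (ler_normD _ _) _.
apply: le_trans (lerD (ler_normD _ _) (lexx _)) _; lra.
Qed.

End UniformLimit.

Section UniformDirderive.
Variables (R : realType) (z0 v : 'C2[R]) (d C : R).
Let U := [set z : 'C2[R] | pmax (z - z0) < d].
Variables (u h : nat -> 'C2[R] -> R) (g : 'C2[R] -> R).
Hypothesis u_g : forall z, U z -> u ^~ z @ \oo --> g z.
Hypothesis u_h : forall m z (t : R), U (z + t%:C%C *: v) ->
  is_derive t 1 (fun x : R => u m (z + x%:C%C *: v)) (h m (z + t%:C%C *: v)).
Hypothesis h_step : forall m z, U z -> `|h m.+1 z - h m z| <= C / 2 ^+ m.+1.
Hypothesis h_cont : forall m z, U z -> {for z, continuous (h m)}.

Lemma ball_line z : U z -> exists2 e : R, 0 < e &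
  forall t : R, `|t| < e -> U (z + t%:C%C *: v).
Proof.
rewrite /U /= => zU; exists ((d - pmax (z - z0)) / (pmax v + 1)).
  by rewrite divr_gt0 ?subr_gt0 // ltr_wpDl // pmax_ge0.
move=> t; rewrite ltr_pdivlMr; last by rewrite ltr_wpDl // pmax_ge0.
move=> ht; rewrite addrAC (le_lt_trans (pmaxD _ _)) // pmaxZ cmodR.
have := normr_ge0 t; lra.
Qed.

(** Stated so as to be applied twice: to the functions and their first derivatives, then to the
    first derivatives and the second ones. *)
Lemma uniform_dirderive z : U z ->
  [/\ is_derive (0 : R) 1 (fun x : R => g (z + x%:C%C *: v)) (dirderive v g z),
      forall m, `|h m z - dirderive v g z| <= C / 2 ^+ m &
      {for z, continuous (dirderive v g)}].
Proof.
have hlim y : exists l, U y -> forall m, `|h m y - l| <= C / 2 ^+ m.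
  have [yU|nyU] := pselect (U y); last by exists 0.
  have [l hl] := geometric_limit (fun m => h_step m yU).
  by exists l.
have [H hH] := choice hlim.
have key y : U y ->
    is_derive (0 : R) 1 (fun x : R => g (y + x%:C%C *: v)) (H y).
  move=> yU; have [e e0 he] := ball_line yU.
  have := @is_derive_uniform_limit R (fun m x => u m (y + x%:C%C *: v))
    (fun m x => h m (y + x%:C%C *: v)) (fun x => g (y + x%:C%C *: v))
    (fun x => H (y + x%:C%C *: v)) e C e0.
  rewrite scale0r addr0; apply.
  - by move=> m t /he; exact: u_h.
  - by move=> m t /he yt; exact: hH.
  - by move=> t /he; exact: u_g.
have HE y : U y -> dirderive v g y = H y.
  by move=> yU; rewrite /dirderive derive1E; have [_ ->] := key _ yU.
move=> zU; rewrite HE //; split; [exact: key|exact: hH|].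
apply/(@cvgrPdist_lt _ _ _ (nbhs z) (nbhs_filter z)) => e e0.
have C0 : 0 <= C.
  by have := hH z zU 0%N; rewrite expr0 divr1; apply: le_trans.
have [m hm] : exists m : nat, C / 2 ^+ m < e / 3.
  exists (Num.bound (3 * C / e)).
  have k : 3 * C / e < 2 ^+ Num.bound (3 * C / e).
    apply: lt_le_trans (archi_boundP _) _.
      by rewrite divr_ge0 ?mulr_ge0 // ltW.
    by rewrite -natrX ler_nat ltnW // ltn_expl.
  rewrite ltr_pdivrMr ?exprn_gt0 //; move: k; rewrite ltr_pdivrMr //; lra.
have := @h_cont m z zU.
move/(@cvgrPdist_lt _ _ _ (nbhs z) (nbhs_filter z))/(_ _ (divr_gt0 e0 (ltr0n _
  3))).
have nU : \forall w \near z, U w.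
  apply/nbhs_pmaxP; exists (d - pmax (z - z0)); first by rewrite subr_gt0.
  move=> w hw; rewrite /U /= -(subrKA z) (le_lt_trans (pmaxD _ _)) //.
  by move: hw; lra.
apply: filterS2 nU => w wU; rewrite !HE // => hw.
have h1 := hH z zU m; have h2 := hH w wU m.
have -> : H z - H w = - (h m z - H z) + (h m z - h m w) + (h m w - H w) by ring.
apply: le_lt_trans (ler_normD _ _) _.
apply: le_lt_trans (lerD (ler_normD _ _) (lexx _)) _.
rewrite normrN; lra.
Qed.

End UniformDirderive.

(** * Pluriharmonicity on the escape set *)

Section LogDerivativeRecursion.
Variables (R : realType) (Q : R) (N : nat) (n : nat -> nat).
(* Intended values, for an orbit with second coordinates y_j:
   A_j = y_{j+1} q'(y_{j+1}) / y_{j+2}, E_j = y_{j+1}^2 q''(y_{j+1}) / y_{j+2},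
   b_j = (b y_j) / y_{j+2}, eps_j of order 1 / |y_{j+1}|, and r_j, r'_j, t_j
   are the first and second derivatives of y_j divided by y_j. *)
Variables (A E b : nat -> R[i]) (eps : nat -> R).
Hypotheses (Q_ge : N.+2%:R <= Q) (n_le : forall j, (n j <= N)%N).
Hypothesis eps_le : forall j, eps j <= (2 * Q ^+ 2) ^- j.
Hypothesis A_le : forall j, cmod (A j - (n j)%:R) <= eps j.
Hypothesis b_le : forall j, cmod (b j) <= eps j.
Hypothesis E_le : forall j, cmod (E j - (n j * (n j).-1)%:R) <= eps j.

Let Q2 : 2 <= Q. Proof. by rewrite (le_trans _ Q_ge) // ler_nat. Qed.
Let Q0 : 0 <= Q. Proof. by rewrite (le_trans _ Q2). Qed.
Let Q1 : 1 <= Q. Proof. by rewrite (le_trans _ Q2) // ler1n. Qed.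

Let eps1 j : eps j <= 1.
Proof.
have X1 : 1 <= 2 * Q ^+ 2 by rewrite mulr_ege1 ?exprn_ege1 ?ler1n.
have X0 : 0 < 2 * Q ^+ 2 by rewrite (lt_le_trans ltr01).
apply: le_trans (eps_le j) _.
by rewrite -exprVn exprn_ile1 ?invr_ge0 ?invf_le1 // ltW.
Qed.

Let eps0 j : 0 <= eps j. Proof. exact: le_trans (cmod_ge0 _) (b_le j). Qed.

Let epsQ j : eps j * (Q ^+ j * Q ^+ j) <= (2 ^+ j)^-1.
Proof.
apply: (@le_trans _ _ ((2 * Q ^+ 2) ^- j * (Q ^+ j * Q ^+ j))).
  by rewrite ler_wpM2r // mulr_ge0 ?exprn_ge0.
rewrite exprMn invfM -mulrA -exprMn -expr2 mulVf ?mulr1 //.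
by rewrite !expf_neq0 // gt_eqF // (lt_le_trans ltr01).
Qed.

Let n_leQ j : (n j)%:R <= Q - 2.
Proof.
rewrite lerBrDr; apply: le_trans Q_ge.
by rewrite -natrD ler_nat addn2 !ltnS n_le.
Qed.

Let A_bound j : cmod (A j) <= Q - 1.
Proof.
have := cmodD (A j - (n j)%:R) (n j)%:R; rewrite subrK cmod_nat.
by have := A_le j; have := eps1 j; have := n_leQ j; lra.
Qed.

Section First.
Variables (r : nat -> R[i]) (S : R).
Hypothesis rS : forall j, r j.+2 = A j * r j.+1 - b j * r j.
Hypotheses (r0 : cmod (r 0%N) <= S) (r1 : cmod (r 1%N) <= S).

(** Since [|A_j| <= Q - 1] and [|b_j| <= 1], the recursion multiplies the bound by at most [Q]. This
    is cruder than the growth by the degrees, but [eps] decays fast enough to compensate. *)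
Lemma log_derivative_bound j : cmod (r j) <= S * Q ^+ j.
Proof.
have S0 : 0 <= S by exact: le_trans (cmod_ge0 _) r0.
suff [] : cmod (r j) <= S * Q ^+ j /\ cmod (r j.+1) <= S * Q ^+ j.+1 by [].
elim: j => [|j [IH1 IH2]].
  by rewrite expr0 mulr1; split => //; rewrite (le_trans r1) // ler_peMr.
split => //; rewrite rS (le_trans (cmodB _ _)) // !cmodM.
apply: (@le_trans _ _ ((Q - 1) * (S * Q ^+ j.+1) + 1 * (S * Q ^+ j.+1))).
  apply: lerD; rewrite ler_pM ?cmod_ge0 //;
    first exact: le_trans (b_le j) (eps1 j).
  apply: le_trans IH1 _; rewrite ler_wpM2l // ler_weXn2l //.
by rewrite -mulrDl subrK mulrCA -exprS.
Qed.

Lemma log_derivative_step j :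
  cmod (r j.+2 - (n j)%:R * r j.+1) <= 2 * S * Q ^+ j.+1 * eps j.
Proof.
have S0 : 0 <= S by exact: le_trans (cmod_ge0 _) r0.
rewrite rS (_ : _ - _ = (A j - (n j)%:R) * r j.+1 - b j * r j); last by ring.
rewrite (le_trans (cmodB _ _)) // !cmodM.
have h1 := log_derivative_bound j; have h2 := log_derivative_bound j.+1.
rewrite (_ : 2 * S * _ * _ = eps j * (S * Q ^+ j.+1) + eps j * (S * Q ^+
  j.+1)); last by ring.
apply: lerD; rewrite ler_pM ?cmod_ge0 //.
by apply: le_trans h1 _; rewrite ler_wpM2l // ler_weXn2l.
Qed.

(** Replacing [A_j] by the degree and dropping [b_j] costs [eps j] times the crude bound, and
    [eps j * Q^(2 j) <= 2^-j]. *)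
Lemma log_derivative_rate j :
  cmod (r j.+2 - (n j)%:R * r j.+1) <= 2 * S * Q / 2 ^+ j.
Proof.
have S0 : 0 <= S by exact: le_trans (cmod_ge0 _) r0.
apply: le_trans (log_derivative_step j) _.
rewrite exprS (_ : _ * eps j = 2 * S * Q * (Q ^+ j * eps j)); last by ring.
rewrite ler_wpM2l ?mulr_ge0 //; apply: le_trans (epsQ j).
rewrite mulrC ler_wpM2l // ler_peMr ?exprn_ge0 ?exprn_ege1 //.
Qed.

End First.

Section Second.
Variables (r r' t : nat -> R[i]) (S : R).
Hypothesis rS : forall j, r j.+2 = A j * r j.+1 - b j * r j.
Hypothesis r'S : forall j, r' j.+2 = A j * r' j.+1 - b j * r' j.
Hypothesis tS : forall j,
  t j.+2 = E j * r j.+1 * r' j.+1 + A j * t j.+1 - b j * t j.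
Hypotheses (r0 : cmod (r 0%N) <= S) (r1 : cmod (r 1%N) <= S).
Hypotheses (r'0 : cmod (r' 0%N) <= S) (r'1 : cmod (r' 1%N) <= S).
Hypotheses (t0 : cmod (t 0%N) <= S ^+ 2) (t1 : cmod (t 1%N) <= S ^+ 2).

Let S0 : 0 <= S. Proof. exact: le_trans (cmod_ge0 _) r0. Qed.

Lemma second_log_derivative_bound j : cmod (t j) <= S ^+ 2 * (Q ^+ j * Q ^+ j).
Proof.
suff [] : cmod (t j) <= S ^+ 2 * (Q ^+ j * Q ^+ j) /\
  cmod (t j.+1) <= S ^+ 2 * (Q ^+ j.+1 * Q ^+ j.+1) by [].
elim: j => [|j [IH1 IH2]].
  rewrite expr0 !mulr1; split => //;
    rewrite (le_trans t1) // ler_peMr ?exprn_ge0 //.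
  by rewrite mulr_ege1 ?exprn_ege1.
split => //; rewrite tS (le_trans (cmodB _ _)) //.
have h1 := log_derivative_bound rS r0 r1 j.+1.
have h2 := log_derivative_bound r'S r'0 r'1 j.+1.
set X := S ^+ 2 * (Q ^+ j.+1 * Q ^+ j.+1).
have X0 : 0 <= X by rewrite mulr_ge0 ?exprn_ge0 // mulr_ge0 ?exprn_ge0.
have k1 : cmod (r j.+1 * r' j.+1) <= X.
  rewrite cmodM /X [leRHS](_ : _ = S * Q ^+ j.+1 * (S * Q ^+ j.+1));
    last by ring.
  by rewrite ler_pM ?cmod_ge0.
have k2 : cmod (E j) <= (Q - 2) * (Q - 2) + 1.
  have := cmodD (E j - (n j * (n j).-1)%:R) (n j * (n j).-1)%:R.
  rewrite subrK cmod_nat => /le_trans; apply; rewrite addrC lerD //.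
    rewrite natrM ler_pM ?ler0n // (le_trans _ (n_leQ j)) // ler_nat leq_pred
      //.
  exact: le_trans (E_le j) (eps1 j).
have k3 : cmod (E j * r j.+1 * r' j.+1) <= ((Q - 2) * (Q - 2) + 1) * X.
  by rewrite -mulrA cmodM ler_pM ?cmod_ge0.
have k4 : cmod (A j * t j.+1) <= (Q - 1) * X by rewrite cmodM ler_pM ?cmod_ge0.
have k5 : cmod (b j * t j) <= 1 * X.
  rewrite cmodM ler_pM ?cmod_ge0 //; first exact: le_trans (b_le j) (eps1 j).
  apply: le_trans IH1 _; rewrite ler_wpM2l ?exprn_ge0 //.
  by rewrite ler_pM ?exprn_ge0 // ler_weXn2l.
apply: (@le_trans _ _ (((Q - 2) * (Q - 2) + 1) * X + (Q - 1) * X + 1 * X)).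
  by rewrite lerD // (le_trans (cmodD _ _)) // lerD.
rewrite [Q ^+ j.+2]exprS (_ : S ^+ 2 * _ = Q * Q * X); last by rewrite /X; ring.
(* What remains is [(Q - 2)^2 + 1 + (Q - 1) + 1 <= Q^2], true for [Q >= 2]. *)
rewrite -!mulrDl ler_wpM2r //; move: Q2; nra.
Qed.

(* t - r r' is the second derivative of log y: the terms of order deg^2 in the
   recursions for t and for r r' cancel. *)
Lemma second_log_derivative_rate j :
  cmod ((t j.+2 - r j.+2 * r' j.+2) - (n j)%:R * (t j.+1 - r j.+1 * r' j.+1)) <=
  (S ^+ 2 * Q ^+ 2 * (3 + 4 * Q)) / 2 ^+ j.
Proof.
have h1 := log_derivative_bound rS r0 r1.
have h2 := log_derivative_bound r'S r'0 r'1.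
have h3 := second_log_derivative_bound.
have d1 := log_derivative_step rS r0 r1 j.
have d2 := log_derivative_step r'S r'0 r'1 j.
set X := S ^+ 2 * (Q ^+ j.+1 * Q ^+ j.+1).
have X0 : 0 <= X by rewrite mulr_ge0 ?exprn_ge0 // mulr_ge0 ?exprn_ge0.
have -> : (t j.+2 - r j.+2 * r' j.+2) - (n j)%:R * (t j.+1 - r j.+1 * r' j.+1) =
    ((E j - (n j * (n j).-1)%:R) * (r j.+1 * r' j.+1) +
     ((A j - (n j)%:R) * t j.+1 - b j * t j)) -
    ((r j.+2 - (n j)%:R * r j.+1) * r' j.+2 +
     (n j)%:R * r j.+1 * (r' j.+2 - (n j)%:R * r' j.+1)).
  rewrite [in LHS]tS.
  (* The main terms cancel: [n (n - 1) r r' + n t - n^2 r r' = n (t - r r')], and every term left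
     carries a factor of size [eps j]. *)
  have -> : (n j * (n j).-1)%:R = (n j)%:R ^+ 2 - (n j)%:R :> R[i].
    case: (n j) => [|k]; first by rewrite mul0n expr0n subrr.
    by rewrite /= natrM -[in RHS]addn1 !natrD; ring.
  ring.
have k1 : cmod ((E j - (n j * (n j).-1)%:R) * (r j.+1 * r' j.+1)) <= eps j * X.
  rewrite cmodM ler_pM ?cmod_ge0 // cmodM /X.
  rewrite [leRHS](_ : _ = S * Q ^+ j.+1 * (S * Q ^+ j.+1)); last by ring.
  by rewrite ler_pM ?cmod_ge0.
have k2 : cmod ((A j - (n j)%:R) * t j.+1) <= eps j * X.
  by rewrite cmodM ler_pM ?cmod_ge0 // h3.
have k3 : cmod (b j * t j) <= eps j * X.
  rewrite cmodM ler_pM ?cmod_ge0 // (le_trans (h3 j)) // ler_wpM2l ?exprn_ge0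
    //.
  by rewrite ler_pM ?exprn_ge0 // ler_weXn2l.
have k4 : cmod ((r j.+2 - (n j)%:R * r j.+1) * r' j.+2) <= 2 * Q * (eps j * X).
  rewrite cmodM; apply: (@le_trans _ _ (2 * S * Q ^+ j.+1 * eps j * (S * Q ^+
    j.+2))).
    by rewrite ler_pM ?cmod_ge0.
  by rewrite [Q ^+ j.+2]exprS /X le_eqVlt; apply/orP; left; apply/eqP; ring.
have k5 : cmod ((n j)%:R * r j.+1 * (r' j.+2 - (n j)%:R * r' j.+1)) <=
    2 * Q * (eps j * X).
  rewrite !cmodM cmod_nat.
  apply: (@le_trans _ _ (Q * (S * Q ^+ j.+1) * (2 * S * Q ^+ j.+1 * eps j))).
    rewrite ler_pM ?mulr_ge0 ?cmod_ge0 ?ler0n // ler_pM ?cmod_ge0 ?ler0n //.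
    by have := n_leQ j; lra.
  by rewrite /X le_eqVlt; apply/orP; left; apply/eqP; ring.
(* Three error terms of size [eps j * X], from [E], [A] and [b], and two of size
   [2 * Q * (eps j * X)], from the two first-order defects. *)
apply: (@le_trans _ _ ((3 + 4 * Q) * (eps j * X))).
  apply: le_trans (cmodB _ _) _.
  apply: le_trans (lerD (cmodD _ _) (cmodD _ _)) _.
  have := cmodB ((A j - (n j)%:R) * t j.+1) (b j * t j); lra.
have -> : eps j * X = S ^+ 2 * Q ^+ 2 * (eps j * (Q ^+ j * Q ^+ j)).
  by rewrite /X !exprS; ring.
rewrite mulrA [X in X * _]mulrC ler_wpM2l //.
by rewrite !mulr_ge0 ?exprn_ge0 // addr_ge0 ?mulr_ge0.
Qed.

End Second.
End LogDerivativeRecursion.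

(** * Size of the recursion coefficients in the cone *)

Section ConeRatios.
Variables (R : realType) (N : nat) (B c : R).
Hypotheses (B1 : 1 <= B) (c0 : 0 < c) (c1 : c <= 1).
Local Notation rad0 := (rad0 N B c).

(** The factor [2 / c] comes from the lower bound [qstep_ge] on the denominators. [(N^3 + N^2) * B]
    is the largest numerator bound, the one for second derivatives: at most [N] coefficients of size
    [N^2 * B], plus [N^2 * B]. *)
Definition cratio : R := 2 / c * ((N%:R ^+ 3 + N%:R ^+ 2) * B).

Lemma cratio_ge0 : 0 <= cratio.
Proof.
have Bp : 0 <= B by rewrite (le_trans ler01).
by rewrite /cratio !mulr_ge0 ?invr_ge0 ?addr_ge0 ?exprn_ge0 ?ler0n ?(ltW c0).
Qed.

Lemma cratio_le_rad0 : cratio <= rad0.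
Proof.
rewrite /cratio /rad0 ler_wpM2l ?divr_ge0 ?(ltW c0) // /expand.
apply: (@le_trans _ _ (2 * N.+2%:R ^+ 3 * B)); last first.
  by rewrite lerDr (le_trans _ (cup_ge2 N B1)).
rewrite ler_wpM2r ?(le_trans ler01) //.
have k : N%:R <= N.+2%:R :> R by rewrite ler_nat ltnW.
have k0 : 0 <= N%:R :> R by rewrite ler0n.
have h1 : N%:R ^+ 3 <= N.+2%:R ^+ 3 :> R by rewrite lerXn2r ?nnegrE ?ler0n.
have h2 : N%:R ^+ 2 <= N.+2%:R ^+ 2 :> R by rewrite lerXn2r ?nnegrE ?ler0n.
have h3 : N.+2%:R ^+ 2 <= N.+2%:R ^+ 3 :> R by rewrite ler_weXn2l // ler1n.
move: h1 h2 h3; lra.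
Qed.

Variables (r : R) (n : nat) (q : {poly R[i]}) (b : R[i]) (w : 'C2[R]).
Hypotheses (ad : admissible N B c n q b) (r0 : rad0 <= r) (hw : in_cone r w).

Lemma cone_cmod_ge1 : 1 <= cmod w.2.
Proof.
by case: hw => rw _; rewrite (le_trans (rad0_ge1 N B1 c0 c1)) // (le_trans r0).
Qed.

Lemma cone_qstep_neq0 : q.[w.2] - b * w.1 != 0.
Proof.
rewrite -cmod_gt0; apply: lt_le_trans (qstep_ge B1 c0 c1 ad r0 hw).
by rewrite mulr_gt0 ?divr_gt0 // exprn_gt0 // (lt_le_trans ltr01 cone_cmod_ge1).
Qed.

(** A numerator of degree below [n] is divided by something of size [|y|^n], which leaves a factor
    [1 / |y|]; the term in [b * w.1] is also of lower order because [|x| <= |y|] in the cone. *)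
Lemma cone_ratio_le (p : {poly R[i]}) (K k : R) (kc : R[i]) :
  (size p <= n)%N -> (forall i, cmod p`_i <= K) -> cmod kc <= k ->
  n%:R * K + k * B <= (N%:R ^+ 3 + N%:R ^+ 2) * B ->
  cmod ((p.[w.2] + kc * (b * w.1)) / (q.[w.2] - b * w.1)) <= cratio / cmod w.2.
Proof.
move=> sp pK kk hK; have t1 := cone_cmod_ge1.
have [/andP[n2 nN] _ _ _ bB] := ad; case: (hw) => _ ww.
have n0 : (0 < n)%N by exact: ltn_trans n2.
have t0 : 0 < cmod w.2 by rewrite (lt_le_trans ltr01).
have h1 : cmod p.[w.2] <= n%:R * K * cmod w.2 ^+ n.-1.
  have := @cmod_horner_le _ p n.-1 K (cmod w.2) w.2; rewrite prednK //.
  by apply.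
have h2 : cmod (kc * (b * w.1)) <= k * B * cmod w.2 ^+ n.-1.
  rewrite !cmodM mulrA ler_pM ?mulr_ge0 ?cmod_ge0 // ?ler_pM ?cmod_ge0 //.
  apply: le_trans ww _; rewrite ler_self_exp //.
  by rewrite -ltnS prednK.
rewrite cmodM cmodV ler_pdivrMr ?cmod_gt0 ?cone_qstep_neq0 //.
apply: (@le_trans _ _ (cratio / cmod w.2 * (c / 2 * cmod w.2 ^+ n)));
  last first.
  rewrite ler_wpM2l ?(qstep_ge B1 c0 c1 ad r0 hw) //.
  by rewrite divr_ge0 ?cmod_ge0 ?cratio_ge0.
have -> : cratio / cmod w.2 * (c / 2 * cmod w.2 ^+ n) =
    (N%:R ^+ 3 + N%:R ^+ 2) * B * cmod w.2 ^+ n.-1.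
  rewrite -[n in X in _ * (_ * X) = _](prednK n0) exprS /cratio.
  by field; rewrite !gt_eqF.
apply: le_trans (cmodD _ _) _; apply: le_trans (lerD h1 h2) _.
by rewrite -mulrDl ler_wpM2r ?exprn_ge0 ?cmod_ge0.
Qed.

Let B0 : 0 <= B. Proof. exact: le_trans ler01 B1. Qed.
Let nN : n%:R <= N%:R :> R.
Proof. by have [/andP[_ h] _ _ _ _] := ad; rewrite ler_nat. Qed.
Let N1 : 1 <= N%:R :> R.
Proof.
have [/andP[h1 h2] _ _ _ _] := ad.
by rewrite ler1n (leq_trans _ h2) // (ltn_trans _ h1).
Qed.
Let N23 : N%:R ^+ 2 <= N%:R ^+ 3 :> R. Proof. by rewrite ler_weXn2l. Qed.
Let N12 : N%:R <= N%:R ^+ 2 :> R. Proof. by rewrite ler_self_exp. Qed.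

Lemma cone_ratio0 : cmod (b * w.1 / (q.[w.2] - b * w.1)) <= cratio / cmod w.2.
Proof.
have := @cone_ratio_le 0 0 1 1; rewrite horner0 add0r [1 * (b * _)]mul1r; apply.
- by rewrite size_poly0.
- by move=> i; rewrite coef0 cmod0.
- by rewrite cmod1.
- by rewrite mulr0 add0r mul1r -[leLHS]mul1r ler_wpM2r // (le_trans N1) //
  (le_trans N12) // lerDr exprn_ge0 // ler0n.
Qed.

Lemma cone_ratio1 :
  cmod (w.2 * q^`().[w.2] / (q.[w.2] - b * w.1) - n%:R) <= cratio / cmod w.2.
Proof.
(* The subtraction cancels the coefficient of degree [n]: coefficient [i] of [q] is multiplied by
   [i - n]. *)
pose p := 'X * q^`() - n%:R *: q.
have sq : size q = n.+1 by case: ad.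
have qB i : cmod q`_i <= B by case: ad.
have pE i : p`_i = (i%:R - n%:R) * q`_i.
  rewrite coefB coefZ coefXM mulrBl; congr (_ - _).
  by case: i => [|i] /=; rewrite ?mul0r // coef_deriv mulr_natl.
have -> : w.2 * q^`().[w.2] / (q.[w.2] - b * w.1) - n%:R =
    (p.[w.2] + n%:R * (b * w.1)) / (q.[w.2] - b * w.1).
  rewrite /p hornerD hornerN hornerZ hornerM hornerX.
  by field; exact: cone_qstep_neq0.
apply: (@cone_ratio_le p (N%:R * B) N%:R).
- apply/leq_sizeP => i; rewrite pE leq_eqVlt => /orP[/eqP<-|ni].
    by rewrite subrr mul0r.
  by rewrite nth_default ?mulr0 // sq.
- move=> i; rewrite pE cmodM.
  have [ni|ni] := ltnP n i.
    by rewrite [q`_i]nth_default ?sq // cmod0 mulr0 mulr_ge0 // ler0n.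
  rewrite ler_pM ?cmod_ge0 // cmodBC -natrB // cmod_nat ler_nat.
  by case: ad => /andP[_ h] _ _ _ _; rewrite (leq_trans (leq_subr _ _)).
- by rewrite cmod_nat.
rewrite mulrA -mulrDl ler_wpM2r // lerD //.
by rewrite (le_trans _ N23) // expr2 ler_wpM2r ?ler0n.
Qed.

Lemma cone_ratio2 :
  cmod (w.2 ^+ 2 * q^`()^`().[w.2] / (q.[w.2] - b * w.1) - (n * n.-1)%:R) <=
  cratio / cmod w.2.
Proof.
(* Same cancellation, with coefficient [i] multiplied by [i (i - 1) - n (n - 1)]. *)
pose p := 'X * ('X * q^`()^`()) - (n * n.-1)%:R *: q.
have sq : size q = n.+1 by case: ad.
have qB i : cmod q`_i <= B by case: ad.
have pE i : p`_i = ((i * i.-1)%:R - (n * n.-1)%:R) * q`_i.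
  rewrite coefB coefZ !coefXM mulrBl; congr (_ - _).
  case: i => [|[|i]] /=; rewrite ?mul0r // coef_deriv coef_deriv -mulrnA.
  by rewrite mulr_natl mulnC.
have -> : w.2 ^+ 2 * q^`()^`().[w.2] / (q.[w.2] - b * w.1) - (n * n.-1)%:R =
    (p.[w.2] + (n * n.-1)%:R * (b * w.1)) / (q.[w.2] - b * w.1).
  rewrite /p hornerD hornerN hornerZ !hornerM hornerX.
  by field; exact: cone_qstep_neq0.
have nnN : ((n * n.-1)%:R <= N%:R ^+ 2 :> R).
  rewrite natrM expr2 ler_pM ?ler0n // (le_trans _ nN) // ler_nat leq_pred //.
apply: (@cone_ratio_le p (N%:R ^+ 2 * B) (N%:R ^+ 2)).
- apply/leq_sizeP => i; rewrite pE leq_eqVlt => /orP[/eqP<-|ni].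
    by rewrite subrr mul0r.
  by rewrite nth_default ?mulr0 // sq.
- move=> i; rewrite pE cmodM.
  have [ni|ni] := ltnP n i.
    by rewrite [q`_i]nth_default ?sq // cmod0 mulr0 mulr_ge0 // exprn_ge0 //
      ler0n.
  rewrite ler_pM ?cmod_ge0 // cmodBC -natrB ?cmod_nat; last first.
    by rewrite leq_mul // -!subn1 leq_sub2r.
  by rewrite (le_trans _ nnN) // ler_nat leq_subr.
- by rewrite cmod_nat.
by rewrite mulrA -mulrDl ler_wpM2r // lerD // exprS ler_wpM2r // exprn_ge0 //
  ler0n.
Qed.

End ConeRatios.

(** * Derivatives of the orbit in the initial point *)

Section OrbitDerivatives.
Variables (R : realType) (q : nat -> {poly R[i]}) (b : nat -> R[i]).
Implicit Types (z v : 'C2[R]).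
Local Notation orb := (orb q b).

Fixpoint dorb v m z : 'C2[R] :=
  if m is m'.+1 then
    ((dorb v m' z).2,
     (q m')^`().[(orb m' z).2] * (dorb v m' z).2 - b m' * (dorb v m' z).1)
  else v.

Fixpoint ddorb v v' m z : 'C2[R] :=
  if m is m'.+1 then
    ((ddorb v v' m' z).2,
     (q m')^`()^`().[(orb m' z).2] * (dorb v m' z).2 * (dorb v' m' z).2 +
     (q m')^`().[(orb m' z).2] * (ddorb v v' m' z).2 - b m' * (ddorb v v' m'
       z).1)
  else 0.

Lemma C2_scaleE (a x y : R[i]) : a *: ((x, y) : 'C2[R]) = (a * x, a * y).
Proof. by []. Qed.

(** Holomorphy of the orbit in [z], in the form used below: first derivatives are complex
    homogeneous in the direction, and [ddorbZ] gives the quadratic version. Applied with the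
    imaginary unit, they make the Laplacian vanish. *)
Lemma dorbZ a v m z : dorb (a *: v) m z = a *: dorb v m z.
Proof.
elim: m => //= m ->; case: (dorb v m z) => x y.
by rewrite !C2_scaleE /=; congr pair; ring.
Qed.

Lemma ddorbZ a v v' m z : ddorb (a *: v) (a *: v') m z = (a * a) *: ddorb v v'
  m z.
Proof.
elim: m => [|m IH] /=; first by rewrite scaler0.
rewrite IH !dorbZ; case: (ddorb v v' m z) => x y.
case: (dorb v m z) => x1 y1; case: (dorb v' m z) => x2 y2.
by rewrite !C2_scaleE /=; congr pair; ring.
Qed.

Lemma orb_is_cderive v m z t :
  is_cderive (fun x : R => (orb m (z + x%:C%C *: v)).1) t
    (dorb v m (z + t%:C%C *: v)).1 /\
  is_cderive (fun x : R => (orb m (z + x%:C%C *: v)).2) t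
    (dorb v m (z + t%:C%C *: v)).2.
Proof.
elim: m => [|m [IH1 IH2]] /=; first by split; exact: is_cderive_line.
split => //; apply: is_cderiveB; first exact: is_cderive_horner.
have := is_cderiveM (is_cderive_cst (b m) t) IH1.
by rewrite mulr0 addr0.
Qed.

Lemma dorb_is_cderive v v' m z t :
  is_cderive (fun x : R => (dorb v m (z + x%:C%C *: v')).1) t
    (ddorb v v' m (z + t%:C%C *: v')).1 /\
  is_cderive (fun x : R => (dorb v m (z + x%:C%C *: v')).2) t
    (ddorb v v' m (z + t%:C%C *: v')).2.
Proof.
elim: m => [|m [IH1 IH2]] /=; first by split; exact: is_cderive_cst.
split => //.
have [_ ho] := orb_is_cderive v' m z t.
have h := is_cderiveB (is_cderiveM (is_cderive_horner (q m)^`() ho) IH2)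
  (is_cderiveM (is_cderive_cst (b m) t) IH1).
by apply: is_cderive_eq h _; ring.
Qed.

Lemma orb_cvg m z :
  (fun x => (orb m x).1) @ z --> (orb m z).1 /\
  (fun x => (orb m x).2) @ z --> (orb m z).2.
Proof.
have FF := nbhs_filter z.
elim: m => [|m [IH1 IH2]] /=; first by split; [exact: cvg_fst|exact: cvg_snd].
split; first exact: IH2.
exact: (cplx_cvgB FF (cplx_cvg_horner (p := q m) FF IH2)
  (cplx_cvgM FF (cplx_cvg_cst (l := b m) FF) IH1)).
Qed.

Lemma dorb_cvg v m z :
  (fun x => (dorb v m x).1) @ z --> (dorb v m z).1 /\
  (fun x => (dorb v m x).2) @ z --> (dorb v m z).2.
Proof.
have FF := nbhs_filter z.
elim: m => [|m [IH1 IH2]] /=; first by split; exact: (cplx_cvg_cst FF).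
split; first exact: IH2; have [_ ho] := orb_cvg m z.
exact: (cplx_cvgB FF (cplx_cvgM FF (cplx_cvg_horner FF ho) IH2)
  (cplx_cvgM FF (cplx_cvg_cst (l := b m) FF) IH1)).
Qed.

Lemma ddorb_cvg v v' m z :
  (fun x => (ddorb v v' m x).1) @ z --> (ddorb v v' m z).1 /\
  (fun x => (ddorb v v' m x).2) @ z --> (ddorb v v' m z).2.
Proof.
have FF := nbhs_filter z.
elim: m => [|m [IH1 IH2]] /=; first by split; exact: (cplx_cvg_cst FF).
split; first exact: IH2; have [_ ho] := orb_cvg m z.
have [_ hv] := dorb_cvg v m z; have [_ hv'] := dorb_cvg v' m z.
exact: (cplx_cvgB FF (cplx_cvgD FF
    (cplx_cvgM FF (cplx_cvgM FF (cplx_cvg_horner FF ho) hv) hv')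
    (cplx_cvgM FF (cplx_cvg_horner FF ho) IH2))
  (cplx_cvgM FF (cplx_cvg_cst (l := b m) FF) IH1)).
Qed.

Definition dlog v m z : R[i] := (dorb v m z).2 / (orb m z).2.

Definition ddratio v v' m z : R[i] := (ddorb v v' m z).2 / (orb m z).2.

Lemma dlog_cvg v m z : (orb m z).2 != 0 -> dlog v m @ z --> dlog v m z.
Proof.
have FF := nbhs_filter z; move=> o0; have [_ h] := dorb_cvg v m z.
have [_ ho] := orb_cvg m z; exact: (cplx_cvgM FF h (cplx_cvgV FF o0 ho)).
Qed.

Lemma ddratio_cvg v v' m z : (orb m z).2 != 0 ->
  ddratio v v' m @ z --> ddratio v v' m z.
Proof.
have FF := nbhs_filter z; move=> o0; have [_ h] := ddorb_cvg v v' m z.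
have [_ ho] := orb_cvg m z; exact: (cplx_cvgM FF h (cplx_cvgV FF o0 ho)).
Qed.

Lemma dlog_is_cderive v v' m z t : (orb m (z + t%:C%C *: v')).2 != 0 ->
  is_cderive (fun x : R => dlog v m (z + x%:C%C *: v')) t
    (ddratio v v' m (z + t%:C%C *: v') -
     dlog v m (z + t%:C%C *: v') * dlog v' m (z + t%:C%C *: v')).
Proof.
move=> o0; have [_ h1] := dorb_is_cderive v v' m z t.
have [_ h2] := orb_is_cderive v' m z t.
apply: is_cderive_eq (is_cderiveM h1 (is_cderiveV o0 h2)) _.
by rewrite /ddratio /dlog; field.
Qed.

End OrbitDerivatives.

(** * Convergence of derivatives in the cone, and the Laplacian *)

Section Pluriharmonic.
Variables (R : realType) (N : nat) (B c : R) (n : nat -> nat).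
Hypotheses (B1 : 1 <= B) (c0 : 0 < c) (c1 : c <= 1).
Variables (q : nat -> {poly R[i]}) (b : nat -> R[i]).
Hypothesis ad : admissible_seq N B c n q b.
Local Notation rad0 := (rad0 N B c).
Local Notation orb := (orb q b).
Local Notation dorb := (dorb q b).
Local Notation ddorb := (ddorb q b).
Local Notation dlog := (dlog q b).
Local Notation ddratio := (ddratio q b).
Local Notation degprod := (degprod n).

Definition escape : set 'C2[R] := [set z | exists m, in_cone rad0 (orb m z)].

(** Unlike [green_approx] it involves no maximum and is differentiable where [y_m] does not vanish;
    the two agree once the orbit is in the cone. *)
Definition log_approx m z : R := ln (cmod (orb m z).2) / (degprod m)%:R.

Definition dlog_approx v m z : R := Re (dlog v m z) / (degprod m)%:R.

Definition ddlog_approx v v' m z : R :=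
  Re (ddratio v v' m z - dlog v m z * dlog v' m z) / (degprod m)%:R.

Lemma cmod_cone_gt0 z m : in_cone rad0 (orb m z) -> 0 < cmod (orb m z).2.
Proof. by move=> h; rewrite (lt_le_trans ltr01) // (cone_cmod_ge1 B1 c0 c1
  (lexx _) h). Qed.

Lemma cone_orb_neq0 z m : in_cone rad0 (orb m z) -> (orb m z).2 != 0.
Proof. by move=> h; rewrite -cmod_gt0 cmod_cone_gt0. Qed.

Lemma cone_stays z m j : in_cone rad0 (orb m z) -> in_cone rad0 (orb (j + m) z).
Proof. by move=> h; case: (orb_cone B1 c0 c1 ad j (lexx _) h). Qed.

(** The inequalities defining the cone are not strict, but one more step makes them so: the new
    second coordinate is at least [expand * |y_m|], while [|y_m|] is at least [rad0] and is the
    modulus of the new first coordinate. Strict inequalities persist nearby. *)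
Lemma near_cone z0 m : in_cone rad0 (orb m z0) ->
  \forall z \near z0, in_cone rad0 (orb m.+1 z).
Proof.
move=> h; have r1 := rad0_ge1 N B1 c0 c1.
have h2 := qstep_expand B1 c0 c1 (ad m) (lexx _) h.
have [h1 h3] := h.
have e8 := expand_ge8 N B1.
have s1 : rad0 < cmod (orb m.+1 z0).2 by apply: lt_le_trans h2; nra.
have s2 : cmod (orb m.+1 z0).1 < cmod (orb m.+1 z0).2.
  by apply: lt_le_trans h2 => /=; nra.
have FF := nbhs_filter z0.
have [cv1 cv2] := orb_cvg q b m.+1 z0.
have k1 := cplx_cvg_cmod cv1; have k2 := cplx_cvg_cmod cv2.
have a1 : \forall z \near z0, rad0 <= cmod (orb m.+1 z).2.
  by apply: (cvgr_ge _ k2).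
pose s := (cmod (orb m.+1 z0).1 + cmod (orb m.+1 z0).2) / 2.
have a2 : \forall z \near z0, s <= cmod (orb m.+1 z).2.
  by apply: (cvgr_ge _ k2); rewrite /s; lra.
have a3 : \forall z \near z0, cmod (orb m.+1 z).1 <= s.
  by apply: (cvgr_le _ k1); rewrite /s; lra.
near=> z; split; first by near: z.
apply: (@le_trans _ _ s); by near: z.
Unshelve. all: by end_near. Qed.

Lemma open_escape : open escape.
Proof.
rewrite openE => z [m hm]; rewrite /interior.
by apply: filterS (near_cone hm) => w hw; exists m.+1.
Qed.

Lemma log_approx_is_derive v m z (t : R) : (orb m (z + t%:C%C *: v)).2 != 0 ->
  is_derive t 1 (fun x : R => log_approx m (z + x%:C%C *: v))
    (dlog_approx v m (z + t%:C%C *: v)).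
Proof.
move=> o0; have [_ h] := orb_is_cderive q b v m z t.
have h1 := is_derive_ln_cmod o0 h.
rewrite (_ : (fun x => _) = (degprod m)%:R^-1 \*:
    (fun x : R => ln (cmod (orb m (z + x%:C%C *: v)).2))); last first.
  by apply/funext => x; rewrite /log_approx mulrC.
by apply: is_derive_eq (is_deriveZ _ h1) _; rewrite /dlog_approx [RHS]mulrC.
Qed.

Lemma dlog_approx_is_derive v v' m z (t : R) :
  (orb m (z + t%:C%C *: v')).2 != 0 ->
  is_derive t 1 (fun x : R => dlog_approx v m (z + x%:C%C *: v'))
    (ddlog_approx v v' m (z + t%:C%C *: v')).
Proof.
move=> o0; have [h _] := dlog_is_cderive v o0.
rewrite (_ : (fun x => _) = (degprod m)%:R^-1 \*:
    (fun x : R => Re (dlog v m (z + x%:C%C *: v')))); last first.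
  by apply/funext => x; rewrite /dlog_approx mulrC.
by apply: is_derive_eq (is_deriveZ _ h) _; rewrite /ddlog_approx [RHS]mulrC.
Qed.

Lemma dlog_approx_cvg v m z : (orb m z).2 != 0 -> {for z,
  continuous (dlog_approx v m)}.
Proof.
move=> o0; have FF := nbhs_filter z.
exact: (cvgM (cplx_cvg_Re (dlog_cvg (v := v) o0)) (@cvg_cst _ _ _ _ FF)).
Qed.

Lemma ddlog_approx_cvg v v' m z : (orb m z).2 != 0 ->
  {for z, continuous (ddlog_approx v v' m)}.
Proof.
move=> o0; have FF := nbhs_filter z.
have h := cplx_cvgB FF (ddratio_cvg (v := v) (v' := v') o0)
  (cplx_cvgM FF (dlog_cvg (v := v) o0) (dlog_cvg (v := v') o0)).
exact: (cvgM (cplx_cvg_Re h) (@cvg_cst _ _ _ _ FF)).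
Qed.

(** Obtained by differentiating [y_{m+2} = q(y_{m+1}) - b y_m] and dividing by [y_{m+2}], each
    derivative being written as its [y] times a logarithmic derivative; [y_m] appears as the first
    coordinate at time [m + 1]. *)
Lemma dlogS v m z : in_cone rad0 (orb m z) ->
  dlog v m.+2 z = (orb m.+1 z).2 * (q m.+1)^`().[(orb m.+1 z).2] / (orb m.+2
    z).2 *
    dlog v m.+1 z - b m.+1 * (orb m.+1 z).1 / (orb m.+2 z).2 * dlog v m z.
Proof.
move=> h; have o0 := cone_orb_neq0 h.
have o1 := cone_orb_neq0 (cone_stays 1 h);
  have o2 := cone_orb_neq0 (cone_stays 2 h).
rewrite /dlog [(dorb v m.+2 z).2]/= [(orb m.+1 z).1]/=.
move: o1 o2; rewrite /= => o1 o2.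
by field; rewrite o0 o1 o2.
Qed.

Lemma ddratioS v v' m z : in_cone rad0 (orb m z) ->
  ddratio v v' m.+2 z =
    (orb m.+1 z).2 ^+ 2 * (q m.+1)^`()^`().[(orb m.+1 z).2] / (orb m.+2 z).2 *
      dlog v m.+1 z * dlog v' m.+1 z +
    (orb m.+1 z).2 * (q m.+1)^`().[(orb m.+1 z).2] / (orb m.+2 z).2 *
      ddratio v v' m.+1 z - b m.+1 * (orb m.+1 z).1 / (orb m.+2 z).2 * ddratio
        v v' m z.
Proof.
move=> h; have o0 := cone_orb_neq0 h.
have o1 := cone_orb_neq0 (cone_stays 1 h);
  have o2 := cone_orb_neq0 (cone_stays 2 h).
rewrite /ddratio /dlog.
move: o1 o2; rewrite /= => o1 o2.
by field; rewrite o0 o1 o2.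
Qed.

Lemma degprodV_le1 m : (degprod m)%:R^-1 <= 1 :> R.
Proof.
have D0 := degprod_gt0 ad m.
by rewrite invf_le1 ?ltr0n // ler1n.
Qed.

(** Turns the defects of the recursions, of the form [r_{j+2} - n_j r_{j+1}], into increments of the
    normalized sequences. *)
Lemma Re_div_degprod (k l : R[i]) m :
  Re l / (degprod m.+1)%:R - Re k / (degprod m)%:R =
    Re (l - (n m)%:R * k) / (degprod m.+1)%:R.
Proof.
have D0 : (degprod m)%:R != 0 :> R by rewrite pnatr_eq0 -lt0n (degprod_gt0 ad).
have n0 : (n m)%:R != 0 :> R.
  by have [/andP[h _] _ _ _ _] := ad m; rewrite pnatr_eq0 -lt0n (ltn_trans _ h).
have -> : Re (l - (n m)%:R * k) = Re l - (n m)%:R * Re k.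
  rewrite Re_add Re_opp Re_mul -(rmorph_nat (real_complex R)) /=.
  by rewrite mul0r subr0.
rewrite degprodS natrM; field; rewrite D0 n0 //.
Qed.

Lemma near_cmod_le (f : 'C2[R] -> R[i]) z0 : f @ z0 --> f z0 ->
  \forall z \near z0, cmod (f z) <= cmod (f z0) + 1.
Proof.
by move=> h; apply: (cvgr_le _ (cplx_cvg_cmod h)); rewrite ltrDl.
Qed.

(** The recursion bounds depend on the point only through their two initial values, and continuity
    bounds these near [z0]. Hence the rates are uniform on a ball, as [uniform_dirderive]
    requires. *)
Lemma local_log_derivatives v v' z0 m0 : in_cone rad0 (orb m0 z0) ->
  exists d C m, 0 < d /\ forall z, pmax (z - z0) < d ->
    in_cone rad0 (orb m z) /\ forall j,
      [/\ `|dlog_approx v (j.+1 + m) z - dlog_approx v (j + m) z| <= C / 2 ^+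
        j.+1,
          `|dlog_approx v' (j.+1 + m) z - dlog_approx v' (j + m) z| <= C / 2 ^+
            j.+1 &
          `|ddlog_approx v v' (j.+1 + m) z - ddlog_approx v v' (j + m) z| <=
          C / 2 ^+ j.+1].
Proof.
move=> h0; pose m1 := m0.+1.
have hm1 : in_cone rad0 (orb m1 z0) by exact: (cone_stays 1 h0).
have o1 := cone_orb_neq0 hm1; have o2 := cone_orb_neq0 (cone_stays 1 hm1).
have FF := nbhs_filter z0.
have e1 := near_cmod_le (dlog_cvg (v := v) o1).
have e2 := near_cmod_le (dlog_cvg (v := v) o2).
have e3 := near_cmod_le (dlog_cvg (v := v') o1).
have e4 := near_cmod_le (dlog_cvg (v := v') o2).
have e5 := near_cmod_le (ddratio_cvg (v := v) (v' := v') o1).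
have e6 := near_cmod_le (ddratio_cvg (v := v) (v' := v') o2).
(* Bounds all six initial values near [z0]. The summand 1 also gives [S <= S ^+ 2], since the
   second-order recursion asks for initial values at most [S ^+ 2]. *)
pose S := 1 + cmod (dlog v m1 z0) + cmod (dlog v m1.+1 z0) +
  cmod (dlog v' m1 z0) + cmod (dlog v' m1.+1 z0) +
  cmod (ddratio v v' m1 z0) + cmod (ddratio v v' m1.+1 z0).
have hn := filterI (near_cone h0)
  (filterI (filterI e1 (filterI e2 e3)) (filterI e4 (filterI e5 e6))).
have [d d0 hd] := (nbhs_pmaxP z0 _).1 (hn FF FF FF FF FF FF).
pose Q : R := N.+2%:R.
(* Twice the sum of the two rate constants; the factor 2 turns [2 ^+ j] into [2 ^+ j.+1]. *)
pose C := 4 * S * Q + 2 * (S ^+ 2 * Q ^+ 2 * (3 + 4 * Q)).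
have S1 : 1 <= S by rewrite /S -!addrA lerDl !addr_ge0 ?cmod_ge0.
have SS : S <= S ^+ 2 by rewrite ler_self_exp.
have S0 : 0 <= S by exact: le_trans S1.
have Q0 : 0 <= Q by rewrite ler0n.
(* One index later than the start of the recursions, because the rates compare the terms [j + 1] and
   [j + 2]. *)
exists d, C, m1.+1; split => // z /hd[hz [[k1 [k2 k3]] [k4 [k5 k6]]]].
have hzj j : in_cone rad0 (orb (j + m1) z) by exact: cone_stays.
split; first exact: (hzj 1%N).
have [b1 b2 b3 b4 [b5 b6]] : [/\ cmod (dlog v m1 z) <= S,
  cmod (dlog v m1.+1 z) <= S, cmod (dlog v' m1 z) <= S,
  cmod (dlog v' m1.+1 z) <= S & cmod (ddratio v v' m1 z) <= S /\
  cmod (ddratio v v' m1.+1 z) <= S].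
  split; [apply: le_trans k1 _|apply: le_trans k2 _|apply: le_trans k3 _|
    apply: le_trans k4 _|split; [apply: le_trans k5 _|apply: le_trans k6 _]];
  have := cmod_ge0 (dlog v m1 z0); have := cmod_ge0 (dlog v m1.+1 z0);
  have := cmod_ge0 (dlog v' m1 z0); have := cmod_ge0 (dlog v' m1.+1 z0);
  have := cmod_ge0 (ddratio v v' m1 z0);
  have := cmod_ge0 (ddratio v v' m1.+1 z0); rewrite /S; lra.
pose A j := (orb (j.+1 + m1) z).2 * (q (j.+1 + m1))^`().[(orb (j.+1 + m1) z).2]
  /
  (orb (j.+2 + m1) z).2.
pose E j := (orb (j.+1 + m1) z).2 ^+ 2 *
  (q (j.+1 + m1))^`()^`().[(orb (j.+1 + m1) z).2] / (orb (j.+2 + m1) z).2.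
pose bb j := b (j.+1 + m1)%N * (orb (j.+1 + m1) z).1 / (orb (j.+2 + m1) z).2.
pose nn j := n (j.+1 + m1).
pose eps j := cratio N B c / cmod (orb (j.+1 + m1) z).2.
have nN j : (nn j <= N)%N by have [/andP[_ ?] _ _ _ _] := ad (j.+1 + m1)%N.
(* At time [m1] the modulus of [y] is at least [rad0 >= cratio]; afterwards it grows by
   [expand >= 2 * Q ^+ 2] at each step. *)
have epsle j : eps j <= (2 * Q ^+ 2) ^- j.
  have [_ hg] := orb_cone B1 c0 c1 ad j.+1 (lexx _) (hzj 0%N).
  have r1 := rad0_ge1 N B1 c0 c1.
  have Ep : 2 * Q ^+ 2 <= expand N B.
    rewrite /expand -mulrA ler_wpM2l // -[leLHS]mulr1 ler_pM ?exprn_ge0 //.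
    by rewrite ler_weXn2l // ler1n.
  have E1 : 1 <= expand N B by rewrite (le_trans _ (expand_ge8 N B1)) // ler1n.
  have X0 : 0 < 2 * Q ^+ 2 by rewrite mulr_gt0 // exprn_gt0 // ltr0n.
  rewrite /eps ler_pdivrMr ?cmod_cone_gt0 // mulrC ler_pdivlMr ?exprn_gt0 //.
  apply: le_trans hg; rewrite mulrC.
  apply: ler_pM; rewrite ?exprn_ge0 ?(ltW X0) ?cratio_ge0 //.
    apply: (@le_trans _ _ (expand N B ^+ j)).
      by rewrite lerXn2r ?nnegrE ?(ltW X0) // (le_trans ler01).
    by rewrite ler_weXn2l.
  by apply: le_trans (cratio_le_rad0 N B1 c0) _; case: (hzj 0%N).
have Ale j : cmod (A j - (nn j)%:R) <= eps j.
  exact: (cone_ratio1 B1 c0 c1 (ad _) (lexx _) (hzj j.+1)).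
have ble j : cmod (bb j) <= eps j.
  exact: (cone_ratio0 B1 c0 c1 (ad _) (lexx _) (hzj j.+1)).
have Ele j : cmod (E j - (nn j * (nn j).-1)%:R) <= eps j.
  exact: (cone_ratio2 B1 c0 c1 (ad _) (lexx _) (hzj j.+1)).
pose r j := dlog v (j + m1) z; pose r' j := dlog v' (j + m1) z.
pose t j := ddratio v v' (j + m1) z.
have rS j : r j.+2 = A j * r j.+1 - bb j * r j by exact: dlogS (hzj j).
have r'S j : r' j.+2 = A j * r' j.+1 - bb j * r' j by exact: dlogS (hzj j).
have tS j : t j.+2 = E j * r j.+1 * r' j.+1 + A j * t j.+1 - bb j * t j.
  exact: ddratioS (hzj j).
have shift k : (k + m1.+1 = k.+1 + m1)%N by rewrite addnS.
move=> j; rewrite !shift.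
have fin (k l : R[i]) (X : R) : X <= C / 2 -> cmod (l - (nn j)%:R * k) <= X / 2
  ^+ j ->
    `|Re l / (degprod (j.+2 + m1))%:R - Re k / (degprod (j.+1 + m1))%:R| <= C /
      2 ^+ j.+1.
  move=> XC hX; rewrite addSn Re_div_degprod normrM.
  have D0 := degprod_gt0 ad (j.+1 + m1).+1.
  rewrite [X in _ * X]ger0_norm ?invr_ge0 ?ler0n //.
  rewrite exprS invfM mulrA -[leRHS]mulr1 ler_pM ?invr_ge0 ?ler0n ?degprodV_le1
    //.
  apply: le_trans (Re_le_cmod _) (le_trans hX _).
  by rewrite ler_wpM2r // invr_ge0 exprn_ge0.
have C1 : 2 * S * Q <= C / 2.
  have : 0 <= S ^+ 2 * Q ^+ 2 * (3 + 4 * Q).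
    by rewrite !mulr_ge0 ?exprn_ge0 // addr_ge0 ?mulr_ge0.
  by rewrite /C; lra.
have C2 : S ^+ 2 * Q ^+ 2 * (3 + 4 * Q) <= C / 2.
  have : 0 <= S * Q by rewrite mulr_ge0.
  by rewrite /C; lra.
have eps' := @log_derivative_rate R Q N nn A bb eps (lexx _) nN epsle Ale ble.
split.
- by apply: (fin (r j.+1) (r j.+2) _ C1); apply: (eps' r).
- by apply: (fin (r' j.+1) (r' j.+2) _ C1); apply: (eps' r').
apply: (fin (t j.+1 - r j.+1 * r' j.+1) (t j.+2 - r j.+2 * r' j.+2) _ C2).
apply: (@second_log_derivative_rate R Q N nn A E bb eps (lexx _) nN epsle Ale
  ble Ele r r' t S) => //.
  exact: le_trans b5 SS.
exact: le_trans b6 SS.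
Qed.

Variable g : 'C2[R] -> R.
Hypothesis gq : orbit_green n q b g.

Lemma log_approx_limit m z : in_cone rad0 (orb m z) ->
  (fun j => log_approx (j + m) z) @ \oo --> g z.
Proof.
move=> h; have r1 := rad0_ge1 N B1 c0 c1.
have : green_approx n q b ^~ z @ \oo --> g z by exact: gq.
rewrite -(cvg_shiftn m) (_ : (fun j => _) = fun j => log_approx (j + m) z) //.
apply/funext => j.
rewrite /log_approx /green_approx cone_trunc_norm //.
by apply: in_cone_le r1 _; exact: cone_stays.
Qed.

(** The first application of [uniform_dirderive] holds on the whole ball, so its limits can serve as
    the functions to be differentiated in the second one. *)
Lemma escape_dirderives v v' z0 : escape z0 ->
  exists d C m, 0 < d /\ forall z, pmax (z - z0) < d ->
    [/\ is_derive (0 : R) 1 (fun x : R =>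
      g (z + x%:C%C *: v)) (dirderive v g z),
        {for z, continuous (dirderive v g)},
        is_derive (0 : R) 1 (fun x : R => dirderive v g (z + x%:C%C *: v'))
          (dirderive v' (dirderive v g) z),
        {for z, continuous (dirderive v' (dirderive v g))} &
        forall j, `|ddlog_approx v v' (j + m) z - dirderive v' (dirderive v g)
          z| <=
          C / 2 ^+ j].
Proof.
move=> [m0 h0]; have [d [C [m [d0 hd]]]] := local_log_derivatives v v' h0.
exists d, C, m; split; first exact: d0.
move=> z hz; have cone w j : pmax (w - z0) < d -> (orb (j + m) w).2 != 0.
  by move=> /hd[h _]; apply: cone_orb_neq0; exact: cone_stays.
have first w : pmax (w - z0) < d -> [/\
    is_derive (0 : R) 1 (fun x : R => g (w + x%:C%C *: v)) (dirderive v g w),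
    forall j, `|dlog_approx v (j + m) w - dirderive v g w| <= C / 2 ^+ j &
    {for w, continuous (dirderive v g)}].
  move=> hw; apply: (@uniform_dirderive _ z0 v d C
    (fun j => log_approx (j + m)) (fun j => dlog_approx v (j + m)) g) hw.
  - by move=> y /hd[h _]; exact: log_approx_limit.
  - by move=> j y t /cone h; apply: log_approx_is_derive; exact: h.
  - by move=> j y /hd[_ /(_ j)[]].
  - by move=> j y /cone h; apply: dlog_approx_cvg; exact: h.
have [f1 f2 f3] := first z hz.
have [s1 s2 s3] : [/\ is_derive (0 : R) 1 (fun x : R =>
  dirderive v g (z + x%:C%C *: v'))
      (dirderive v' (dirderive v g) z),
    forall j, `|ddlog_approx v v' (j + m) z - dirderive v' (dirderive v g) z| <=
      C / 2 ^+ j &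
    {for z, continuous (dirderive v' (dirderive v g))}].
  apply: (@uniform_dirderive _ z0 v' d C (fun j => dlog_approx v (j + m))
    (fun j => ddlog_approx v v' (j + m)) (dirderive v g)) hz.
  - by move=> y /first[_ h _]; exact: rate_cvg h.
  - by move=> j y t /cone h; apply: dlog_approx_is_derive; exact: h.
  - by move=> j y /hd[_ /(_ j)[]].
  - by move=> j y /cone h; apply: ddlog_approx_cvg; exact: h.
by split.
Qed.

(** Both terms are quadratic in the direction and the square of the imaginary unit is -1; so the
    Laplacian of each approximation along a complex line vanishes exactly. *)
Lemma ddlog_approx_i v m z :
  ddlog_approx ('i%C *: v) ('i%C *: v) m z = - ddlog_approx v v m z.
Proof.
rewrite /ddlog_approx (_ : _ - _ = - (ddratio v v m z - dlog v m z * dlog v m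
  z)).
  by rewrite Re_opp mulNr.
rewrite /ddratio /dlog ddorbZ dorbZ.
have -> : (('i%C * 'i%C) *: ddorb v v m z).2 = 'i%C * 'i%C * (ddorb v v m z).2
  by [].
have -> : ('i%C *: dorb v m z).2 = 'i%C * (dorb v m z).2 by [].
have ii : 'i%C * 'i%C = -1 :> R[i] by rewrite -expr2 sqr_i.
rewrite ii; set x := (dorb v m z).2; set y := (orb m z).2.
have -> : 'i%C * x / y * ('i%C * x / y) = 'i%C * 'i%C * (x / y * (x / y)) by
  ring.
by rewrite ii; ring.
Qed.

Theorem orbit_green_pluriharmonic : pluriharmonic_on escape g.
Proof.
have z00 (z : 'C2[R]) (d : R) : 0 < d -> pmax (z - z) < d.
  by move=> d0; rewrite subrr -(scale0r z) pmaxZ cmod0 mul0r.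
split; first exact: open_escape.
- split.
    move=> v z /(escape_dirderives v v)[d [C [m [d0 hd]]]].
    have [[h _] hc _ _ _] := hd z (z00 z _ d0). split; [exact: h|exact: hc].
  move=> v v' z /(escape_dirderives v v')[d [C [m [d0 hd]]]].
  have [_ _ [h _] hc _] := hd z (z00 z _ d0). split; [exact: h|exact: hc].
move=> z v hz.
have [d [C [m [d0 hd]]]] := escape_dirderives v v hz.
have [d' [C' [m' [d'0 hd']]]] := escape_dirderives ('i%C *: v) ('i%C *: v) hz.
have [_ _ _ _ h] := hd z (z00 z _ d0); have [_ _ _ _ h'] := hd' z (z00 z _ d'0).
(* The starting indices [m] and [m'] for the two directions are unrelated; undoing the shifts makes
   the limits comparable. *)
have l1 : ddlog_approx v v ^~ z @ \oo --> dirderive v (dirderive v g) z.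
  by rewrite -(cvg_shiftn m); exact: rate_cvg h.
have l2 : (fun j => ddlog_approx ('i%C *: v) ('i%C *: v) j z) @ \oo -->
    dirderive ('i%C *: v) (dirderive ('i%C *: v) g) z.
  by rewrite -(cvg_shiftn m'); exact: rate_cvg h'.
have l3 : (fun j => ddlog_approx ('i%C *: v) ('i%C *: v) j z) @ \oo -->
    - dirderive v (dirderive v g) z.
  have -> : (fun j => ddlog_approx ('i%C *: v) ('i%C *: v) j z) =
      - (ddlog_approx v v ^~ z).
    by apply/funext => j; rewrite ddlog_approx_i.
  exact: (cvgN l1).
by rewrite (cvg_unique _ l2 l3) // subrr.
Qed.

End Pluriharmonic.

(** * Jensen's inequality over roots of unity *)

Section UnitCircle.
Variable R : realType.
Implicit Types (s t : R).

Definition cis t : R[i] := (cos t +i* sin t)%C.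

Lemma cisD s t : cis (s + t) = cis s * cis t.
Proof.
rewrite /cis cosD sinD; apply/eqP; rewrite eq_complex /= eqxx /=.
by apply/eqP; ring.
Qed.

Lemma cis0 : cis 0 = 1. Proof. by rewrite /cis cos0 sin0. Qed.

Lemma cisMn t k : cis (k%:R * t) = cis t ^+ k.
Proof.
elim: k => [|k IH]; first by rewrite mul0r cis0.
by rewrite -natr1 mulrDl mul1r cisD IH exprSr.
Qed.

Lemma cmod_cis t : cmod (cis t) = 1.
Proof. by rewrite cmodE /= cos2Dsin2 sqrtr1. Qed.

Lemma cis_eq1 t : 0 < t < 2 * pi -> cis t != 1.
Proof.
move=> /andP[t0 t2]; rewrite eq_complex /= negb_and; apply/orP; left.
have h : 0 < sin (t / 2).
  by apply: sin_gt0_pi; rewrite divr_gt0 //= ltr_pdivrMr // mulrC.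
have : cos t = 1 - 2 * sin (t / 2) ^+ 2.
  have {1}-> : t = t / 2 + t / 2 by field.
  rewrite cosD -!expr2; have := cos2Dsin2 (t / 2); lra.
by move=> ->; rewrite lt_eqF // ltrBlDr ltrDl mulr_gt0 // exprn_gt0.
Qed.

Definition zeta N : R[i] := cis (2 * pi / N%:R).

Lemma prim_zeta N : (0 < N)%N -> N.-primitive_root (zeta N).
Proof.
move=> N0; have N0' : (0 : R) < N%:R by rewrite ltr0n.
rewrite /primitive_root_of_unity N0 /=; apply/forallP => -[i iN] /=.
rewrite unity_rootE -cisMn.
have pi0 : 0 < 2 * pi :> R by rewrite mulr_gt0 // pi_gt0.
have [->|ne] := eqVneq i.+1 N.
  have -> : N%:R * (2 * pi / N%:R) = pi *+ 2 :> R.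
    by rewrite mulr2n; field; rewrite gt_eqF.
  by rewrite /cis cos2pi sin2pi eqxx.
rewrite (negPf (cis_eq1 _)) //; apply/andP; split.
  by rewrite mulr_gt0 ?divr_gt0.
rewrite mulrCA -[ltRHS]mulr1 ltr_pM2l // ltr_pdivrMr // mul1r ltr_nat.
by rewrite ltn_neqAle ne.
Qed.

Lemma prod_sub_roots_of_unity N (r a : R[i]) : (0 < N)%N -> r != 0 ->
  \prod_(i < N) (a - r * zeta N ^+ i) = a ^+ N - r ^+ N.
Proof.
move=> N0 r0; have := factor_Xn_sub_1 (prim_zeta N0).
rewrite big_mkord => /(congr1 (fun p => p.[a / r])).
have -> : ('X^N - 1).[a / r] = (a / r) ^+ N - 1 by rewrite !hornerE.
rewrite horner_prod => h.
have -> : a ^+ N - r ^+ N = r ^+ N * ((a / r) ^+ N - 1).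
  by rewrite expr_div_n mulrBr mulr1 mulrCA divff ?mulr1 // expf_neq0.
have -> : r ^+ N = \prod_(i < N) r by rewrite prodr_const card_ord.
rewrite -h -big_split /=.
by apply: eq_bigr => i _; rewrite hornerXsubC mulrBr mulrCA divff ?mulr1.
Qed.

Lemma expr_dominates (x y : R) : 0 <= x -> x < y ->
  exists N0, forall N, (N0 <= N)%N -> 2 * x ^+ N <= y ^+ N.
Proof.
move=> x0 xy; have y0 : 0 < y by exact: le_lt_trans xy.
have z1 : `|x / y| < 1.
  by rewrite ger0_norm ?divr_ge0 ?(ltW y0) // ltr_pdivrMr // mul1r.
have /cvgrPdistC_le/(_ (2^-1)) := cvg_expr z1.
rewrite invr_gt0 ltr0n => /(_ isT)[N0 _ h]; exists N0 => N hN.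
have := h N hN; rewrite /= subr0 ger0_norm ?exprn_ge0 ?divr_ge0 ?(ltW y0) //.
by rewrite expr_div_n ler_pdivrMr ?exprn_gt0 // mulrC ler_pdivlMr // mulrC.
Qed.

Lemma cmod_expr_sub_ge (r : R) (s : seq R[i]) : 0 < r ->
  (forall a, a \in s -> cmod a != r) ->
  exists N0, forall N, (N0 <= N)%N ->
    forall a, a \in s -> cmod a ^+ N / 2 <= cmod (a ^+ N - r%:C%C ^+ N).
Proof.
move=> r0; elim: s => [|a s IH] hs; first by exists 0%N.
have [|N0 h0] := IH; first by move=> x xs; apply: hs; rewrite inE xs orbT.
have [N1 h1] : exists N1, forall N, (N1 <= N)%N ->
    cmod a ^+ N / 2 <= cmod (a ^+ N - r%:C%C ^+ N).
  have rE N : cmod (r%:C%C ^+ N) = r ^+ N by rewrite cmodX cmodR ger0_norm ?ltW.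
  have /hs : a \in a :: s by rewrite inE eqxx.
  rewrite neq_lt => /orP[ar|ra].
    have [N1 h1] := expr_dominates (cmod_ge0 a) ar; exists N1 => N /h1 hN.
    rewrite cmodBC; apply: le_trans (cmodB_ge _ _); rewrite rE cmodX.
    have : 0 <= cmod a ^+ N by rewrite exprn_ge0 // cmod_ge0.
    by move: hN; lra.
  have [N1 h1] := expr_dominates (ltW r0) ra; exists N1 => N /h1 hN.
  apply: le_trans (cmodB_ge _ _); rewrite rE cmodX.
  have : 0 <= r ^+ N by rewrite exprn_ge0 // ltW.
  by move: hN; lra.
exists (maxn N0 N1) => N; rewrite geq_max => /andP[hN0 hN1] x.
by rewrite inE => /orP[/eqP->|]; [exact: h1|exact: h0].
Qed.

(* The product of [a - r w^k] over the [N]-th roots of unity [w^k] is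
   [a^N - r^N], of modulus at least [|a|^N / 2] for large [N] unless
   [|a| = r]. *)
Lemma discrete_jensen (P : {poly R[i]}) (r : R) : 0 < r -> P.[0] != 0 ->
  (forall a, root P a -> cmod a != r) ->
  exists N0, forall N, (N0 <= N)%N -> (0 < N)%N ->
    N%:R * ln (cmod P.[0]) - (size P)%:R * ln 2 <=
    \sum_(k < N) ln (cmod P.[r%:C%C * zeta N ^+ k]).
Proof.
move=> r0 P0 hroot.
have Pn0 : P != 0 by apply: contraNneq P0 => ->; rewrite horner0.
have [s Es] := closed_field_poly_normal P.
set c := lead_coef P in Es.
have c0 : c != 0 by rewrite lead_coef_eq0.
have sroot a : a \in s -> root P a.
  by move=> as_; rewrite Es rootZ // root_prod_XsubC.
have [N0 h0] := cmod_expr_sub_ge r0 (fun a h => hroot a (sroot a h)).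
exists N0 => N /h0 hN Npos; have r0' : r%:C%C != 0 :> R[i].
  by rewrite -cmod_eq0 cmodR normr_eq0 gt_eqF.
have PE x : P.[x] = c * \prod_(a <- s) (x - a).
  rewrite {1}Es hornerZ horner_prod; congr (_ * _).
  by apply: eq_bigr => a _; rewrite hornerXsubC.
have sneq0 a : a \in s -> a != 0.
  by move=> /sroot; apply: contraTneq => ->; rewrite rootE.
have szs : size s = (size P).-1.
  by rewrite Es size_scale // size_prod_XsubC.
have prodE : \prod_(k < N) cmod P.[r%:C%C * zeta N ^+ k] =
    cmod c ^+ N * \prod_(a <- s) cmod (a ^+ N - r%:C%C ^+ N).
  transitivity (\prod_(k < N) (cmod c *
      cmod (\prod_(a <- s) (r%:C%C * zeta N ^+ k - a)))).
    by apply: eq_bigr => k _; rewrite PE cmodM.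
  rewrite big_split /= prodr_const card_ord; congr (_ * _).
  have E (x : R[i]) : cmod (\prod_(a <- s) (x - a)) = \prod_(a <- s) cmod (x -
    a).
    by elim/big_ind2 : _ => [|u u' w w' <- <-|//]; rewrite ?cmod1 ?cmodM.
  under eq_bigr => k _ do rewrite E.
  rewrite exchange_big /=; apply: eq_bigr => a _.
  rewrite -prod_sub_roots_of_unity //.
  have E' (F : 'I_N -> R[i]) : cmod (\prod_(k < N) F k) = \prod_(k < N) cmod (F
    k).
    by elim/big_ind2 : _ => [|u u' w w' <- <-|//]; rewrite ?cmod1 ?cmodM.
  by rewrite E'; apply: eq_bigr => k _; rewrite cmodBC.
(* Each root costs at most a factor 2, whatever [N] is, so the loss in the logarithm disappears
   after division by [N]. *)
have ge : cmod P.[0] ^+ N / 2 ^+ size s <=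
    \prod_(k < N) cmod P.[r%:C%C * zeta N ^+ k].
  rewrite prodE PE cmodM exprMn -mulrA ler_wpM2l ?exprn_ge0 ?cmod_ge0 //.
  have : {in s, forall a,
    cmod a ^+ N / 2 <= cmod (a ^+ N - r%:C%C ^+ N)} by exact: hN.
  move: (s) => u; elim: u => [|a u IH] hu.
    by rewrite !big_nil cmod1 expr1n expr0 divr1.
  rewrite !big_cons /= cmodM exprMn exprS invfM mulrACA.
  rewrite ler_pM ?mulr_ge0 ?invr_ge0 ?exprn_ge0 ?cmod_ge0 //.
    by rewrite sub0r cmodN; apply: hu; rewrite inE eqxx.
  by apply: IH => x xu; apply: hu; rewrite inE xu orbT.
have P0' : 0 < cmod P.[0] by rewrite cmod_gt0.
have lhs0 : 0 < cmod P.[0] ^+ N / 2 ^+ size s by rewrite divr_gt0 ?exprn_gt0.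
have fac k : 0 < cmod P.[r%:C%C * zeta N ^+ k].
  rewrite cmod_gt0; apply: contraTneq isT => h.
  have /hroot : root P (r%:C%C * zeta N ^+ k) by rewrite rootE h.
  by rewrite cmodM cmodX cmod_cis expr1n mulr1 cmodR ger0_norm ?ltW // eqxx.
have -> : \sum_(k < N) ln (cmod P.[r%:C%C * zeta N ^+ k]) =
    ln (\prod_(k < N) cmod P.[r%:C%C * zeta N ^+ k]).
  suff [] : \sum_(k < N) ln (cmod P.[r%:C%C * zeta N ^+ k]) =
    ln (\prod_(k < N) cmod P.[r%:C%C * zeta N ^+ k]) /\
    0 < \prod_(k < N) cmod P.[r%:C%C * zeta N ^+ k] by [].
  elim/big_ind2 : _ => [|x u y w [-> u0] [-> w0]|k _].
  - by rewrite ln1.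
  - by rewrite lnM ?posrE // mulr_gt0.
  - by [].
apply: le_trans (_ : ln (cmod P.[0] ^+ N / 2 ^+ size s) <= _); last first.
  by rewrite ler_ln ?posrE // (lt_le_trans lhs0).
rewrite ln_div ?posrE ?exprn_gt0 // !lnXn // -[X in _ <= X - _]mulr_natl.
rewrite lerD2l lerN2 -[leLHS]mulr_natl ler_wpM2r ?ler_nat ?szs ?leq_pred //.
by rewrite ln_ge0 // ler1n.
Qed.

End UnitCircle.

(** * Riemann sums of continuous functions *)

Section RiemannSum.
Variable R : realType.
Local Notation mu := (@lebesgue_measure R).

Lemma ex_primitive (f : R -> R) (a b : R) : a < b -> continuous f ->
  exists F : R -> R, (forall x, a <= x <= b -> is_derive x 1 F (f x)) /\
    (\int[mu]_(t in `[a, b]) (f t)%:E = (F b - F a)%:E)%E.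
Proof.
(* The primitive is taken on the larger interval from [a - 1] to [b + 1], so that it is
   differentiable at [a] and [b] as well. *)
move=> ab cf; pose u := b + 1.
have fi : mu.-integrable `[a - 1, u] (EFin \o f).
  apply: continuous_compact_integrable; first exact: segment_compact.
  exact: continuous_subspaceT.
pose F x : R := \int[mu]_(t in `[a - 1, x]) f t.
have hF x : a <= x <= b -> is_derive x 1 F (f x).
  move=> /andP[ax xb].
  have xu : x < u by rewrite /u; lra.
  have ax1 : a - 1 < x by lra.
  have [h1 h2] := continuous_FTC1_closed xu fi ax1 (cf x).
  by apply: DeriveDef; [exact: h1|rewrite -derive1E; exact: h2].
have hc x : a <= x <= b -> {for x, continuous F}.
  by move=> /hF[h _]; exact/differentiable_continuous/derivable1_diffP.
have LR : derivable_oo_LRcontinuous F a b.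
  split.
  - move=> x; rewrite in_itv /= => /andP[ax xb].
    by have [|h _] := hF x _; [rewrite (ltW ax) (ltW xb)|exact: h].
  - by apply: cvg_at_right_filter; apply: hc; rewrite lexx ltW.
  - by apply: cvg_at_left_filter; apply: hc; rewrite lexx ltW.
have F'f : {in `]a, b[, derive1 F =1 f}.
  move=> x; rewrite in_itv /= => /andP[ax xb]; rewrite derive1E.
  by have [|_ h] := hF x _; [rewrite (ltW ax) (ltW xb)|exact: h].
exists F; split; first exact: hF.
by rewrite (continuous_FTC2 ab (continuous_subspaceT cf) LR F'f).
Qed.

(** With a primitive the integral is a telescoping sum of increments, and the mean value theorem
    turns each into the mesh times a value of [f] within one mesh of the sample point. *)
Lemma riemann_sum_le_integral (f : R -> R) (T e : R) N : (0 < N)%N -> 0 < T ->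
  continuous f -> (forall s t, `|s - t| <= T / N%:R -> f s - e <= f t) ->
  ((T * (N%:R^-1 * \sum_(k < N) f (k%:R * (T / N%:R)) - e))%:E <=
    \int[mu]_(t in `[0%R, T]) (f t)%:E)%E.
Proof.
move=> N0 T0 cf hf; have [F [dF ->]] := ex_primitive T0 cf.
set h := T / N%:R; have N0' : (0 : R) < N%:R by rewrite ltr0n.
have h0 : 0 < h by rewrite divr_gt0.
have TE : T = N%:R * h by rewrite /h mulrC divfK // gt_eqF.
rewrite lee_fin.
have step k : (k < N)%N -> h * (f (k%:R * h) - e) <= F (k.+1%:R * h) - F (k%:R
  * h).
  move=> kN; have lt : k%:R * h < k.+1%:R * h by rewrite ltr_pM2r // ltr_nat.
  have inT x : k%:R * h <= x <= k.+1%:R * h -> 0 <= x <= T.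
    move=> /andP[h1 h2]; apply/andP; split.
      by apply: le_trans h1; rewrite mulr_ge0 // ltW.
    by rewrite (le_trans h2) // [leRHS]TE ler_wpM2r ?ler_nat // ltW.
  have dFk y : y \in `]k%:R * h, k.+1%:R * h[ -> is_derive y 1 F (f y).
    by rewrite in_itv /= => /andP[a1 a2]; apply: dF; apply: inT;
      rewrite (ltW a1) (ltW a2).
  have cFk : {within `[k%:R * h, k.+1%:R * h], continuous F}.
    apply: derivable_within_continuous => x.
    by rewrite in_itv /= => /inT/dF[dFx _]; exact: dFx.
  have [x] := MVT lt dFk cFk.
  rewrite in_itv /= => /andP[a1 a2] ->.
  have -> : k.+1%:R * h - k%:R * h = h by rewrite -mulrBl -natrB // subSnn
    mul1r.
  rewrite mulrC ler_wpM2r ?(ltW h0) //; apply: hf.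
  rewrite distrC ger0_norm ?subr_ge0 ?(ltW a1) // -/h lerBlDr.
  by rewrite (le_trans (ltW a2)) // -natr1 mulrDl mul1r addrC.
have tele : \sum_(k < N) (F (k.+1%:R * h) - F (k%:R * h)) = F T - F 0.
  rewrite TE -[in RHS](mul0r h) -[in F (0 * h)]/(0%:R).
  by rewrite -(big_mkord xpredT (fun k => F (k.+1%:R * h) - F (k%:R * h)))
    (telescope_sumr (fun k => F (k%:R * h))).
rewrite -tele; apply: le_trans (_ : \sum_(k < N) h * (f (k%:R * h) - e) <= _);
  last first.
  by apply: ler_sum => k _; exact: step.
rewrite -mulr_sumr sumrB sumr_const card_ord -[_ *+ N]mulr_natl /h.
rewrite le_eqVlt; apply/orP; left; apply/eqP; field; rewrite gt_eqF //.
Qed.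

End RiemannSum.

(** * Sub-mean inequality for the approximations *)

Section SubMeanValue.
Variables (R : realType) (q : nat -> {poly R[i]}) (b : nat -> R[i]).
Implicit Types (z v : 'C2[R]).

Lemma orb_line_poly m z v : exists P : {poly R[i]} * {poly R[i]},
  forall x : R[i],
  orb q b m (z + x *: v) = (P.1.[x], P.2.[x]).
Proof.
elim: m => [|m [[P1 P2] IH]].
  exists (z.1%:P + v.1 *: 'X, z.2%:P + v.2 *: 'X) => x.
  have E (s t : R[i]) : (s%:P + t *: 'X).[x] = s + x * t.
    by rewrite hornerD hornerC hornerZ hornerX mulrC.
  by rewrite /= !E; case: z; case: v.
exists (P2, q m \Po P2 - (b m)%:P * P1) => x /=.
by rewrite IH /qstep /= !hornerE horner_comp.
Qed.

Definition circle_point z v (r t : R) : 'C2[R] := z + (r%:C%C * cis t) *: v.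

(** Roots of modulus at least 1 impose nothing; for each of the finitely many others, [d] is reduced
    to at most [1 - cmod a]. *)
Lemma avoid_radii (P : {poly R[i]}) (d : R) : P != 0 -> 0 < d ->
  exists2 r : R, 1 - d < r < 1 & forall a, root P a -> cmod a != r.
Proof.
move=> P0 d0; have [s Es] := closed_field_poly_normal P.
have hs a : root P a -> a \in s.
  by rewrite {1}Es rootZ ?lead_coef_eq0 // root_prod_XsubC.
suff [r r1 hr] : exists2 r : R, 1 - d < r < 1 & forall a,
  a \in s -> cmod a != r.
  by exists r => // a /hs; exact: hr.
elim: (s) {Es hs} d d0 => [|a s' IH] d d0.
  by exists (1 - d / 2) => //; apply/andP; split; lra.
have [|ha] := leP 1 (cmod a).
  move=> a1; have [r /andP[r1 r2] hr] := IH d d0; exists r; first by rewrite r1.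
  move=> x; rewrite inE => /orP[/eqP->|/hr//].
  by rewrite gt_eqF // (lt_le_trans r2).
have [|r /andP[r1 r2] hr] := IH (Num.min d (1 - cmod a)).
  by rewrite lt_min d0 subr_gt0.
exists r => [|x].
  by rewrite r2 andbT (le_lt_trans _ r1) // lerD2l lerN2 ge_min lexx.
rewrite inE => /orP[/eqP->|/hr//]; rewrite lt_eqF // (le_lt_trans _ r1) //.
have : Num.min d (1 - cmod a) <= 1 - cmod a by rewrite ge_min lexx orbT.
lra.
Qed.

Lemma ln_trunc_norm1_ge0 z : 0 <= ln (trunc_norm 1 z).
Proof. by rewrite ln_ge0 // trunc_norm_ger. Qed.

(** At the center the maximum of 1 and the two coordinate moduli is attained either by 1, and then
    nonnegativity on the circle suffices, or by one coordinate. That coordinate is a polynomial on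
    the line and stays below the maximum everywhere, so [discrete_jensen] applies to it. *)
Lemma trunc_norm_submean m z v (d e : R) : 0 < d -> 0 < e ->
  exists2 r : R, 1 - d < r < 1 & exists N0, forall N,
    (N0 <= N)%N -> (0 < N)%N ->
    ln (trunc_norm 1 (orb q b m z)) - e <=
    N%:R^-1 * \sum_(k < N) ln (trunc_norm 1
      (orb q b m (circle_point z v r (k%:R * (2 * pi / N%:R))))).
Proof.
move=> d0 e0; have [[P1 P2] hP] := orb_line_poly m z v.
have Pz : orb q b m z = (P1.[0], P2.[0]) by rewrite -hP scale0r addr0.
have [le1|gt1] := leP (pmax (orb q b m z)) 1.
  exists (1 - d / 2); first by apply/andP; split; lra.
  exists 0%N => N _ N0; rewrite {1}/trunc_norm (max_idPl le1) ln1.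
  apply: (@le_trans _ _ 0); first by lra.
  by rewrite mulr_ge0 ?invr_ge0 // sumr_ge0 // => k _;
    exact: ln_trunc_norm1_ge0.
have [P Pgt1 Ple] : exists2 P : {poly R[i]},
    cmod P.[0] = trunc_norm 1 (orb q b m z) &
    forall x : R[i], cmod P.[x] <= trunc_norm 1 (orb q b m (z + x *: v)).
  rewrite /trunc_norm (max_idPr (ltW gt1)) Pz /pmax /=.
  have [h|h] := leP (cmod P1.[0]) (cmod P2.[0]).
    by exists P2 => // x; rewrite hP !le_max lexx !orbT.
  by exists P1 => // x; rewrite hP !le_max lexx !orbT.
have P0 : P.[0] != 0.
  by rewrite -cmod_gt0 Pgt1 trunc_norm_gt0.
have Pn0 : P != 0 by apply: contraNneq P0 => ->; rewrite horner0.
have dm0 : 0 < Num.min d 1 by rewrite lt_min d0 ltr01.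
have [r /andP[r1 r2] hr] := avoid_radii Pn0 dm0.
have [m1 m2] : Num.min d 1 <= d /\ Num.min d 1 <= 1.
  by rewrite !ge_min !lexx orbT.
have r0 : 0 < r by move: r1 m2; lra.
exists r; first by rewrite r2 andbT; move: r1 m1; lra.
have [N0 hN] := discrete_jensen r0 P0 hr.
(* From this index on, the loss [(size P) * ln 2] of [discrete_jensen] is at most [N * e]. *)
pose N1 := Num.bound ((size P)%:R * ln 2 / e).
have l2 : 0 <= ln 2 :> R by rewrite ln_ge0 // ler1n.
have sl : 0 <= (size P)%:R * ln 2 / e by rewrite divr_ge0 ?mulr_ge0 ?ler0n //
  ltW.
exists (maxn N0 N1) => N; rewrite geq_max => /andP[/hN h1 h2] Np.
have {}h1 := h1 Np; have Np' : (0 : R) < N%:R by rewrite ltr0n.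
have h3 : (size P)%:R * ln 2 <= N%:R * e.
  rewrite -ler_pdivrMr //; apply: le_trans (ltW (archi_boundP sl)) _.
  by rewrite ler_nat.
have h4 : \sum_(k < N) ln (cmod P.[r%:C%C * zeta R N ^+ k]) <=
    \sum_(k < N) ln (trunc_norm 1
      (orb q b m (circle_point z v r (k%:R * (2 * pi / N%:R))))).
  apply: ler_sum => k _; rewrite /circle_point cisMn -/(zeta R N).
  have Pk : P.[r%:C%C * zeta R N ^+ k] != 0.
    apply: contraTneq isT => h.
    have /hr : root P (r%:C%C * zeta R N ^+ k) by rewrite rootE h.
    by rewrite cmodM cmodX cmod_cis expr1n mulr1 cmodR ger0_norm ?ltW // eqxx.
  by rewrite ler_ln ?posrE ?cmod_gt0 ?trunc_norm_gt0.
rewrite mulrC ler_pdivlMr // mulrC -Pgt1; move: h1 h3 h4; lra.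
Qed.

End SubMeanValue.

(** * Plurisubharmonicity *)

Section Plurisubharmonic.
Variables (R : realType) (N : nat) (B c : R) (n : nat -> nat).
Hypotheses (B1 : 1 <= B) (c0 : 0 < c) (c1 : c <= 1).
Variables (q : nat -> {poly R[i]}) (b : nat -> R[i]).
Hypothesis ad : admissible_seq N B c n q b.
Variable g : 'C2[R] -> R.
Hypothesis gq : orbit_green n q b g.
Local Notation rad0 := (rad0 N B c).

Lemma orbit_green_uniformly_continuous r (e : R) : rad0 <= r -> 0 < e ->
  exists2 d, 0 < d & forall w w', in_bidisc r w -> in_bidisc r w' ->
    pmax (w - w') < d -> `|g w - g w'| <= e.
Proof.
move=> r0 e0.
have [al [L [/andP[al0 al1] [L0 hL]]]] := orbit_green_hoelder B1 c0 c1 ad gq r0.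
have eL : 0 < e / (L + 1) by rewrite divr_gt0 // ltr_wpDl.
(* The distance at which the Hoelder bound with constant [L + 1] equals [e]; the added 1 avoids
   division by zero. *)
pose d0 := (e / (L + 1)) `^ al^-1.
have d00 : 0 < d0 by rewrite powR_gt0.
exists (Num.min 1 d0); first by rewrite lt_min ltr01.
move=> w w' hw hw'; rewrite lt_min => /andP[h1 h2].
apply: le_trans (hL w w' hw hw' (ltW h1)) _.
apply: (@le_trans _ _ ((L + 1) * (e / (L + 1)))); last first.
  by rewrite mulrC divfK // gt_eqF // ltr_wpDl.
rewrite ler_pM ?powR_ge0 ?lerDl //.
have -> : e / (L + 1) = d0 `^ al.
  by rewrite /d0 -powRrM mulVf ?gt_eqF // powRr1 // ltW.
by apply: ge0_ler_powR; rewrite ?nnegrE ?pmax_ge0 // ltW.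
Qed.

Lemma bidisc_exhaust (t : R) : exists2 r, rad0 <= r & t <= r.
Proof. by exists (Num.max rad0 t); rewrite le_max lexx // orbT. Qed.

Lemma orbit_green_continuous z : {for z, continuous g}.
Proof.
apply/(@cvgrPdistC_le _ _ _ (nbhs z) (nbhs_filter z)) => e e0.
have [r r0 hr] := bidisc_exhaust (pmax z + 1).
have [d d0 hd] := orbit_green_uniformly_continuous r0 e0.
apply/nbhs_pmaxP; exists (Num.min 1 d); first by rewrite lt_min ltr01.
move=> w; rewrite lt_min => /andP[h1 h2]; apply: hd => //.
  rewrite /in_bidisc -[w](subrK z) (le_trans (pmaxD _ _)) // (le_trans _ hr) //.
  by rewrite addrC lerD2l ltW.
by rewrite /in_bidisc (le_trans _ hr) // lerDl.
Qed.

Lemma cis_near0 (e : R) : 0 < e ->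
  exists2 d, 0 < d & forall t, `|t| < d -> cmod (cis t - 1) < e.
Proof.
move=> e0; have e2 : 0 < e / 2 by rewrite divr_gt0.
have hcos : cos t @[t --> (0 : R)] --> cos (0 : R) by exact: continuous_cos.
have hsin : sin t @[t --> (0 : R)] --> sin (0 : R) by exact: continuous_sin.
move/cvgrPdistC_lt/(_ _ e2): hcos; move/cvgrPdistC_lt/(_ _ e2): hsin.
rewrite cos0 sin0 => -[d1 /= d10 h1] [d2 /= d20 h2].
exists (Num.min d1 d2); first by rewrite lt_min d10.
move=> t; rewrite lt_min => /andP[t1 t2].
have k1 : `|sin t - 0| < e / 2 by apply: h1; rewrite /= sub0r normrN.
have k2 : `|cos t - 1| < e / 2 by apply: h2; rewrite /= sub0r normrN.
apply: (le_lt_trans (cmod_le_ReIm (cis t - 1))).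
rewrite (_ : complex.Re _ = cos t - 1) // (_ : complex.Im _ = sin t - 0) //.
by move: k1 k2; lra.
Qed.

Lemma cmod_cisB (s t : R) : cmod (cis s - cis t) = cmod (cis (s - t) - 1).
Proof.
rewrite -[RHS]mul1r -(cmod_cis t) -cmodM mulrBr mulr1 -cisD.
by congr (cmod (cis _ - _)); ring.
Qed.

Section Circle.
Variables (z v : 'C2[R]).

Lemma circle_pointB r s t : pmax (circle_point z v r s - circle_point z v r t) =
  `|r| * cmod (cis (s - t) - 1) * pmax v.
Proof.
rewrite /circle_point opprD addrACA subrr add0r -scalerBl pmaxZ.
by rewrite -mulrBr cmodM cmodR cmod_cisB.
Qed.

Lemma circle_point_radius r t : pmax (circle_point z v r t - circle_point z v 1
  t) =
  `|r - 1| * pmax v.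
Proof.
rewrite /circle_point opprD addrACA subrr add0r -scalerBl pmaxZ.
by rewrite -mulrBl cmodM cmod_cis mulr1 -rmorphB cmodR.
Qed.

Lemma circle_point_bidisc r t : `|r| <= 1 ->
  pmax (circle_point z v r t) <= pmax z + pmax v.
Proof.
move=> r1; rewrite (le_trans (pmaxD _ _)) // lerD2l pmaxZ cmodM cmod_cis mulr1.
by rewrite cmodR ler_piMl // pmax_ge0.
Qed.

Lemma orbit_green_circle_uniform (e : R) : 0 < e -> exists2 d, 0 < d &
  forall s t, `|s - t| < d ->
    `|g (circle_point z v 1 s) - g (circle_point z v 1 t)| <= e.
Proof.
move=> e0; have [r r0 hr] := bidisc_exhaust (pmax z + pmax v).
have [d1 d10 hd1] := orbit_green_uniformly_continuous r0 e0.
have p0 : 0 < pmax v + 1 by rewrite ltr_wpDl ?pmax_ge0.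
have [d d0 hd] := cis_near0 (divr_gt0 d10 p0).
exists d => // s t st; apply: hd1; rewrite ?/in_bidisc.
- by rewrite (le_trans _ hr) // circle_point_bidisc // normr1.
- by rewrite (le_trans _ hr) // circle_point_bidisc // normr1.
rewrite circle_pointB normr1 mul1r; have := hd _ st.
rewrite ltr_pdivlMr // => h; apply: le_lt_trans h.
by rewrite ler_wpM2l ?cmod_ge0 // lerDl.
Qed.

Lemma orbit_green_sub_mean :
  ((g z)%:E <= ((2 * pi)^-1)%R%:E *
    \int[lebesgue_measure]_(t in `[0%R,
      (2 * pi)%R]) (g (circle_point z v 1 t))%:E)%E.
Proof.
pose phi t := g (circle_point z v 1 t).
have pi2 : 0 < 2 * pi :> R by rewrite mulr_gt0 // pi_gt0.
have cphi : continuous phi.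
  move=> t; apply/cvgrPdist_le => e e0.
  have [d d0 hd] := orbit_green_circle_uniform e0.
  by exists d => // s /= st; apply: hd.
have [F [_ hF]] := ex_primitive pi2 cphi.
rewrite hF -EFinM lee_fin; apply/ler_addgt0Pr => e' e'0.
(* Five errors: the approximation at [z], the discrete Jensen inequality, the approximation on the
   inner circle, the passage to radius 1, and the Riemann sum. *)
pose e := e' / 5; have e0 : 0 < e by rewrite divr_gt0.
have e5 : e' = 5 * e by rewrite /e mulrC divfK.
have [r r0 hr] := bidisc_exhaust (pmax z + pmax v).
have r1 : 1 <= r by exact: le_trans (rad0_ge1 N B1 c0 c1) r0.
have [d1 d10 hd1] := orbit_green_uniformly_continuous r0 e0.
have [d2 d20 hd2] := orbit_green_circle_uniform e0.
have p0 : 0 < pmax v + 1 by rewrite ltr_wpDl ?pmax_ge0.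
set CC := clog N B c r + ln r.
have CC0 : 0 <= CC by rewrite addr_ge0 ?ln_ge0 // clog_ge0.
have [m hm] : exists m : nat, CC / 2 ^+ m <= e.
  exists (Num.bound (CC / e)); rewrite ler_pdivrMr ?exprn_gt0 // mulrC.
  rewrite -ler_pdivrMr //; apply: le_trans (ltW (archi_boundP _)) _.
    by rewrite divr_ge0 // ltW.
  by rewrite -natrX ler_nat ltnW // ltn_expl.
have dd0 : 0 < Num.min 1 (d1 / (pmax v + 1)) by rewrite lt_min ltr01 divr_gt0.
have [rho /andP[rho1 rho2] [N0 hN]] := trunc_norm_submean q b m z v dd0 e0.
(* Chosen after [m] and [rho]: large enough for the Jensen step, positive, and with mesh below the
   modulus of continuity [d2]. *)
pose NN := maxn (maxn N0 1) (Num.bound (2 * pi / d2)).+1.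
have hN0 : (N0 <= NN)%N by rewrite leq_max leq_max leqnn.
have NN0 : (0 < NN)%N by rewrite leq_max leq_max leqnn orbT.
have NNd : 2 * pi / NN%:R < d2.
  rewrite ltr_pdivrMr ?ltr0n // [ltRHS]mulrC -ltr_pdivrMr //.
  have pd : 0 <= 2 * pi / d2 by rewrite divr_ge0 // ltW.
  apply: lt_trans (archi_boundP pd) _.
  by rewrite ltr_nat leq_max leqnn orbT.
have NN0' : (0 : R) < NN%:R by rewrite ltr0n.
have RS := @riemann_sum_le_integral R phi (2 * pi) e NN NN0 pi2 cphi.
rewrite hF lee_fin in RS.
have {}RS : NN%:R^-1 * (\sum_(k < NN) phi (k%:R * (2 * pi / NN%:R))) - e <=
    (2 * pi)^-1 * (F (2 * pi) - F 0).
  rewrite [leRHS]mulrC ler_pdivlMr // [leLHS]mulrC; apply: RS => s t st.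
  have := hd2 s t (le_lt_trans st NNd); rewrite ler_norml /phi; lra.
have D0 : (0 : R) < (degprod n m)%:R by rewrite ltr0n (degprod_gt0 ad).
have rho01 : `|rho| <= 1.
  rewrite ger0_norm ?ltW //; have : Num.min 1 (d1 / (pmax v + 1)) <= 1.
    by rewrite ge_min lexx.
  by move: rho1; lra.
have hz : in_bidisc r z by rewrite /in_bidisc (le_trans _ hr) // lerDl pmax_ge0.
have approx_z := orbit_green_rate B1 c0 c1 ad m gq r0 hz.
have point t : green_approx n q b m (circle_point z v rho t) <= phi t + 2 * e.
  have hb : in_bidisc r (circle_point z v rho t).
    by rewrite /in_bidisc (le_trans _ hr) // circle_point_bidisc.
  have h1 := orbit_green_rate B1 c0 c1 ad m gq r0 hb.
  have h2 : `|g (circle_point z v rho t) - phi t| <= e.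
    apply: hd1; first exact: hb.
      by rewrite /in_bidisc (le_trans _ hr) // circle_point_bidisc // normr1.
    rewrite circle_point_radius;
      apply: (@le_lt_trans _ _ (`|rho - 1| * (pmax v + 1))).
      by rewrite ler_wpM2l // lerDl.
    rewrite -ltr_pdivlMr // ltr0_norm ?subr_lt0 // opprB.
    have : Num.min 1 (d1 / (pmax v + 1)) <= d1 / (pmax v + 1).
      by rewrite ge_min lexx orbT.
    by move: rho1; lra.
  by move: h1 h2 hm; rewrite -/CC !ler_norml; lra.
have mean : green_approx n q b m z - e <=
    NN%:R^-1 * \sum_(k < NN) green_approx n q b m
      (circle_point z v rho (k%:R * (2 * pi / NN%:R))).
  rewrite /green_approx -mulr_suml mulrA lerBlDr.
  have := hN NN hN0 NN0; rewrite lerBlDr => h.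
  apply: (@le_trans _ _ ((NN%:R^-1 * (\sum_(k < NN) ln (trunc_norm 1 (orb q b m
    (circle_point z v rho (k%:R * (2 * pi / NN%:R)))))) + e) / (degprod n
      m)%:R)).
    by rewrite ler_pM2r ?invr_gt0.
  by rewrite mulrDl lerD2l ler_piMr ?(ltW e0) // (le_trans (degprodV_le ad m))
    //
    invf_le1 ?exprn_gt0 // exprn_ege1 // ler1n.
have mean2 : NN%:R^-1 * (\sum_(k < NN) green_approx n q b m
      (circle_point z v rho (k%:R * (2 * pi / NN%:R)))) <=
    NN%:R^-1 * (\sum_(k < NN) phi (k%:R * (2 * pi / NN%:R))) + 2 * e.
  apply: (@le_trans _ _ (NN%:R^-1 *
      \sum_(k < NN) (phi (k%:R * (2 * pi / NN%:R)) + 2 * e))).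
    by rewrite ler_wpM2l ?invr_ge0 ?(ltW NN0') //; apply: ler_sum => k _;
      exact: point.
  rewrite big_split /= sumr_const card_ord mulrDr lerD2l -[(2 * e) *+
    _]mulr_natl.
  by rewrite mulKf // gt_eqF.
move: RS mean mean2 approx_z hm; rewrite -/CC ler_norml e5; lra.
Qed.

End Circle.

Theorem orbit_green_plurisubharmonic : plurisubharmonic (fun z => (g z)%:E).
Proof.
split=> [z|z a|z v]; first exact: ltry.
- rewrite -EFinN lte_fin => az.
  have h : (fun w => - g w) @ z --> - g z by apply: cvgN;
    exact: orbit_green_continuous.
  exists [set w | a < - g w]; last by move=> w; rewrite -EFinN lte_fin.
  have e0 : 0 < - g z - a by rewrite subr_gt0.
  move/(@cvgrPdist_lt _ _ _ (nbhs z) (nbhs_filter z))/(_ _ e0): h.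
  by apply: filterS => w /=; rewrite ltr_norml; lra.
have := orbit_green_sub_mean z v.
rewrite (_ : (fun t => (g (circle_point z v 1 t))%:E) =
  fun t => (g (z + (cos t +i* sin t)%C *: v))%:E) //.
by apply/funext => t; rewrite /circle_point rmorph1 mul1r.
Qed.

End Plurisubharmonic.

(** * Compact convergence, bounds over [M], comparison of logarithms *)

Section CompactConvergence.
Variable R : realType.

Lemma compact_cvgP (T : Type) (F : set_system T) (FF : Filter F)
    (u : T -> 'C2[R] -> R) (g : 'C2[R] -> R) :
  (forall r e : R, 0 < e -> \forall t \near F, forall z, pmax z <= r ->
    `|g z - u t z| < e) ->
  {family compact, u @ F --> g}.
Proof.
move=> h; apply/fam_cvgP =>
  K /compact_in_bidisc[r hr] P /uniform_nbhs[E [entE hE]].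
move: entE; rewrite -entourage_ballE => -[e /= e0 he].
apply: filterS (h r e e0) => t ht; apply: hE => z Kz.
by apply: he; exact: ht _ (hr _ Kz).
Qed.

Lemma bounded_on_compact (T : topologicalType) (M : set T) (f : T -> R[i]) :
  compact M -> {within M, continuous f} ->
  exists C : R, forall l, M l -> cmod (f l) <= C.
Proof.
move=> Mc fc.
have /compact_bounded[r [_ hr]] : compact (@cmod R @` (f @` M)).
  apply: continuous_compact; last exact: continuous_compact.
  by apply: continuous_subspaceT; exact: continuous_cmod.
exists (r + 1) => l Ml; apply: le_trans (ler_norm _) _.
by apply: hr; [rewrite ltrDl | exists (f l) => //; exists l].
Qed.

Lemma uniform_bound (I : finType) (T : Type) (M : set T) (f : I -> T -> R[i]) :
  (forall i, exists C : R, forall l, M l -> cmod (f i l) <= C) ->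
  exists C : R, forall i l, M l -> cmod (f i l) <= C.
Proof.
move=> /choice[C hC]; exists (\sum_i `|C i|) => i l Ml.
rewrite (bigD1 i) //=; apply: le_trans (hC i l Ml) _.
by apply: le_trans (ler_norm _) _; rewrite lerDl sumr_ge0.
Qed.

Lemma logplusE (t : R) : logplus t = ln (Num.max 1 t).
Proof.
rewrite /logplus; have [t1|t1] := leP t 1.
  rewrite ln1; apply/max_idPr; have [t0|t0] := leP t 0; first by rewrite ln0.
  by rewrite -ln1 ler_ln ?posrE.
by apply/max_idPl; rewrite ln_ge0 // ltW.
Qed.

Lemma logplus_enorm_ge (z : 'C2[R]) : ln (trunc_norm 1 z) <= logplus (enorm z).
Proof.
rewrite logplusE ler_ln ?posrE ?lt_max ?ltr01 //.
by rewrite ge_max !le_max lexx /= pmax_le_enorm orbT.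
Qed.

Lemma logplus_enorm_le (z : 'C2[R]) :
  logplus (enorm z) <= ln (trunc_norm 1 z) + ln 2.
Proof.
have t0 : 0 < trunc_norm 1 z by exact: trunc_norm_gt0.
rewrite logplusE -lnM ?posrE // ler_ln ?posrE ?mulr_gt0 ?lt_max ?ltr01 //.
have h1 := trunc_norm_ger 1 z; have h2 := trunc_norm_gep 1 z.
have := enorm_le_pmax z => h3; rewrite ge_max; apply/andP; split; lra.
Qed.

End CompactConvergence.

(** * Transport through the exchange of coordinates *)

Section Swap.
Variable R : realType.
Implicit Types (z v : 'C2[R]) (u : 'C2[R] -> R) (e : bool).

(* The minus sign is handled by exchanging the coordinates. *)
Definition sw e z : 'C2[R] := if e then z else (z.2, z.1).

Lemma swK e : involutive (sw e).
Proof. by case: e => // -[x y]. Qed.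

Lemma swD e z v : sw e (z + v) = sw e z + sw e v.
Proof. by case: e. Qed.

Lemma swZ e (k : R[i]) z : sw e (k *: z) = k *: sw e z.
Proof. by case: e. Qed.

Lemma swB e z v : sw e (z - v) = sw e z - sw e v.
Proof. by case: e. Qed.

Lemma pmax_sw e z : pmax (sw e z) = pmax z.
Proof. by case: e; rewrite // /pmax maxC. Qed.

Lemma enorm_sw e z : enorm (sw e z) = enorm z.
Proof. by case: e; rewrite // /enorm addrC. Qed.

Lemma sw_cvg e z : sw e @ z --> sw e z.
Proof.
apply/(cvg_C2P (nbhs_filter z)) => d d0; apply/nbhs_pmaxP; exists d => // w.
by rewrite -swB pmax_sw.
Qed.

Lemma dirderive_sw e v u : dirderive v (u \o sw e) = dirderive (sw e v) u \o sw
  e.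
Proof.
apply/funext => z; rewrite /dirderive /=; congr (derive1 _ _).
by apply/funext => t; rewrite /= swD swZ.
Qed.

Lemma of_class_C1_sw e (A : set 'C2[R]) u : of_class_C1 A u ->
  of_class_C1 (sw e @^-1` A) (u \o sw e).
Proof.
move=> h v z Az; have [h1 h2] := h (sw e v) _ Az; split.
  rewrite (_ : (fun t => _) = fun t : R => u (sw e z + t%:C%C *: sw e v)) //.
  by apply/funext => t; rewrite /= swD swZ.
rewrite dirderive_sw.
by apply: (@continuous_comp _ _ _ (sw e)); [exact: sw_cvg|exact: h2].
Qed.

Lemma pluriharmonic_sw e (A : set 'C2[R]) u : pluriharmonic_on A u ->
  pluriharmonic_on (sw e @^-1` A) (u \o sw e).
Proof.
move=> [oA [h1 h2] h3]; split.
- by apply: open_comp => // z _; exact: sw_cvg.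
- split; first exact: of_class_C1_sw.
  by move=> v; rewrite dirderive_sw; exact: of_class_C1_sw (h2 _).
by move=> z b Az; rewrite !dirderive_sw /= swZ; exact: h3.
Qed.

Lemma plurisubharmonic_sw e u : plurisubharmonic (fun z => (u z)%:E) ->
  plurisubharmonic (fun z => (u (sw e z))%:E).
Proof.
move=> [h1 h2 h3]; split; first by move=> z; exact: h1.
- move=> z a /h2[V Vz hV]; exists (sw e @^-1` V); first exact: sw_cvg Vz.
  by move=> w Vw; exact: hV.
move=> z b; have := h3 (sw e z) (sw e b).
rewrite (_ : (fun t => (u (sw e z + (cos t +i* sin t)%C *: sw e b))%:E) =
  fun t => (u (sw e (z + (cos t +i* sin t)%C *: b)))%:E) //.
by apply/funext => t; rewrite swD swZ.
Qed.

End Swap.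

(** * Compositions of Henon maps *)

Section Henon.
Variables (R : realType) (k s : nat) (M : set 'rV[R[i]]_k) (deg : 'I_s -> nat).
Variables (p : 'I_s -> 'rV[R[i]]_k -> {poly R[i]}) (a : 'I_s -> 'rV[R[i]]_k ->
  R[i]).
Hypothesis M_compact : compact M.
Hypothesis s_gt0 : (1 <= s)%N.
Hypothesis deg_ge2 : forall j, (2 <= deg j)%N.
Hypothesis p_monic : forall j l, M l -> p j l \is monic.
Hypothesis p_degree : forall j l, M l -> size (p j l) = (deg j).+1.
Hypothesis p_continuous : forall j (i : nat),
  {within M, continuous (fun l => (p j l)`_i)}.
Hypothesis a_continuous : forall j, {within M, continuous (a j)}.
Hypothesis a_neq0 : forall j l, M l -> a j l != 0.
Local Notation param := 'rV[R[i]]_k.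
Implicit Types (e : bool) (L : nat -> param) (l : param) (z : 'C2[R]).

Let d := (\prod_(j < s) deg j)%N.
Let X := seq_space M.

(** Step [m] is factor [m %% s] of the map number [m %/ s]; inverting a composition reverses its
    factors, hence [rev_ord] for the minus sign. *)
Definition factor_index e m : 'I_s :=
  let j := Ordinal (ltn_pmod m s_gt0) in if e then j else rev_ord j.

Definition factor_param L m : param := L (m %/ s)%N.

Definition fpoly e j l : {poly R[i]} :=
  if e then p j l else (a j l)^-1 *: p j l.

Definition fjac e j l : R[i] := if e then a j l else (a j l)^-1.

Definition qseq e L m := fpoly e (factor_index e m) (factor_param L m).

Definition bseq e L m := fjac e (factor_index e m) (factor_param L m).

Definition nseq e m := deg (factor_index e m).

Lemma factor_index_shift e n j : factor_index e (n * s + j) = factor_index e j.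
Proof.
by rewrite /factor_index; case: e; [|congr rev_ord]; apply/val_inj;
  rewrite /= modnMDl.
Qed.

Lemma factor_param_shift L n j : (j < s)%N -> factor_param L (n * s + j) = L n.
Proof. by move=> js; rewrite /factor_param divnMDl // divn_small // addn0. Qed.

Lemma factor_index_small e (i : 'I_s) :
  factor_index e i = if e then i else rev_ord i.
Proof.
by rewrite /factor_index; case: e; [|congr rev_ord]; apply/val_inj;
  rewrite /= modn_small.
Qed.

Lemma qstep_false j l z :
  qstep (fpoly false j l) (fjac false j l) (sw false z) =
  sw false (henon_factor_inv p a j l z).
Proof.
rewrite /qstep /sw /fpoly /fjac /henon_factor_inv /=; congr pair.
by rewrite hornerZ; ring.
Qed.

Lemma henon_pm_foldl e l z : sw e (henon_pm p a e l z) =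
  foldl (fun w (i : 'I_s) => qstep (fpoly e (factor_index e i) l)
    (fjac e (factor_index e i) l) w) (sw e z) (enum 'I_s).
Proof.
case: e; rewrite /henon_pm.
  rewrite /sw /henon; congr foldl.
  by apply/funext => w; apply/funext => i; rewrite factor_index_small.
rewrite /henon_inv -foldl_rev.
(* [henon_inv] folds from the right, that is from the left over the reversed list; this matches the
   reversal in [factor_index]. *)
have -> : rev (enum 'I_s) = [seq rev_ord i | i <- enum 'I_s].
  apply: (inj_map val_inj); rewrite map_rev val_enum_ord -map_comp.
  apply: (@eq_from_nth _ 0%N) => [|i]; rewrite size_rev size_iota.
    by rewrite size_map size_enum_ord.
  move=> is_; rewrite nth_rev ?size_iota // nth_iota ?subn_gt0 ?ltn_subrL //.
    rewrite (nth_map (Ordinal s_gt0)) ?size_enum_ord // add0n /=.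
    by rewrite nth_enum_ord.
elim: (enum 'I_s) z => [//|i r IH z].
by cbn [foldl map]; rewrite IH factor_index_small qstep_false.
Qed.

Lemma orb_foldl e L n w j : (j <= s)%N ->
  orb (qseq e L) (bseq e L) (n * s + j) w =
  foldl (fun w (i : 'I_s) => qstep (fpoly e (factor_index e i) (L n))
    (fjac e (factor_index e i) (L n)) w) (orb (qseq e L) (bseq e L) (n * s) w)
    (take j (enum 'I_s)).
Proof.
elim: j => [|j IH] js; first by rewrite addn0 take0.
have i0 : 'I_s by exact: Ordinal s_gt0.
rewrite addnS /= IH ?(ltnW js) // (take_nth i0) ?size_enum_ord // foldl_rcons.
have -> : nth i0 (enum 'I_s) j = Ordinal js by apply/val_inj;
  rewrite /= nth_enum_ord.
by rewrite /qseq /bseq factor_index_shift factor_param_shift.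
Qed.

(** One map is a block of [s] steps. For the minus sign the exchanges of coordinates cancel between
    consecutive factors and remain only at the two ends. *)
Lemma orb_henon_iter e L n z :
  orb (qseq e L) (bseq e L) (n * s) (sw e z) = sw e (henon_iter p a e L n z).
Proof.
elim: n => [|n IH]; first by rewrite mul0n.
rewrite mulSn addnC orb_foldl // IH /= henon_pm_foldl.
by rewrite take_oversize // size_enum_ord.
Qed.

Lemma degprod_block e n : degprod (nseq e) (n * s) = (d ^ n)%N.
Proof.
have h m j : (j <= s)%N -> degprod (nseq e) (m * s + j) =
    (degprod (nseq e) (m * s) * degprod (nseq e) j)%N.
  elim: j => [|j IH] js; first by rewrite addn0 /degprod big_ord0 muln1.
  by rewrite addnS !degprodS IH ?(ltnW js) // mulnA /nseq factor_index_shift.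
elim: n => [|n IH]; first by rewrite mul0n /degprod big_ord0.
rewrite mulSn addnC h // IH expnS mulnC; congr (_ * _)%N.
rewrite /degprod /d; case: e {h IH}.
  by apply: eq_bigr => i _; rewrite /nseq factor_index_small.
rewrite [RHS](reindex_inj rev_ord_inj) /=.
by apply: eq_bigr => i _; rewrite /nseq factor_index_small.
Qed.

Lemma a_inv_continuous j : {within M, continuous (fun l => (a j l)^-1)}.
Proof.
apply/subspace_continuousP => l Ml.
have FF : Filter (within M (nbhs l)) by exact: within_filter.
apply: (cplx_cvgV FF (a_neq0 j Ml)).
by have /subspace_continuousP := @a_continuous j; apply.
Qed.

Lemma fjac_continuous e j : {within M, continuous (fjac e j)}.
Proof. by case: e; [exact: a_continuous|exact: a_inv_continuous]. Qed.

Lemma fpoly_continuous e j (i : nat) : {within M, continuous (fun l =>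
  (fpoly e j l)`_i)}.
Proof.
case: e; first exact: p_continuous.
have -> : (fun l => (fpoly false j l)`_i) = fun l => (a j l)^-1 * (p j l)`_i.
  by apply/funext => l; rewrite coefZ.
apply/subspace_continuousP => l Ml.
have FF : Filter (within M (nbhs l)) by exact: within_filter.
apply: (cplx_cvgM FF).
  by have /subspace_continuousP := @a_inv_continuous j; apply.
by have /subspace_continuousP := @p_continuous j i; apply.
Qed.

Lemma fpoly_size e j l : M l -> size (fpoly e j l) = (deg j).+1.
Proof.
move=> Ml; case: e; rewrite /fpoly ?size_scale ?p_degree //.
by rewrite invr_eq0 a_neq0.
Qed.

Lemma henon_constants : exists (N : nat) (B c : R), [/\ 1 <= B, 0 < c, c <= 1 &
  forall e L, X L -> admissible_seq N B c (nseq e) (qseq e L) (bseq e L)].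
Proof.
pose N := (\max_(j < s) deg j)%N.
have degN j : (deg j <= N)%N by exact: leq_bigmax.
have [C1 h1] := @uniform_bound R (bool * 'I_s)%type _ M (fun ej =>
  fjac ej.1 ej.2)
  (fun ej => bounded_on_compact M_compact (@fjac_continuous ej.1 ej.2)).
have [C2 h2] := @uniform_bound R (bool * 'I_s * 'I_N.+1)%type _ M
  (fun eji l => (fpoly eji.1.1 eji.1.2 l)`_eji.2)
  (fun eji => bounded_on_compact M_compact (@fpoly_continuous eji.1.1 eji.1.2
    eji.2)).
pose B := Num.max 1 (Num.max C1 C2).
have B1 : 1 <= B by rewrite le_max lexx.
have BC1 : C1 <= B by rewrite !le_max lexx orbT.
have BC2 : C2 <= B by rewrite !le_max lexx !orbT.
have B0 : 0 < B by rewrite (lt_le_trans ltr01).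
(* The leading coefficient is 1 for the plus sign and [1 / a] for the minus sign, and [|a| <= B]
   with [B >= 1]; hence the choice of [c]. *)
exists N, B, B^-1; split => //; rewrite ?invr_gt0 ?invf_le1 // => e L XL m.
rewrite /qseq /bseq /nseq; set j := factor_index e m.
have Ml : M (factor_param L m) by exact: XL.
set l := factor_param L m in Ml *.
split; rewrite ?deg_ge2 ?degN ?fpoly_size //.
- move=> i; have [iN|Ni] := ltnP i N.+1.
    by apply: le_trans BC2; have := h2 ((e, j), Ordinal iN) l Ml.
  rewrite nth_default ?cmod0 ?(ltW B0) // fpoly_size //.
  by rewrite (leq_trans _ Ni) // ltnS.
- have lc : lead_coef (p j l) = 1 by apply/monicP; exact: p_monic.
  rewrite /fpoly; case: (e); rewrite ?lead_coefZ lc ?mulr1 ?cmod1 ?invf_le1 //.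
  rewrite cmodV lef_pV2 ?posrE ?cmod_gt0 ?a_neq0 //.
  by apply: le_trans BC1; have := h1 (true, j) l Ml.
- by apply: le_trans BC1; have := h1 (e, j) l Ml.
Qed.

Lemma henon_iter_cons e L l n z :
  henon_iter p a e (seq_cons l L) n.+1 z = henon_iter p a e L n (henon_pm p a e
    l z).
Proof. by elim: n => //= n ->. Qed.

End Henon.

(** * Green functions of the Henon family *)

Section HenonGreen.
Variables (R : realType) (k s : nat) (M : set 'rV[R[i]]_k) (deg : 'I_s -> nat).
Variables (p : 'I_s -> 'rV[R[i]]_k -> {poly R[i]}) (a : 'I_s -> 'rV[R[i]]_k ->
  R[i]).
Hypothesis s_gt0 : (1 <= s)%N.
Hypothesis p_continuous : forall j (i : nat),
  {within M, continuous (fun l => (p j l)`_i)}.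
Hypothesis a_continuous : forall j, {within M, continuous (a j)}.
Hypothesis a_neq0 : forall j l, M l -> a j l != 0.
Local Notation param := 'rV[R[i]]_k.
Implicit Types (e : bool) (L : nat -> param) (l : param) (z : 'C2[R]).

Let d := (\prod_(j < s) deg j)%N.
Let X := seq_space M.

Local Notation qseq e L := (qseq p a s_gt0 e L).
Local Notation bseq e L := (bseq a s_gt0 e L).
Local Notation nseq e := (nseq deg s_gt0 e).

Variables (N : nat) (B c : R).
Hypotheses (B1 : 1 <= B) (c0 : 0 < c) (c1 : c <= 1).
Hypothesis ad : forall e L,
  X L -> admissible_seq N B c (nseq e) (qseq e L) (bseq e L).
Local Notation rad0 := (rad0 N B c).

Definition green e L z : R := lim (green_seq p a d e L n z @[n --> \oo]).

(** The extra [ln 2] accounts for replacing the truncated sup norm by [logplus] of the Euclidean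
    norm. *)
Definition green_rate (r : R) : R := clog N B c r + ln r + ln 2.

Lemma green_seqE e L n z : green_seq p a d e L n z =
  logplus (enorm (henon_iter p a e L n z)) / (degprod (nseq e) (n * s))%:R.
Proof. by rewrite /green_seq degprod_block mulrC. Qed.

Lemma green_limits e L r z : X L -> rad0 <= r -> in_bidisc r z ->
  (forall n, `|green_seq p a d e L n z - green e L z| <= green_rate r / 2 ^+ n)
    /\
  green_approx (nseq e) (qseq e L) (bseq e L) ^~ (sw e z) @ \oo --> green e L z.
Proof.
move=> XL r0 hz; have hz' : in_bidisc r (sw e z) by rewrite /in_bidisc pmax_sw.
have [g hg] := green_approx_limit B1 c0 c1 (ad e XL) r0 hz'.
have r1 : 1 <= r by exact: le_trans (rad0_ge1 N B1 c0 c1) r0.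
have C0 : 0 <= clog N B c r + ln r.
  by rewrite addr_ge0 ?ln_ge0 // clog_ge0.
have rate n : `|green_seq p a d e L n z - g| <= green_rate r / 2 ^+ n.
  have h := hg (n * s)%N; rewrite /green_rate mulrDl.
  have -> : green_seq p a d e L n z - g =
    (green_approx (nseq e) (qseq e L) (bseq e L) (n * s) (sw e z) - g) +
    (green_seq p a d e L n z -
     green_approx (nseq e) (qseq e L) (bseq e L) (n * s) (sw e z)) by ring.
  have le2 : (2 ^+ (n * s))^-1 <= (2 ^+ n)^-1 :> R.
    by rewrite lef_pV2 ?posrE ?exprn_gt0 // ler_weXn2l ?ler1n // leq_pmulr.
  apply: le_trans (ler_normD _ _) (lerD _ _).
    by apply: le_trans h _; rewrite ler_wpM2l.
  have D0 : (0 : R) < (degprod (nseq e) (n * s))%:R.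
    by rewrite ltr0n (degprod_gt0 (ad e XL)).
  rewrite green_seqE /green_approx orb_henon_iter -mulrBl normrM.
  rewrite [X in _ * X]ger0_norm ?invr_ge0 ?(ltW D0) //.
  rewrite ler_pM ?invr_ge0 ?(ltW D0) //; last first.
    exact: le_trans (degprodV_le (ad e XL) _) le2.
  have -> : trunc_norm 1 (sw e (henon_iter p a e L n z)) =
    trunc_norm 1 (henon_iter p a e L n z) by rewrite /trunc_norm pmax_sw.
  have := logplus_enorm_le (henon_iter p a e L n z).
  have := logplus_enorm_ge (henon_iter p a e L n z).
  have l2 : 0 <= ln 2 :> R by rewrite ln_ge0 // ler1n.
  by rewrite ler_norml => h1 h2; apply/andP; split; lra.
have -> : green e L z = g.
  by apply: cvg_lim => //; exact: rate_cvg rate.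
by split; [exact: rate|exact: rate_cvg hg].
Qed.

Lemma green_orbit e L : X L ->
  orbit_green (nseq e) (qseq e L) (bseq e L) (green e L \o sw e).
Proof.
move=> XL w; have [r r0 hr] := @bidisc_exhaust R N B c (pmax w).
have hw : in_bidisc r (sw e w) by rewrite /in_bidisc pmax_sw.
by have [_] := green_limits e XL r0 hw; rewrite swK.
Qed.

Lemma green_sw e L : (green e L \o sw e) \o sw e = green e L.
Proof. by apply/funext => z; rewrite /= swK. Qed.

Lemma green_ge0 e L z : X L -> 0 <= green e L z.
Proof.
move=> XL; have [r r0 hr] := @bidisc_exhaust R N B c (pmax z).
have [_ h] := green_limits e XL r0 hr; apply: (cvgr_to_ge h); apply: nearW => m.
by rewrite /green_approx divr_ge0 // ln_ge0 // trunc_norm_ger.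
Qed.

Lemma green_cvg_family e L : X L ->
  {family compact, green_seq p a d e L @ \oo --> green e L}.
Proof.
move=> XL; apply: compact_cvgP => r eps eps0.
have [r' r0 hr] := @bidisc_exhaust R N B c r.
have hc : (fun n => green_rate r' / 2 ^+ n) @ \oo --> (0 : R).
  apply: (@rate_cvg _ _ _ `|green_rate r'|) => n.
  by rewrite subr0 normrM [X in _ * X]ger0_norm // invr_ge0 exprn_ge0.
have [m _ hm] : \forall n \near \oo, green_rate r' / 2 ^+ n < eps.
  exact: cvgr_lt _ hc _ eps0.
exists m => // n /= /hm hn z zr.
have hz : in_bidisc r' z by exact: le_trans zr hr.
have [h _] := green_limits e XL r0 hz.
by rewrite distrC; exact: le_lt_trans (h n) hn.
Qed.

Lemma green_hoelder e L : X L -> locally_hoelder (green e L).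
Proof.
move=> XL z0; have [r r0 hr] := @bidisc_exhaust R N B c (pmax z0 + 1).
have [al [C [hal [C0 h]]]] := orbit_green_hoelder B1 c0 c1 (ad e XL)
  (green_orbit (e := e) XL) r0.
exists al, C; split => //; exists [set z | pmax (z - z0) < 2^-1].
  by apply/nbhs_pmaxP; exists 2^-1; rewrite ?invr_gt0.
have al0 : 0 <= al by case/andP: hal => /ltW.
have in_r z : pmax (z - z0) < 2^-1 -> in_bidisc r (sw e z).
  move=> hz; rewrite /in_bidisc pmax_sw -(subrK z0 z) (le_trans (pmaxD _ _)) //.
  by move: hz hr; lra.
move=> z w /= hz hw; have := h (sw e z) (sw e w) (in_r _ hz) (in_r _ hw).
rewrite -swB pmax_sw /= !swK => {}h; apply: le_trans (h _) _.
  have -> : z - w = (z - z0) + (z0 - w) by rewrite addrA subrK.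
  by apply: le_trans (pmaxD _ _) _; rewrite (pmaxBC z0); move: hz hw; lra.
rewrite ler_wpM2l //; apply: ge0_ler_powR; rewrite ?nnegrE ?pmax_ge0 //.
  by rewrite (le_trans (pmax_ge0 (z - w))) // pmax_le_enorm.
exact: pmax_le_enorm.
Qed.

Lemma green_plurisubharmonic e L : X L -> plurisubharmonic (fun z =>
  (green e L z)%:E).
Proof.
move=> XL; rewrite -(green_sw e L); apply: plurisubharmonic_sw.
exact: (orbit_green_plurisubharmonic B1 c0 c1 (ad e XL) (green_orbit (e := e)
  XL)).
Qed.

(** [n] maps of [L] applied after [l] are the first [n + 1] maps of [seq_cons l L], so the two
    normalized sequences differ by a factor [d] and a shift of index. *)
Lemma green_henon e l L z : M l -> X L ->
  green e L (henon_pm p a e l z) = d%:R * green e (seq_cons l L) z.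
Proof.
move=> Ml XL; have XlL : X (seq_cons l L) by case.
have [r r0 hr] := @bidisc_exhaust R N B c (Num.max (pmax z) (pmax (henon_pm p a
  e l z))).
move: hr; rewrite ge_max => /andP[h1 h2].
have [k1 _] := green_limits e XL r0 h2.
have [k2 _] := green_limits e XlL r0 h1.
have := rate_cvg k2; rewrite -(cvg_shiftS _) => k3.
have d0 : d%:R != 0 :> R.
  have := degprod_gt0 (ad e XL) (1 * s); rewrite degprod_block expn1 => h.
  by rewrite pnatr_eq0 -lt0n.
have k4 : green_seq p a d e L ^~ (henon_pm p a e l z) @ \oo -->
    d%:R * green e (seq_cons l L) z.
  rewrite (_ : (fun n => _) = d%:R \*:
    (fun n => green_seq p a d e (seq_cons l L) n.+1 z)); first exact: cvgZr.
  apply/funext => n.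
  rewrite -[RHS]/(d%:R * green_seq p a d e (seq_cons l L) n.+1 z) /green_seq.
  by rewrite henon_iter_cons expnS natrM invfM mulrA mulVKf.
exact: (cvg_unique _ (rate_cvg k1) k4).
Qed.

Lemma escaping_cone e L z : X L ->
  (exists m, in_cone rad0 (orb (qseq e L) (bseq e L) m (sw e z))) ->
  escaping_set p a e L z.
Proof.
move=> XL [m hm]; apply/cvgryPge => A.
have [j hj] : exists j : nat, A <= j%:R.
  exists (Num.bound `|A|); apply: le_trans (ler_norm _) (ltW (archi_boundP _)).
  exact: normr_ge0.
exists (j + m)%N => // n /= jn.
have ns : (j + m <= n * s)%N by rewrite (leq_trans jn) // leq_pmulr.
have [_ h] := orb_cone B1 c0 c1 (ad e XL) (n * s - m) (lexx _) hm.
rewrite subnK in h; last by rewrite (leq_trans _ ns) // leq_addl.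
rewrite orb_henon_iter in h.
rewrite -(enorm_sw e); apply: le_trans (pmax_le_enorm _).
apply: le_trans (pmax_ge2 _); apply: le_trans h.
have t1 : 1 <= cmod (orb (qseq e L) (bseq e L) m (sw e z)).2.
  exact: (cone_cmod_ge1 B1 c0 c1 (lexx _) hm).
have e2 : 2 <= expand N B by rewrite (le_trans _ (expand_ge8 N B1)) // ler_nat.
apply: le_trans hj _; rewrite -[leLHS]mulr1 ler_pM // ?ler0n //.
apply: (@le_trans _ _ (2 ^+ (n * s - m))); last first.
  by rewrite lerXn2r ?nnegrE // (le_trans _ e2).
rewrite -natrX ler_nat (leq_trans _ (ltnW (ltn_expl _ (ltnSn 1)))) //.
by rewrite leq_subRL // (leq_trans _ ns) ?leq_addl // addnC.
Qed.

(** For [r >= rad0] the cone of radius [r] lies in that of radius [rad0]; an orbit that misses the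
    latter never leaves a bidisc of such a radius containing its start. *)
Lemma not_cone_bidisc e L z : X L ->
  ~ (exists m, in_cone rad0 (orb (qseq e L) (bseq e L) m (sw e z))) ->
  exists2 r, rad0 <= r & forall m,
    in_bidisc r (orb (qseq e L) (bseq e L) m (sw e z)).
Proof.
move=> XL nh; have [r r0 hr] := @bidisc_exhaust R N B c (pmax (sw e z)).
exists r => // m; have [//|h] := orb_region B1 c0 c1 (ad e XL) m r0 hr.
by case: nh; exists m; exact: in_cone_le h.
Qed.

Lemma not_cone_bounded e L z : X L ->
  ~ (exists m, in_cone rad0 (orb (qseq e L) (bseq e L) m (sw e z))) ->
  bounded_orbit_set p a e L z.
Proof.
move=> XL /(not_cone_bidisc XL)[r r0 hr]; exists (2 * r) => n.
have := hr (n * s)%N; rewrite orb_henon_iter /in_bidisc pmax_sw => h.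
by apply: le_trans (enorm_le_pmax _) _; rewrite ler_wpM2l.
Qed.

Lemma escaping_not_bounded e L z :
  escaping_set p a e L z -> ~ bounded_orbit_set p a e L z.
Proof.
move=> /cvgryPge h [C hC]; have [n0 _ hn] := h (C + 1).
by have := le_trans (hn n0 (leqnn _)) (hC n0); lra.
Qed.

(** Orbits that enter the cone tend to infinity and all others are bounded, so escaping is the same
    as entering the cone. *)
Lemma escapingE e L : X L ->
  escaping_set p a e L = sw e @^-1` escape N B c (qseq e L) (bseq e L).
Proof.
move=> XL; apply/seteqP; split=> z; last exact: escaping_cone.
move=> hz; have [//|h] := pselect (exists m,
  in_cone rad0 (orb (qseq e L) (bseq e L) m (sw e z))).
by have := escaping_not_bounded hz (not_cone_bounded XL h).
Qed.

Lemma escaping_complement e L : X L ->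
  escaping_set p a e L = ~` bounded_orbit_set p a e L.
Proof.
move=> XL; apply/seteqP; split=> z; first exact: escaping_not_bounded.
move=> nb; apply: escaping_cone => //.
by have [//|/(not_cone_bounded XL)] :=
  pselect (exists m, in_cone rad0 (orb (qseq e L) (bseq e L) m (sw e z))).
Qed.

Lemma green_gt0 e L z : X L -> escaping_set p a e L z -> 0 < green e L z.
Proof.
move=> XL; rewrite escapingE // => -[m hm].
have := orbit_green_gt0 B1 c0 c1 (ad e XL) (green_orbit (e := e) XL) hm.
by rewrite /= swK.
Qed.

Lemma green_eq0 e L z : X L ->
  green e L z = 0 <-> bounded_orbit_set p a e L z.
Proof.
move=> XL; split=> [g0|hb].
  have [//|nb] := pselect (bounded_orbit_set p a e L z).
  have : escaping_set p a e L z by rewrite escaping_complement.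
  by move=> /(green_gt0 XL); rewrite g0 ltxx.
have nh : ~ (exists m, in_cone rad0 (orb (qseq e L) (bseq e L) m (sw e z))).
  by move=> /(escaping_cone XL)/escaping_not_bounded.
have [r r0 hr] := not_cone_bidisc XL nh.
have := orbit_green_eq0 B1 c0 c1 (ad e XL) (green_orbit (e := e) XL) r0 hr.
by rewrite /= swK.
Qed.

Lemma green_pluriharmonic e L : X L ->
  pluriharmonic_on (escaping_set p a e L) (green e L).
Proof.
move=> XL; rewrite escapingE // -(green_sw e L); apply: pluriharmonic_sw.
exact: (orbit_green_pluriharmonic B1 c0 c1 (ad e XL) (green_orbit (e := e) XL)).
Qed.

Lemma green_le e L z : X L -> green e L z <= logplus (enorm z) + ln (cup N B).
Proof.
move=> XL; have := orbit_green_le B1 (ad e XL) (sw e z) (green_orbit (e := e)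
  XL).
rewrite /= swK => /le_trans; apply; rewrite lerD2r.
apply: le_trans (logplus_enorm_ge _).
by rewrite /trunc_norm pmax_sw.
Qed.

Lemma proj_within_cvg (f : param -> R[i]) i L : {within M,
  continuous f} -> X L ->
  (fun L' => f (L' i)) @ within (X : set {ptws nat -> param})
    (nbhs (L : {ptws nat -> param})) --> f (L i).
Proof.
move=> /subspace_continuousP fc XL U hU.
have h : nbhs (L i) [set l | M l -> U (f l)] := fc _ (XL i) _ hU.
have h' : nbhs (L : {ptws nat -> param})
    [set L' : {ptws nat -> param} | M (L' i) -> U (f (L' i))].
  exact: (@proj_continuous nat (fun=> param) i L _ h).
rewrite /fmap /within /=.
apply: (@filterS _ (nbhs (L : {ptws nat -> param})) (nbhs_filter _) _ _ _ h').
by move=> L' hL' XL'; apply: hL'; exact: XL'.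
Qed.

Lemma near_forall_ltn (T : Type) (F : set_system T) (FF : Filter F) m
    (P : nat -> T -> Prop) :
  (forall i, (i < m)%N -> \forall t \near F, P i t) ->
  \forall t \near F, forall i, (i < m)%N -> P i t.
Proof.
elim: m => [|m IH] h; first by apply: nearW.
have h1 := IH (fun i im => h i (ltnW im)); have h2 := h m (ltnSn m).
apply: filterS2 h1 h2 => t h1 h2 i.
by rewrite ltnS leq_eqVlt => /orP[/eqP->//|]; exact: h1.
Qed.

(** For a given precision [ccmp / 2 ^+ m] only the first [m] factors need be close. They involve
    finitely many coordinates of Lambda, so closeness holds on a neighbourhood in the product
    topology. *)
Lemma green_continuous e :
  {within (X : set {ptws nat -> param}),
    continuous (green e : {ptws nat -> param} -> {family compact,
      'C2[R] -> R})}.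
Proof.
apply/subspace_continuousP => L XL.
have FF : Filter (within (X : set {ptws nat -> param}) (nbhs (L : {ptws nat ->
  param}))).
  exact: within_filter.
apply: compact_cvgP => r eps eps0.
have [r' r0 hr] := @bidisc_exhaust R N B c r.
have r1 : 1 <= r' by exact: le_trans (rad0_ge1 N B1 c0 c1) r0.
have [m hm] : exists m : nat, ccmp N B c r' / 2 ^+ m < eps.
  have hc : (fun n => ccmp N B c r' / 2 ^+ n) @ \oo --> (0 : R).
    apply: (@rate_cvg _ _ _ (ccmp N B c r')) => n.
    by rewrite subr0 ger0_norm // divr_ge0 ?ccmp_ge0 // exprn_ge0.
  have [m _ hm] := cvgr_lt _ hc _ eps0.
  by exists m; exact: (hm m (leqnn m)).
(* The largest tolerance for which the two orbits can be compared up to time [m]. *)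
pose th := (spread N B c r' ^+ m)^-1.
have sp0 : 0 < spread N B c r' by rewrite (lt_le_trans _ (spread_ge2 N B1 c0 c1
  r1)).
have th0 : 0 < th by rewrite invr_gt0 exprn_gt0.
have nq : \forall L' \near within (X : set {ptws nat -> param}) (nbhs (L :
  {ptws nat -> param})),
    forall i, (i < m)%N -> forall j, (j < N.+1)%N ->
      cmod ((qseq e L' i)`_j - (qseq e L i)`_j) < th.
  apply: near_forall_ltn => i _; apply: near_forall_ltn => j _.
  have fc := @fpoly_continuous R k s M p a p_continuous a_continuous a_neq0 e
    (factor_index s_gt0 e i) j.
  by have /cvg_cmodP := @proj_within_cvg _ (i %/ s)%N L fc XL; apply.
have nb : \forall L' \near within (X : set {ptws nat -> param}) (nbhs (L :
  {ptws nat -> param})),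
    forall i, (i < m)%N -> cmod (bseq e L' i - bseq e L i) < th.
  apply: near_forall_ltn => i _.
  have fc := @fjac_continuous R k s M a a_continuous a_neq0 e (factor_index
    s_gt0 e i).
  by have /cvg_cmodP := @proj_within_cvg _ (i %/ s)%N L fc XL; apply.
have nX : \forall L' \near within (X : set {ptws nat -> param}) (nbhs (L :
  {ptws nat -> param})), X L'.
  exact: (@withinT _ (nbhs (L : {ptws nat -> param})) X (nbhs_filter _)).
apply: filterS3 nq nb nX => L' hq hb XL' z zr.
have hz : in_bidisc r' (sw e z) by rewrite /in_bidisc pmax_sw (le_trans zr).
have := orbit_green_close B1 c0 c1 (ad e XL) (ad e XL') (green_orbit (e := e)
  XL)
  (green_orbit (e := e) XL') r0 hz hz (ltW th0).
move=> /(_ m); rewrite /= !swK => h; apply: le_lt_trans hm; apply: h.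
- by rewrite subrr -(scale0r z) pmaxZ cmod0 mul0r ltW.
- move=> i j im; rewrite cmodBC; have [jN|Nj] := ltnP j N.+1;
  first exact: ltW (hq i im j jN).
  have big L1 : X L1 -> (qseq e L1 i)`_j = 0.
    move=> XL1; have [/andP[_ nN] sq _ _ _] := ad e XL1 i.
    by rewrite nth_default // sq (leq_trans _ Nj).
  by rewrite !big // subrr cmod0 ltW.
- by move=> i im; rewrite cmodBC; exact: ltW (hb i im).
by rewrite /th divff // expf_neq0 // gt_eqF.
Qed.

End HenonGreen.

Theorem proposition1p1 (R : realType) (k s : nat) (M : set 'rV[R[i]]_k)
    (deg : 'I_s -> nat)
    (p : 'I_s -> 'rV[R[i]]_k -> {poly R[i]})
    (a : 'I_s -> 'rV[R[i]]_k -> R[i])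
    (M_compact : compact M)
    (s_gt0 : (1 <= s)%N)
    (deg_ge2 : forall j, (2 <= deg j)%N)
    (p_monic : forall j l, M l -> p j l \is monic)
    (p_degree : forall j l, M l -> size (p j l) = (deg j).+1)
    (p_continuous : forall j (i : nat),
       {within M, continuous (fun l => (p j l)`_i)})
    (a_continuous : forall j, {within M, continuous (a j)})
    (a_neq0 : forall j l, M l -> a j l != 0) :
  let d := (\prod_(j < s) deg j)%N in
  let X := seq_space M in
  exists G : bool -> (nat -> 'rV[R[i]]_k) -> 'C2[R] -> R,
    [/\ forall e L, X L ->
          [/\ {family compact, green_seq p a d e L @ \oo --> G e L},
              forall z, 0 <= G e L z,
              locally_hoelder (G e L) &
              plurisubharmonic (fun z => (G e L z)%:E)],
        forall e l L, M l -> X L -> forall z,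
          G e L (henon_pm p a e l z) = d%:R * G e (seq_cons l L) z,
        forall e L, X L ->
          [/\ escaping_set p a e L = ~` bounded_orbit_set p a e L,
              forall z, escaping_set p a e L z -> 0 < G e L z,
              pluriharmonic_on (escaping_set p a e L) (G e L) &
              forall z, G e L z = 0 <-> bounded_orbit_set p a e L z],
        exists2 C : R, 0 < C &
          forall e L, X L -> forall z,
            0 <= G e L z <= logplus (enorm z) + C &
        forall e,
          {within (X : set {ptws nat -> 'rV[R[i]]_k}),
            continuous (G e : {ptws nat -> 'rV[R[i]]_k} ->
                              {family compact, 'C2[R] -> R})}].
Proof.
move=> d X.
have [N [B [c [B1 c0 c1 ad]]]] := henon_constants M_compact s_gt0 deg_ge2
  p_monic
  p_degree p_continuous a_continuous a_neq0.
exists (@green R k s deg p a); split.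
- move=> e L XL; split.
  + exact: (green_cvg_family B1 c0 c1 ad).
  + by move=> z; exact: (green_ge0 B1 c0 c1 ad).
  + exact: (green_hoelder B1 c0 c1 ad).
  + exact: (green_plurisubharmonic B1 c0 c1 ad).
- by move=> e l L Ml XL z; exact: (green_henon B1 c0 c1 ad).
- move=> e L XL; split.
  + exact: (escaping_complement B1 c0 c1 ad).
  + by move=> z; exact: (green_gt0 B1 c0 c1 ad).
  + exact: (green_pluriharmonic B1 c0 c1 ad).
  + by move=> z; exact: (green_eq0 B1 c0 c1 ad).
- exists (ln (cup N B)).
    by rewrite ln_gt0 // (lt_le_trans _ (cup_ge2 N B1)) // ltr1n.
  move=> e L XL z; rewrite (green_ge0 B1 c0 c1 ad) //=.
  exact: (green_le B1 c0 c1 ad).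
by move=> e; exact: (green_continuous p_continuous a_continuous a_neq0 B1 c0 c1
  ad).
Qed.
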